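(* Let $(\mathcal{P},\omega)$ be a substitution tiling system in $\mathbb{R}^d$ (satisfying the standing assumptions listed in the context). Suppose that $G$ is a finite symmetry group for $(\mathcal{P},\omega)$ and that $G$ acts freely on $\mathcal{P}$. Then $\mathcal{R}_{\mathrm{punc}}\rtimes G$ is an almost AF Cantor groupoid with respect to the AF subgroupoid $\mathcal{R}_{AF}\rtimes G$; that is, it satisfies the definition of an almost AF Cantor groupoid with $\mathscr{G}=\mathcal{R}_{\mathrm{punc}}\rtimes G$ and $\mathscr{G}_0=\mathcal{R}_{AF}\rtimes G$.
   Context: TILINGS. Fix $d\ge 1$. A tile is a subset of $\mathbb{R}^d$ homeomorphic to the closed unit ball, possibly carrying a label (tiles with different labels are different; translates keep the label). A partial tiling is a collection of tiles with pairwise disjoint interiors; a patch is a finite partial tiling; $\mathrm{supp}(P)$ is the union of the tiles of $P$; a tiling is a partial tiling with support $\mathbb{R}^d$. For a partial tiling $T$, $U\subset\mathbb{R}^d$ and $x\in\mathbb{R}^d$, put $T(U)=\{t\in T: t\cap U\ne\emptyset\}$ and $T+x=\{t+x: t\in T\}$. $\mathcal{P}$ is a finite set of tiles (prototiles), each containing the origin in its interior, such that $p+x=q$ with $p,q\in\mathcal{P}$ forces $x=0$; moreover there are an integer $n_{\mathrm{cap}}<d$ and a constant $K$ such that for every $0<\varepsilon\le1$ the boundary of each prototile can be covered by at most $K\varepsilon^{-n_{\mathrm{cap}}}$ balls of radius $\varepsilon$. $\mathcal{P}^*$ is the set of partial tilings consisting of translates of prototiles. A substitution rule is a map $\omega:\mathcal{P}\to\mathcal{P}^*$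 for which there is $\lambda>1$ with $\mathrm{supp}(\omega(p))=\lambda p$ for all $p$; it extends to $\mathcal{P}^*\to\mathcal{P}^*$ by $\omega(p+x)=\omega(p)+\lambda x$ and taking unions. $(\mathcal{P},\omega)$ is a substitution tiling system. $\Omega$ is the set of tilings $T\in\mathcal{P}^*$ such that every patch in $T$ is contained in $\omega^n(p)+x$ for some $n\in\mathbb{N}$, $p\in\mathcal{P}$, $x\in\mathbb{R}^d$. Standing assumptions: (primitivity) there is $N$ such that $\omega^N(p)$ contains a translate of $q$ for all $p,q\in\mathcal{P}$; (finite local complexity) for every $T\in\Omega$ and $R>0$ there are, up to translation, finitely many patches in $T$ with support of diameter less than $R$; (injectivity) $\omega:\Omega\to\Omega$ is injective; (border forcing) there is $n$ such that for all $p\in\mathcal{P}$, whenever $\omega^n(p)+x\subset T$ and $\omega^n(p)+x'\subset T'$ with $T,T'\in\Omega$, then $T(\mathrm{supp}(\omega^n(p)+x))-x=T'(\mathrm{supp}(\omega^n(p)+x'))-x'$. The puncture of a tile $t=p+x$ ($p\in\mathcal{P}$) is $\mathbf{x}(t)=x$. $\Omega_{\mathrm{punc}}$ is the set of $T\in\Omega$ containing a tile whose puncture is $0$; its topology has as a basis of clopen sets the $U(P,t)=\{T\in\Omega_{\mathrm{punc}}: P-\mathbf{x}(t)\subset T\}$, $P$ a patch of a tiling in $\Omega$, $t\in P$; it is a Cantor set. SYMMETRY GROUPS. A symmetry group for $(\mathcal{P},\omega)$ is a subgroup $G$ of $O(d,\mathbb{R})$ such that $G$ acts on $\mathcal{P}$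 from the left by $p\mapsto gp=\{gx:x\in p\}$ and $\omega(gp)=g\omega(p)$ for $g\in G$, $p\in\mathcal{P}$. It then acts on tiles by $g(p+x)=gp+gx$ and on (partial) tilings by $gT=\{gt:t\in T\}$. GROUPOIDS. $\mathcal{R}_{\mathrm{punc}}=\{(T,T+x): T,T+x\in\Omega_{\mathrm{punc}}, x\in\mathbb{R}^d\}$ is an equivalence relation, viewed as a groupoid with unit space $\Omega_{\mathrm{punc}}$, $r(T,T')=T$, $s(T,T')=T'$; its (étale) topology is generated by the sets $V(P,t_1,t_2)=\{(T,T')\in\mathcal{R}_{\mathrm{punc}}: P-\mathbf{x}(t_1)\subset T,\ T'=T+\mathbf{x}(t_1)-\mathbf{x}(t_2)\}$, $P$ a patch of a tiling in $\Omega$, $t_1,t_2\in P$. Each $T\in\Omega$ decomposes uniquely into $n$th-order supertiles $\omega^n(t)$ (namely $t\in\omega^{-n}(T)$). $\mathcal{R}_n\subset\mathcal{R}_{\mathrm{punc}}$ is the set of $(T,T-x)$ such that $0$ and $x$ are punctures of tiles in the same $n$th-order supertile of $T$; $\mathcal{R}_{AF}=\bigcup_n\mathcal{R}_n$. $G$ acts on $\mathcal{R}_{\mathrm{punc}}$ (and $\mathcal{R}_{AF}$) by $\alpha_g(T,T')=(gT,gT')$. The semidirect product $\mathscr{G}\rtimes G$ of a groupoid $\mathscr{G}$ by an action $\alpha$ of a discrete group $G$ is $\mathscr{G}\times G$ with the product topology; writing $\gamma\cdot g=\alpha_{g^{-1}}(\gamma)$, the product is $(\gamma,g)(\eta\cdot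 g,h)=(\gamma\eta,gh)$ for $\gamma,\eta$ composable, and $(\gamma,g)^{-1}=(\gamma^{-1}\cdot g,g^{-1})$; its unit space is identified with $\mathscr{G}^{(0)}$, so $r(\gamma,g)=r(\gamma)$, $s(\gamma,g)=s(\gamma)\cdot g$. An étale groupoid is a locally compact, Hausdorff, second countable groupoid with $r,s$ local homeomorphisms; it is a Cantor groupoid if its unit space is homeomorphic to the Cantor set. A groupoid is principal if for all units $x,y$ there is at most one $\gamma$ with $r(\gamma)=x,s(\gamma)=y$. Subgroupoids are understood to have the same unit space. A Cantor groupoid is AF if it is an increasing union of a sequence of compact open principal Cantor subgroupoids, each containing the unit space. A graph in $\mathscr{G}$ is a subset on which $r$ and $s$ are injective. A compact $K\subset\mathscr{G}^{(0)}$ is thin for $\mathscr{G}$ if for every $n$ there are compact graphs $S_1,\dots,S_n\subset\mathscr{G}$ with $s(S_k)=K$ and $r(S_1),\dots,r(S_n)$ pairwise disjoint. A subset $E\subset\mathscr{G}^{(0)}$ is invariant if $s(\gamma)\in E$ implies $r(\gamma)\in E$. A measure $\mu$ on $\mathscr{G}^{(0)}$ is $\mathscr{G}$-invariant if $\mu(r(S))=\mu(s(S))$ for every open graph $S$. A Cantor groupoid $\mathscr{G}$ is an almost AF Cantor groupoid (with respect to $\mathscr{G}_0$) if: (1) $\mathscr{G}_0\subset\mathscr{G}$ is an open AF subgroupoid containing the unit space such that for every compact $K\subset\mathscr{G}\setminus\mathscr{G}_0$ the set $s(K)$ is thin for $\mathscr{G}_0$; and (2) for every closed invariant $E\subset\mathscr{G}^{(0)}$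 and every nonempty relatively open $U\subset E$ there is a $\mathscr{G}$-invariant Borel probability measure $\mu$ on $\mathscr{G}^{(0)}$ with $\mu(U)>0$. *)

(* Defs.v *)
From HB Require Import structures.
From mathcomp Require Import all_boot all_order all_algebra.
From mathcomp Require Import all_classical all_reals all_analysis.

Set Implicit Arguments.
Unset Strict Implicit.
Unset Printing Implicit Defensive.

Import Order.TTheory GRing.Theory Num.Theory.
Import numFieldNormedType.Exports.

Local Open Scope classical_set_scope.
Local Open Scope ring_scope.

Definition homeomorphic (T U : topologicalType) : Prop :=
  exists (f : T -> U) (g : U -> T),
    [/\ cancel f g, cancel g f, continuous f & continuous g].

Section relative_topology.
Variable X : topologicalType.

Definition rel_open (C U : set X) : Prop :=
  exists2 O : set X, open O & U = C `&` O.

Definition rel_closed (C F : set X) : Prop :=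
  exists2 D : set X, closed D & F = C `&` D.

(* [f] maps the subspace [C] to the subspace [D] and is a local homeomorphism
   between them. *)
Definition local_homeomorphism (C D : set X) (f : X -> X) : Prop :=
  f @` C `<=` D /\
  forall x, C x -> exists U : set X,
    [/\ rel_open C U, U x, rel_open D (f @` U) &
        exists g : X -> X, [/\ {in U, cancel f g}, {within U, continuous f} &
                              {within f @` U, continuous g}]].

End relative_topology.

(* The operations are total functions on an ambient space [X]; a groupoid is a
   subset [C] of [X] on which they satisfy the groupoid axioms, with the
   subspace topology. Products are meaningful only for [gsrc a = grng b]. *)
Record groupoid_ops (X : Type) := GroupoidOps {
  grng : X -> X;
  gsrc : X -> X;
  gmul : X -> X -> X;
  ginv : X -> X }.

Section groupoids.
Variables (X : ptopologicalType) (O : groupoid_ops X).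

Local Notation r := (grng O).
Local Notation s := (gsrc O).

Definition units (C : set X) : set X := r @` C.

Definition composable (C : set X) : set (X * X) :=
  [set p | [/\ C p.1, C p.2 & s p.1 = r p.2]].

Record is_groupoid (C : set X) : Prop := IsGroupoid {
  groupoid_rng : forall a, C a -> C (r a);
  groupoid_src : forall a, C a -> C (s a);
  groupoid_mul : forall a b, composable C (a, b) -> C (gmul O a b);
  groupoid_inv : forall a, C a -> C (ginv O a);
  groupoid_rng_unit : forall a, C a -> r (r a) = r a /\ s (r a) = r a;
  groupoid_src_unit : forall a, C a -> r (s a) = s a /\ s (s a) = s a;
  groupoid_rng_mul :
    forall a b, composable C (a, b) -> r (gmul O a b) = r a;
  groupoid_src_mul :
    forall a b, composable C (a, b) -> s (gmul O a b) = s b;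
  groupoid_mulA : forall a b c, composable C (a, b) -> composable C (b, c) ->
    gmul O a (gmul O b c) = gmul O (gmul O a b) c;
  groupoid_mul1 : forall a, C a -> gmul O (r a) a = a /\ gmul O a (s a) = a;
  groupoid_rng_inv : forall a, C a -> r (ginv O a) = s a;
  groupoid_src_inv : forall a, C a -> s (ginv O a) = r a;
  groupoid_mulV : forall a, C a ->
    gmul O a (ginv O a) = r a /\ gmul O (ginv O a) a = s a }.

Record etale (C : set X) : Prop := Etale {
  etale_groupoid : is_groupoid C;
  etale_mul : {within composable C, continuous (fun p => gmul O p.1 p.2)};
  etale_inv : {within C, continuous (ginv O)};
  etale_locally_compact : locally_compact [set: set_type C];
  etale_hausdorff : hausdorff_space (set_type C);
  etale_second_countable : @second_countable (set_type C);
  etale_rng : local_homeomorphism C (units C) r;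
  etale_src : local_homeomorphism C (units C) s }.

Definition cantor_groupoid (C : set X) : Prop :=
  etale C /\ homeomorphic (set_type (units C)) cantor_space.

Definition principal (C : set X) : Prop :=
  forall x y a b, units C x -> units C y -> C a -> C b ->
    r a = x -> s a = y -> r b = x -> s b = y -> a = b.

Definition subgroupoid (C H : set X) : Prop :=
  [/\ H `<=` C, units C `<=` H,
      forall a b, composable H (a, b) -> H (gmul O a b) &
      forall a, H a -> H (ginv O a)].

Definition AF_groupoid (C : set X) : Prop :=
  cantor_groupoid C /\
  exists K : nat -> set X,
    [/\ forall n, [/\ subgroupoid C (K n), compact (K n), rel_open C (K n),
                      principal (K n) & cantor_groupoid (K n)],
        forall n, K n `<=` K n.+1 &
        C = \bigcup_n K n].

Definition graph (C S : set X) : Prop :=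
  [/\ S `<=` C, set_inj S r & set_inj S s].

Definition thin (C K : set X) : Prop :=
  [/\ K `<=` units C, compact K &
      forall n : nat, exists S : 'I_n -> set X,
        [/\ forall k, graph C (S k) /\ compact (S k),
            forall k, s @` S k = K &
            forall k l, k != l -> (r @` S k) `&` (r @` S l) = set0]].

Definition invariant_set (C E : set X) : Prop :=
  E `<=` units C /\ forall a, C a -> E (s a) -> E (r a).

(* Library measures live on pointed types, so a Borel measure on the unit space
   is a measure on [X] for the sigma-algebra generated by the relatively open
   subsets of [units C]; the probability measures on the unit space are those
   with [mu (units C) = 1]. *)
Definition borel_units (C : set X) : Type :=
  g_sigma_algebraType (rel_open (units C)).

HB.instance Definition _ (C : set X) :=
  Measurable.copy (borel_units C) (g_sigma_algebraType (rel_open (units C))).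

Definition invariant_measure (R : realType) (C : set X)
    (mu : set (borel_units C) -> \bar R) : Prop :=
  forall S : set X, graph C S -> rel_open C S -> mu (r @` S) = mu (s @` S).

Definition almost_AF_cantor_groupoid (R : realType) (C C0 : set X) : Prop :=
  [/\ cantor_groupoid C,
      [/\ subgroupoid C C0, rel_open C C0, AF_groupoid C0 &
          forall K : set X, compact K -> K `<=` C `\` C0 -> thin C0 (s @` K)] &
      forall E U : set X, invariant_set C E -> rel_closed (units C) E ->
        rel_open E U -> U !=set0 ->
        exists mu : probability (borel_units C) R,
          [/\ mu (units C) = 1%E, invariant_measure mu & (0 < mu U)%E]].

End groupoids.

Definition semidirect (X : Type) (R : realType) (d : nat) : Type :=
  (X * discrete_topology 'M[R]_d)%type.

HB.instance Definition _ (X : ptopologicalType) (R : realType) (d : nat) :=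
  Pointed.copy (semidirect X R d) (X * discrete_topology 'M[R]_d)%type.
HB.instance Definition _ (X : ptopologicalType) (R : realType) (d : nat) :=
  Topological.copy (semidirect X R d) (X * discrete_topology 'M[R]_d)%type.

(* With gamma . g = alpha_{g^-1} gamma, an element (delta, h) is
   (eta . g, h) for eta = alpha_g delta, so that
   (gamma, g)(delta, h) = (gamma (alpha_g delta), gh). *)
Definition semidirect_ops (X : Type) (R : realType) (d : nat)
    (O : groupoid_ops X) (alpha : 'M[R]_d -> X -> X) :
    groupoid_ops (semidirect X R d) :=
  GroupoidOps
    (fun a : semidirect X R d => (grng O a.1, 1%:M))
    (fun a => (alpha (invmx a.2) (gsrc O a.1), 1%:M))
    (fun a b => (gmul O a.1 (alpha a.2 b.1), a.2 *m b.2))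
    (fun a => (alpha (invmx a.2) (ginv O a.1), invmx a.2)).

(* R^d consists of column vectors. Balls and diameters are Euclidean, while the
   norm of the library on ['cV[R]_d] is the sup norm (with the same topology). *)
Section euclidean.
Variables (R : realType) (d : nat).

Definition enorm (x : 'cV[R]_d) : R := Num.sqrt (\sum_i x i 0 ^+ 2).

Definition eball (c : 'cV[R]_d) (e : R) : set 'cV[R]_d :=
  [set y | enorm (y - c) < e].

Definition closed_unit_ball : set 'cV[R]_d := [set y | enorm y <= 1].

Definition ediam (A : set 'cV[R]_d) : \bar R :=
  ereal_sup [set (enorm (x - y))%:E | x in A & y in A].

Definition boundary (A : set 'cV[R]_d) : set 'cV[R]_d := closure A `\` A°.

End euclidean.

Section tilings.
Variables (R : realType) (d : nat) (L : Type).

Local Notation V := 'cV[R]_d.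

(* A labelled subset of R^d; unlabelled tiles are the case [L := unit]. *)
Definition ltile : Type := (set V * L)%type.

Definition is_tile (t : ltile) : Prop :=
  homeomorphic (set_type t.1) (set_type (@closed_unit_ball R d)).

Definition shift_tile (x : V) (t : ltile) : ltile :=
  ([set y + x | y in t.1], t.2).

Definition shift (x : V) (T : set ltile) : set ltile := shift_tile x @` T.

Definition partial_tiling (T : set ltile) : Prop :=
  (forall t, T t -> is_tile t) /\
  (forall t u, T t -> T u -> t <> u -> (t.1)° `&` (u.1)° = set0).

Definition patch (T : set ltile) : Prop := partial_tiling T /\ finite_set T.

Definition supp (T : set ltile) : set V := \bigcup_(t in T) t.1.

Definition tiles_meeting (T : set ltile) (U : set V) : set ltile :=
  [set t | T t /\ t.1 `&` U !=set0].

(* The substitution is a function on all labelled sets, of which only the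
   values on prototiles are used. *)
Record substitution_data := SubstitutionData {
  prototiles : set ltile;
  subst : ltile -> set ltile;
  expansion : R }.

Variable S : substitution_data.

Local Notation P := (prototiles S).
Local Notation lam := (expansion S).

Definition Pstar : set (set ltile) :=
  [set T | partial_tiling T /\
           forall t, T t -> exists p x, P p /\ t = shift_tile x p].

Record prototile_set : Prop := PrototileSet {
  prototiles_finite : finite_set P;
  prototiles_neq0 : P !=set0;
  prototiles_tile : forall p, P p -> is_tile p;
  prototiles_origin : forall p, P p -> (p.1)° 0;
  prototiles_transl :
    forall p q x, P p -> P q -> shift_tile x p = q -> x = 0;
  prototiles_boundary : exists (ncap : int) (K : R), (ncap < d%:Z)%R /\
    forall (eps : R) p, 0 < eps -> eps <= 1 -> P p ->
      exists c : seq V, (size c)%:R <= K * eps ^ (- ncap) /\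
        boundary p.1 `<=` [set y | exists2 z, z \in c & eball z eps y] }.

Definition substitution_rule : Prop :=
  1 < lam /\
  forall p, P p -> Pstar (subst S p) /\
                   supp (subst S p) = [set lam *: y | y in p.1].

Definition substitution_tiling_system : Prop :=
  prototile_set /\ substitution_rule.

Definition omega (T : set ltile) : set ltile :=
  [set u | exists p x, [/\ P p, T (shift_tile x p) &
                           shift (lam *: x) (subst S p) u]].

Definition supertile (n : nat) (t : ltile) : set ltile := iter n omega [set t].

Definition Omega : set (set ltile) :=
  [set T | [/\ Pstar T, supp T = setT &
     forall Q, Q `<=` T -> patch Q ->
       exists n p x, P p /\ Q `<=` shift x (supertile n p)]].

Definition primitive : Prop :=
  exists N, forall p q, P p -> P q ->
    exists x, supertile N p (shift_tile x q).

Definition finite_local_complexity : Prop :=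
  forall T (r : R), Omega T -> 0 < r ->
    exists F : set (set ltile), finite_set F /\
      forall Q, patch Q -> Q `<=` T -> (ediam (supp Q) < r%:E)%E ->
        exists Q0 x, F Q0 /\ Q = shift x Q0.

Definition injective_substitution : Prop := set_inj Omega omega.

Definition border_forcing : Prop :=
  exists n, forall p x x' T T', P p -> Omega T -> Omega T' ->
    shift x (supertile n p) `<=` T -> shift x' (supertile n p) `<=` T' ->
    shift (- x) (tiles_meeting T (supp (shift x (supertile n p)))) =
    shift (- x') (tiles_meeting T' (supp (shift x' (supertile n p)))).

Definition puncture (t : ltile) : V :=
  xget 0 [set x | exists2 p, P p & t = shift_tile x p].

Definition Omega_punc : set (set ltile) :=
  [set T | Omega T /\ exists2 t, T t & puncture t = 0].

Definition tiling_pair : Type := (set ltile * set ltile)%type.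

Definition Rpunc : set tiling_pair :=
  [set a | [/\ Omega_punc a.1, Omega_punc a.2 &
               exists x, a.2 = shift x a.1]].

Definition cylinder (Q : set ltile) (t1 t2 : ltile) : set tiling_pair :=
  [set a | [/\ Rpunc a, shift (- puncture t1) Q `<=` a.1 &
               a.2 = shift (puncture t1 - puncture t2) a.1]].

Definition cylinders : set (set tiling_pair) :=
  [set A | exists Q t1 t2,
     [/\ patch Q /\ (exists2 T, Omega T & Q `<=` T), Q t1, Q t2 &
         A = cylinder Q t1 t2]].

Definition RAF_level (n : nat) : set tiling_pair :=
  [set a | Rpunc a /\ exists T0 t t1 t2 x,
     [/\ Omega T0 /\ iter n omega T0 = a.1,
         T0 t,
         supertile n t t1 /\ puncture t1 = 0,
         supertile n t t2 /\ puncture t2 = x &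
         a.2 = shift (- x) a.1]].

Definition RAF : set tiling_pair := \bigcup_n RAF_level n.

Definition rot_tile (la : 'M[R]_d -> L -> L) (g : 'M[R]_d) (t : ltile) : ltile :=
  ([set g *m y | y in t.1], la g t.2).

Definition rot (la : 'M[R]_d -> L -> L) (g : 'M[R]_d) (T : set ltile) :
  set ltile := rot_tile la g @` T.

(* [la] is the action of the group on labels; the group acts on labelled tiles
   through it ([la := fun _ => id] if labels are left unchanged). *)
Record symmetry_group (G : set 'M[R]_d) (la : 'M[R]_d -> L -> L) : Prop :=
  SymmetryGroup {
    symmetry_orthogonal : forall g, G g -> g^T *m g = 1%:M;
    symmetry_1 : G 1%:M;
    symmetry_M : forall g h, G g -> G h -> G (g *m h);
    symmetry_V : forall g, G g -> G (invmx g);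
    symmetry_label1 : forall l, la 1%:M l = l;
    symmetry_labelM : forall g h l, G g -> G h -> la (g *m h) l = la g (la h l);
    symmetry_prototiles : forall g p, G g -> P p -> P (rot_tile la g p);
    symmetry_subst : forall g p, G g -> P p ->
      subst S (rot_tile la g p) = rot la g (subst S p) }.

Definition free_on_prototiles (G : set 'M[R]_d) (la : 'M[R]_d -> L -> L) : Prop :=
  forall g p, G g -> P p -> rot_tile la g p = p -> g = 1%:M.

End tilings.

(* The topology on all pairs of sets of tiles generated by the cylinders; its
   trace on [Rpunc S] is the one generated by the cylinders there. *)
Definition cylinder_space (R : realType) (d : nat) (L : Type)
  (S : substitution_data R d L) : Type := tiling_pair R d L.

Section tiling_groupoid.
Variables (R : realType) (d : nat) (L : Type) (S : substitution_data R d L).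

HB.instance Definition _ :=
  Pointed.copy (cylinder_space S) (set (ltile R d L) * set (ltile R d L))%type.

HB.instance Definition _ :=
  isSubBaseTopological.Build (cylinder_space S) (cylinders S)
    (id : set (cylinder_space S) -> set (cylinder_space S)).

Definition pair_ops : groupoid_ops (cylinder_space S) :=
  GroupoidOps
    (fun a : cylinder_space S => (a.1, a.1)) (fun a => (a.2, a.2))
    (fun a b => (a.1, b.2)) (fun a => (a.2, a.1)).

Definition rot_pair (la : 'M[R]_d -> L -> L) (g : 'M[R]_d)
    (a : cylinder_space S) : cylinder_space S := (rot la g a.1, rot la g a.2).

End tiling_groupoid.

(* Main.v *)
(** The arguments rest on addresses. Since the substitution is injective on the
    tiling space, the tile at the origin of a punctured tiling has, for each [n],
    a unique position in the [n]th order supertile containing it, and by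
    compactness this position is a locally constant function of the tiling.
    Hence the levels of [RAF] are compact open; they are principal after
    taking the semidirect product because a nontrivial group element moves every
    prototile, hence changes the type of the supertile at the origin.

    Call a tile of a supertile shallow if it is within a fixed distance of the
    boundary. By primitivity a supertile of some fixed order has a tile in its
    interior, so each further application of that power of the substitution
    multiplies the proportion of shallow tiles by a constant less than one. Since
    a compact set of arrows involves translations of bounded length only, those
    outside [RAF] start at tilings whose origin is shallow at every level;
    supertiles having arbitrarily many tiles for each shallow one, injections of
    copies of the shallow tiles into the supertile give the disjoint graphs
    required by thinness.

    The same estimate makes the supertiles of one tiling a Folner sequence. An
    ultrafilter limit of averages over them and over the group is an invariant
    finitely additive mean, which extends to an invariant Borel probability
    measure since the cylinders are compact open. By primitivity every orbit
    is dense, so that finitely many translates of any nonempty cylinder cover the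
    unit space and its measure is positive. *)

Require Import Defs.
From HB Require Import structures.
From mathcomp Require Import all_boot all_order all_algebra.
From mathcomp Require Import finmap.
From mathcomp Require Import all_classical all_reals all_analysis.
From mathcomp Require Import ring.

Set Implicit Arguments.
Unset Strict Implicit.
Unset Printing Implicit Defensive.

Import Order.TTheory GRing.Theory Num.Theory.
Import numFieldNormedType.Exports.

Local Open Scope classical_set_scope.
Local Open Scope ring_scope.

(* [shift], [patch] and [rot] also name functions of the libraries. *)
Local Notation shift := Defs.shift.
Local Notation rot := Defs.rot.
Local Notation patch := Defs.patch.

(** Limits are taken without a metric: the limit of tilings along an ultrafilter consists of the
    tiles that most of them contain. It covers space only if each ball admits finitely many tiles,
    uniformly over the tilings. This uniformity is the obstacle behind the early work. It is read
    off one self-similar tiling containing every supertile, and it yields desubstitutions,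
    compactness of the basic sets of arrows and local constancy of addresses.

    Injectivity also excludes periods, so an arrow determines its translation. A neighbourhood of an
    arrow is then given by a finite set of tiles, a vector and a group element, and continuity
    becomes a statement about these data.

    The etale axioms are checked once, for any open subgroupoid, which serves the whole groupoid,
    the AF part and its levels. For measures, a nonempty closed invariant set of units is
    everything, so one measure positive on all nonempty open sets suffices. The mean needs only an
    inequality under partial translations; the inverse translation gives equality. *)

Section set_types.
Variables (X : topologicalType).

(** * Subspaces and homeomorphisms *)

Lemma nbhs_set_type (A : set X) (x : set_type A) (B : set (set_type A)) :
  nbhs x B <-> exists2 O : set X, nbhs (\val x) O & forall y : set_type A, O (\val y) -> B y.
Proof.
split.
  move=> [_ /= [[W oW <-]] Wx WB]; exists W; first exact: open_nbhs_nbhs.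
  by move=> y Wy; apply: WB.
move=> [W]; rewrite nbhsE => -[W' [oW' W'x] sW] H.
exists (set_val @^-1` W'); split => //=; first by exists W'.
by move=> y W'y; apply: H; apply: sW.
Qed.

Lemma compact_set_type (A : set X) (K : set (set_type A)) :
  compact (set_val @` K) -> compact K.
Proof.
move=> cK F FF FK.
have [p [[k Kk <-] clp]] : (set_val @` K) `&` cluster (set_val @ F) !=set0.
  apply: cK; rewrite nbhs_simpl /=.
  by apply: filterS FK => k Kk /=; exists k.
exists k; split=> // B C FB /nbhs_set_type [W kW WC].
have [_ [[b Bb <-] Wb]] : (set_val @` B) `&` W !=set0.
  apply: clp => //; rewrite nbhs_simpl /=.
    by apply: filterS FB => b Bb /=; exists b.
by exists b; split=> //; apply: WC.
Qed.

Lemma compact_setT_set_type (A : set X) :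
  compact A -> compact [set: set_type A].
Proof.
move=> cA; apply: compact_set_type.
suff -> : set_val @` [set: set_type A] = A by [].
apply/seteqP; split=> [_ [y _ <-]|x Ax]; first exact: set_valP.
by exists (exist _ x (mem_set Ax)).
Qed.

Lemma homeomorphic_set_type (A B : set X) (f g : X -> X) :
  continuous f -> continuous g -> cancel f g -> cancel g f ->
  (forall x, A x -> B (f x)) -> (forall x, B x -> A (g x)) ->
  homeomorphic (set_type A) (set_type B).
Proof.
move=> cf cg fK gK AB BA.
pose F (a : set_type A) : set_type B := exist _ (f (\val a)) (mem_set (AB _ (set_valP a))).
pose G (b : set_type B) : set_type A := exist _ (g (\val b)) (mem_set (BA _ (set_valP b))).
exists F, G; split.
- by move=> a; apply/val_inj; rewrite /= fK.
- by move=> a; apply/val_inj; rewrite /= gK.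
- move=> a U /nbhs_set_type [W aW WU]; apply/nbhs_set_type.
  by exists (f @^-1` W); [exact: cf|move=> y Wy; exact: WU].
- move=> a U /nbhs_set_type [W aW WU]; apply/nbhs_set_type.
  by exists (g @^-1` W); [exact: cg|move=> y Wy; exact: WU].
Qed.

End set_types.

Lemma homeomorphic_trans (T U W : topologicalType) :
  homeomorphic T U -> homeomorphic U W -> homeomorphic T W.
Proof.
move=> [f [g [fK gK cf cg]]] [h [k [hK kK ch ck]]].
exists (h \o f), (g \o k); split.
- by move=> x /=; rewrite hK fK.
- by move=> x /=; rewrite gK kK.
- by move=> x; apply: continuous_comp; [exact: cf|exact: ch].
- by move=> x; apply: continuous_comp; [exact: ck|exact: cg].
Qed.

Lemma homeomorphic_sym (T U : topologicalType) :
  homeomorphic T U -> homeomorphic U T.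
Proof. by move=> [f [g [fK gK cf cg]]]; exists g, f; split. Qed.

(** * Sup norm, Euclidean norm and compactness of balls *)

Section euclidean_balls.
Variables (R : realType) (d : nat).
Local Notation V := 'cV[R]_d.

Lemma nbhs_norm (x : V) (A : set V) :
  nbhs x A <-> exists2 e : R, 0 < e & forall y, `|y - x| < e -> A y.
Proof.
split.
  move/(@nbhs_normP _ V) => [e /= e0 H]; exists e => // y yx; apply: H => /=.
  by rewrite distrC.
move=> [e e0 H]; apply/(@nbhs_normP _ V); exists e => //= y /= yx; apply: H.
by rewrite distrC.
Qed.

Lemma coord_norm (x : V) i : `|x i 0| <= `|x|.
Proof.
rewrite [leRHS]mx_normE -[leLHS]nngE num_le.
exact: (le_bigmax _ (fun i : 'I_d * 'I_1 => `|x i.1 i.2|%:nng%R) (i, 0)).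
Qed.

Lemma norm_le (x : V) (e : R) : 0 <= e -> (forall i, `|x i 0| <= e) -> `|x| <= e.
Proof.
move=> e0 H; rewrite [leLHS]mx_normE.
have -> : e = (NngNum e0)%:num by [].
rewrite num_le; apply/bigmax_leP; split => //= -[i j] _ /=.
by rewrite -num_le /= ord1.
Qed.

Lemma enorm_le (x : V) : enorm x <= d%:R * `|x|.
Proof.
have H : 0 <= d%:R * `|x| by rewrite mulr_ge0.
rewrite -[leRHS]ger0_norm // -[leRHS]sqrtr_sqr ler_sqrt ?sqr_ge0 //.
apply: (@le_trans _ _ (\sum_(i < d) `|x| ^+ 2)).
  apply: ler_sum => i _; rewrite -[leLHS]real_normK ?num_real //.
  by rewrite lerXn2r ?nnegrE //; apply: coord_norm.
rewrite sumr_const card_ord -[leLHS]mulr_natl exprMn.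
apply: ler_wpM2r; first exact: sqr_ge0.
case: d => [|n]; first by rewrite expr0n.
by rewrite expr2 ler_peMl // ?ler0n // ler1n.
Qed.

Lemma norm_le_enorm (x : V) : `|x| <= enorm x.
Proof.
apply: norm_le; first exact: sqrtr_ge0.
move=> i; rewrite -sqrtr_sqr ler_sqrt ?sumr_ge0 //; last by move=> ? _; exact: sqr_ge0.
by rewrite (bigD1 i) //= lerDl sumr_ge0 // => ? _; exact: sqr_ge0.
Qed.

Lemma closed_unit_ball_compact : compact (@closed_unit_ball R d).
Proof.
have := @rV_compact R d (fun=> `[-1, 1]%classic) (fun=> @segment_compact R (-1) 1).
set K := (X in compact X) => cK.
have cf : continuous (fun v : 'rV[R]_d => v^T : V).
  move=> v A /nbhs_norm [e e0 eA]; rewrite /nbhs /=.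
  apply/(@nbhs_normP _ 'rV[R]_d); exists e => //= w; rewrite /= => wv; apply: eA.
  move: wv; rewrite -opprB normrN; apply: le_lt_trans; apply: norm_le => // i.
  rewrite !mxE.
  rewrite [leRHS]mx_normE -[leLHS]nngE num_le.
  apply: le_trans (le_bigmax _ (fun i : 'I_1 * 'I_d => `|(w-v) i.1 i.2|%:nng%R) (0, i)).
  by rewrite -num_le /= !mxE.
have cK' : compact ((fun v : 'rV[R]_d => v^T : V) @` K).
  by apply: continuous_compact cK; exact: continuous_subspaceT.
apply: subclosed_compact cK' _.
  have -> : @closed_unit_ball R d =
     (fun x : V => \sum_i x i 0 ^+ 2) @^-1` [set y | y <= 1].
    apply/seteqP; split=> x; rewrite /closed_unit_ball /= /enorm.
      by rewrite -{1}[1]sqrtr1 ler_sqrt.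
    by rewrite -{2}[1]sqrtr1 ler_sqrt.
  apply: closed_comp; last exact: closed_le.
  move=> x _; move: x; apply: continuous_big; first exact: add_continuous.
  move=> i _ x.
  apply: (@continuous_comp _ _ _ (fun y : V => y i 0) (fun z : R => z ^+ 2)); [exact: coord_continuous|exact: exprn_continuous].
move=> x xB; exists x^T; last by rewrite trmxK.
move=> i /=; rewrite in_itv /= -ler_norml mxE.
exact: le_trans (coord_norm _ _) (le_trans (norm_le_enorm _) xB).
Qed.

Lemma cV_hausdorff : hausdorff_space V.
Proof. exact: norm_hausdorff. Qed.

Lemma homeomorphic_ball_compact (A : set V) :
  homeomorphic (set_type A) (set_type (@closed_unit_ball R d)) -> compact A.
Proof.
move=> [f [g [fK gK cf cg]]].
have -> : A = (fun y => set_val (g y)) @` [set: set_type (@closed_unit_ball R d)].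
  apply/seteqP; split=> [x Ax|_ [y _ <-]]; last exact: set_valP.
  by exists (f (exist _ x (mem_set Ax))) => //; rewrite fK.
apply: continuous_compact; last first.
  exact/compact_setT_set_type/closed_unit_ball_compact.
apply: continuous_subspaceT => y; apply: continuous_comp; first exact: cg.
exact: initial_continuous.
Qed.

Lemma compact_norm_bounded (A : set V) : compact A ->
  exists2 M : R, 0 < M & forall x, A x -> `|x| <= M.
Proof.
move=> /compact_bounded [M [_ HM]].
exists (`|M| + 1); first by rewrite ltr_wpDl.
move=> x Ax; apply: HM => //.
by apply: le_lt_trans (ler_norm _) _; rewrite ltrDl.
Qed.

End euclidean_balls.

(** * Finite covers, ultrafilters and the Cantor space *)

Lemma filter_finite_forall {I T : Type} (F : set_system I) (Q : set T)
    (A : I -> T -> Prop) : Filter F -> finite_set Q ->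
  (forall q, Q q -> F [set i | A i q]) -> F [set i | forall q, Q q -> A i q].
Proof.
move=> FF /finite_setP [n]; elim: n Q => [|n IH] Q.
  rewrite II0 card_eq0 => /eqP -> _.
  by apply: filterS (@filterT _ F _) => i _ q [].
move/eq_cardSP => [p Qp /IH {}IH] H.
have {}IH := IH (fun q Qq => H q Qq.1).
apply: filterS (filterI IH (H p Qp)) => i [Hi Hp] q Qq.
by have [->|qp] := pselect (q = p); [exact: Hp|apply: Hi].
Qed.

Lemma finite_sub_chain {T : Type} (F : nat -> set T) (Q : set T) :
  (forall i j, (i <= j)%N -> F i `<=` F j) -> finite_set Q ->
  Q `<=` \bigcup_i F i -> exists i, Q `<=` F i.
Proof.
move=> mF fQ QF.
have [|N _ HN] := @filter_finite_forall nat T \oo Q (fun i q => F i q) _ fQ.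
  by move=> q /QF [i _ Fq]; exists i => // j /= ij; apply: mF Fq.
by exists N => q Qq; apply: HN => //=.
Qed.

(** The finite case of the Baire property: if one closed set does not contain [U], remove it and
    continue with the open remainder. With tiles as closed sets it produces a tile having an
    interior point in a prescribed open set. *)
Lemma finite_closed_cover {X : topologicalType} {T : Type} (N : set T)
    (A : T -> set X) (U : set X) : finite_set N ->
  (forall u, N u -> closed (A u)) -> open U -> U !=set0 ->
  U `<=` \bigcup_(u in N) A u -> exists u z, [/\ N u, U z & nbhs z (A u)].
Proof.
move=> /finite_setP [n]; elim: n N U => [|n IH] N U.
  by rewrite II0 card_eq0 => /eqP -> _ _ [z Uz] /(_ z Uz) [].
move/eq_cardSP => [p Np /IH {}IH] cA oU [z Uz] UN.
have [UA|] := pselect (U `<=` A p).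
  exists p, z; split=> //; apply: filterS UA _.
  exact: open_nbhs_nbhs.
move=> /nonsubset [w [Uw Aw]].
have [|||x [Ux Ax]|u [x [[Nu _] [Ux _] xA]]] := IH (U `&` ~` A p).
- by move=> u [Nu _]; apply: cA.
- by apply: openI => //; apply: closed_openC; apply: cA.
- by exists w.
- have [v Nv vx] := UN x Ux; exists v => //; split=> // vp.
  by move: vx; rewrite vp.
- by exists u, x.
Qed.

Lemma finI_from_finite {I : choiceType} {T : Type} (D : set I) (f : I -> set T)
    (A : set T) : finI_from D f A -> exists E : set I,
  [/\ finite_set E, E `<=` D & \bigcap_(i in E) f i = A].
Proof.
move=> [E ED <-]; exists [set` E]; split=> //.
by move=> i /= /ED; rewrite inE.
Qed.

Lemma continuous_bij_homeomorphic {T U : topologicalType} (f : T -> U) (g : U -> T) :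
  cancel f g -> cancel g f -> continuous f ->
  (forall A, closed A -> closed (f @` A)) -> homeomorphic T U.
Proof.
move=> fK gK cf clf; exists f, g; split=> //.
apply/continuous_closedP => A cA.
have -> : g @^-1` A = f @` A; last exact: clf.
apply/seteqP; split=> [u Au|_ [t At <-] /=]; last by rewrite fK.
by exists (g u) => //; rewrite gK.
Qed.

Lemma cantor_like_homeomorphic {T U : topologicalType} :
  homeomorphic T U -> cantor_like T -> cantor_like U.
Proof.
move=> [f [g [fK gK cf cg]]] [pT cT hT zT]; split.
- apply/perfectTP => u ou; apply: ((perfectTP.1 pT) (g u)).
  have -> : [set g u] = f @^-1` [set u].
    by apply/seteqP; split=> [_ ->|t /= <-]; rewrite /= ?gK ?fK.
  by apply: open_comp => // t _; exact: cf.
- have -> : [set: U] = f @` [set: T].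
    by apply/seteqP; split=> // u _; exists (g u) => //; rewrite gK.
  by apply: continuous_compact => //; exact: continuous_subspaceT.
- move=> u v uv; rewrite -[u]gK -[v]gK; congr f; apply: hT => A B Au Bv.
  have Av : nbhs (f (g u)) (g @^-1` A) by rewrite gK; exact: cg.
  have Bw : nbhs (f (g v)) (g @^-1` B) by rewrite gK; exact: cg.
  rewrite !gK in Av Bw.
  by have [w [Aw Bw']] := uv _ _ Av Bw; exists (g w).
- move=> u v uv; have [|A [[oA cA] Au Av]] := zT (g u) (g v).
    by apply: contra_neq uv => /(congr1 f); rewrite !gK.
  exists (g @^-1` A); split=> //; split.
    by apply: open_comp => // w _; exact: cg.
  by apply: closed_comp => // w _; exact: cg.
Qed.

(** Brouwer's characterization of the Cantor set. The countable separating family [U] stands in for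
    a metric: the sequence of memberships embeds [T] into [cantor_space]. *)
Lemma homeomorphic_cantor_space (R : realType) {T : topologicalType} (U : nat -> set T) :
  cantor_like T -> [set: T] !=set0 -> (forall n, clopen (U n)) ->
  (forall x y, (forall n, U n x <-> U n y) -> x = y) ->
  homeomorphic T cantor_space.
Proof.
move=> clT [t0 _] cU sepU; have [_ cptT _ _] := clT.
pose e (t : T) : cantor_space := fun n => `[<U n t>].
have ce : continuous e.
  move=> t; apply/cvg_sup.
  move=> i; move: t; apply/(@continuousP _ (initial_topology (@^~ i))) => _ [B _ <-].
  have [oU cUi] := cU i.
  have eE : e @^-1` (@^~ i @^-1` B) = [set t | B `[<U i t>]] by [].
  rewrite eE; have [Bt|Bt] := pselect (B true); have [Bf|Bf] := pselect (B false).
  - rewrite (_ : [set t | _] = setT); first exact: openT.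
    by apply/seteqP; split=> // t _ /=; case: asboolP.
  - rewrite (_ : [set t | _] = U i) //.
    by apply/seteqP; split=> t /=; case: asboolP.
  - rewrite (_ : [set t | _] = ~` U i); first exact: closed_openC.
    by apply/seteqP; split=> t /=; case: asboolP.
  - rewrite (_ : [set t | _] = set0); first exact: open0.
    by apply/seteqP; split=> t //=; case: asboolP.
pose A := range e.
have Ae t : A (e t) by exists t.
pose f (t : T) : set_type A := exist _ (e t) (mem_set (Ae t)).
have finj : injective f.
  move=> x y /(congr1 (fun a => \val a)) /= exy; apply: sepU => n.
  have : e x n = e y n by rewrite exy.
  by rewrite /e; case: asboolP; case: asboolP => // ? ? _; split.
have cf : continuous f.
  move=> t B /nbhs_set_type [W nW WB].
  apply: (@filterS _ (nbhs t) _ (e @^-1` W)); last exact: (ce t W nW).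
  by move=> s Ws; apply: WB.
have /choice [g gK] : forall a : set_type A, exists t, f t = a.
  move=> a; have [t _ te] := set_valP a; exists t; apply: val_inj.
  by rewrite /= te.
have fK : cancel f g by move=> t; apply: finj; rewrite gK.
have hA : hausdorff_space (set_type A).
  move=> a b ab; apply: val_inj; apply: cantor_space_hausdorff => B B' nB nB'.
  have [||c [? ?]] := ab (set_val @^-1` B) (set_val @^-1` B').
  - by apply/nbhs_set_type; exists B.
  - by apply/nbhs_set_type; exists B'.
  - by exists (\val c).
have TA : homeomorphic T (set_type A).
  apply: (continuous_bij_homeomorphic fK gK cf) => B cB.
  apply: (compact_closed hA); apply: continuous_compact.
    exact: continuous_subspaceT.
  exact: subclosed_compact cptT _.
apply: (homeomorphic_trans TA).
(* The image of [T] inherits a pseudometric from [cantor_space], and only there is the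
   characterization applied. *)
pose W : pseudoPMetricType R := HB.pack (set_type A) (isPointed.Build _ (f t0)).
have clA := cantor_like_homeomorphic TA clT.
have clW : cantor_like W by exact: clA.
have [h [ch clh]] := homeomorphism_cantor_like clW.
apply: homeomorphic_sym.
have [k hk kh] : bijective h.
  rewrite -setTT_bijective.
  exact: (@bij _ _ _ _ h).
exact: (continuous_bij_homeomorphic hk kh ch).
Qed.

Lemma countable_enum {T : Type} (A : set T) (a0 : T) : countable A ->
  exists e : nat -> T, forall a, A a -> exists n, e n = a.
Proof.
move=> /countable_injP [f finj].
have /choice [e eP] : forall n, exists a, forall b, A b -> f b = n -> a = b.
  move=> n; have [[b [Ab bn]]|H] := pselect (exists b, A b /\ f b = n).
    by exists b => c Ac cn; apply: finj; rewrite ?inE // bn cn.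
  by exists a0 => b Ab bn; exfalso; apply: H; exists b.
by exists e => a Aa; exists (f a); apply: eP.
Qed.

Lemma ultra_finite_cover {I T : Type} (F : set_system T) (J : set I)
    (A : I -> set T) (B : set T) : UltraFilter F -> finite_set J -> F B ->
  B `<=` \bigcup_(j in J) A j -> exists2 j, J j & F (A j).
Proof.
move=> FU fJ FB BA; apply: contrapT => H.
have [x [Bx Hx]] : B `&` [set x | forall j, J j -> ~ A j x] !=set0.
  apply: (@filter_ex _ F); apply: filterI => //; apply: filter_finite_forall => // j Jj.
  have [FA|//] := in_ultra_setVsetC (A j) FU.
  by exfalso; apply: H; exists j.
by have [j Jj Ajx] := BA x Bx; exact: (Hx j Jj).
Qed.

(** * Counting *)

Section counting.

Lemma finite_set_rec (T : Type) (Q : set T -> Prop) : Q set0 ->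
  (forall a A, finite_set A -> ~ A a -> Q A -> Q (a |` A)) ->
  forall A, finite_set A -> Q A.
Proof.
move=> Q0 QS A /(@finite_seqP {classic T}) [s ->].
elim: s => [|a s IH]; first by rewrite (_ : [set` [::]] = set0) // -subset0.
have [as_|nas] := pselect ([set` s] a).
  by rewrite (_ : [set` a :: s] = [set` s]) //; apply/seteqP; split=> x /=;
    rewrite in_cons; [move=> /orP[/eqP ->//|//]|move=> ->; rewrite orbT].
rewrite (_ : [set` a :: s] = a |` [set` s]).
  by apply: QS => //; apply/(@finite_seqP {classic T}); exists s.
apply/seteqP; split=> x /=; rewrite in_cons; first by move=> /orP[/eqP|]; [left|right].
by move=> [->|->]; rewrite ?eqxx ?orbT.
Qed.

Definition ncard (T : Type) (A : set T) : nat :=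
  #|` fset_set (A : set {classic T})|.

Variable T : Type.
Implicit Types A B : set T.

Lemma ncard0 : ncard (set0 : set T) = 0%N.
Proof. by rewrite /ncard fset_set0 cardfs0. Qed.

Lemma ncard1 (a : T) : ncard [set a] = 1%N.
Proof. by rewrite /ncard (@fset_set1 {classic T}) cardfs1. Qed.

Lemma ncard_sub A B : finite_set B -> A `<=` B -> (ncard A <= ncard B)%N.
Proof.
move=> fB AB; have fA := sub_finite_set AB fB.
by apply: fsubset_leq_card; rewrite -fset_set_sub.
Qed.

Lemma ncardUI A B : finite_set A -> finite_set B ->
  (ncard (A `|` B) + ncard (A `&` B) = ncard A + ncard B)%N.
Proof.
move=> fA fB.
by rewrite /ncard (@fset_setU {classic T}) // (@fset_setI {classic T}) // cardfsUI.
Qed.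

Lemma ncardU A B : finite_set A -> finite_set B -> A `&` B = set0 ->
  ncard (A `|` B) = (ncard A + ncard B)%N.
Proof. by move=> fA fB AB0; rewrite -ncardUI // AB0 ncard0 addn0. Qed.

Lemma ncardU_le A B : finite_set A -> finite_set B ->
  (ncard (A `|` B) <= ncard A + ncard B)%N.
Proof. by move=> fA fB; rewrite -ncardUI // leq_addr. Qed.

Lemma ncard_gt0 A : finite_set A -> A !=set0 -> (0 < ncard A)%N.
Proof.
move=> fA [a Aa]; rewrite -[1%N](ncard1 a); apply: ncard_sub => // _ -> //.
Qed.

Lemma ncard_image (U : Type) (f : T -> U) A : finite_set A ->
  (forall a b, A a -> A b -> f a = f b -> a = b) -> ncard (f @` A) = ncard A.
Proof.
move=> fA inj; rewrite /ncard (@fset_set_image {classic T} {classic U}) //.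
rewrite card_in_imfset // => a b /=; rewrite !in_fset_set // !inE; exact: inj.
Qed.

Lemma ncard_bigcup_ratio (R : realType) (I : Type) (J : set I) (E F : I -> set T) (b : R) :
  finite_set J -> trivIset J F -> (forall i, J i -> finite_set (F i)) ->
  (forall i, J i -> E i `<=` F i) ->
  (forall i, J i -> (ncard (E i))%:R <= b * (ncard (F i))%:R) ->
  (ncard (\bigcup_(i in J) E i))%:R <= b * (ncard (\bigcup_(i in J) F i))%:R.
Proof.
move=> fJ; elim/finite_set_rec: J / fJ => [|i J fJ nJi IH] tF fF EF bE.
  by rewrite !bigcup_set0 ncard0 mulr0.
have sJ : J `<=` i |` J by move=> j Jj; right.
have Ji : (i |` J) i by left.
have fU : finite_set (\bigcup_(i in J) F i).
  by apply: bigcup_finite => // j /sJ /fF.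
have sE : \bigcup_(i in J) E i `<=` \bigcup_(i in J) F i.
  by move=> x [j Jj Ex]; exists j => //; apply: (EF _ (sJ _ Jj)).
rewrite !bigcup_setU1 (ncardU (fF _ Ji) fU); last first.
  rewrite -subset0 => x [Fx [j Jj Fjx]]; apply: nJi.
  by rewrite (tF i j) //; [right|exists x].
have {}IH := IH (sub_trivIset sJ tF) (fun j Jj => fF _ (sJ _ Jj))
  (fun j Jj => EF _ (sJ _ Jj)) (fun j Jj => bE _ (sJ _ Jj)).
rewrite natrD mulrDr; apply: le_trans (lerD (bE _ Ji) IH).
rewrite -natrD ler_nat; apply: ncardU_le; last exact: sub_finite_set sE fU.
exact: sub_finite_set (EF _ Ji) (fF _ Ji).
Qed.

Lemma ncard_bigcup_le (I : Type) (J : set I) (F : I -> set T) m :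
  finite_set J -> (forall i, J i -> finite_set (F i)) ->
  (forall i, J i -> (ncard (F i) <= m)%N) ->
  (ncard (\bigcup_(i in J) F i) <= ncard J * m)%N.
Proof.
move=> fJ; elim/finite_set_rec: J / fJ => [|i J fJ nJi IH] fF Fm.
  by rewrite bigcup_set0 ncard0.
have sJ : J `<=` i |` J by move=> j Jj; right.
have Ji : (i |` J) i by left.
have fU : finite_set (\bigcup_(i in J) F i).
  by apply: bigcup_finite => // j /sJ /fF.
rewrite bigcup_setU1; apply: leq_trans (ncardU_le (fF _ Ji) fU) _.
have -> : ncard (i |` J) = (1 + ncard J)%N.
  rewrite /ncard (@fset_setU1 {classic I}) // cardfsU1 in_fset_set //.
  by rewrite (_ : i \in (J : set {classic I}) = false) //; apply/negbTE; rewrite notin_setE.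
rewrite mulnDl mul1n leq_add //; first exact: Fm.
by apply: IH => j /sJ; [exact: fF|exact: Fm].
Qed.

Lemma finite_argmax A (f : T -> nat) : finite_set A -> A !=set0 ->
  exists2 a, A a & forall b, A b -> (f b <= f a)%N.
Proof.
move=> fA; elim/finite_set_rec: A / fA => [[]//|a A fA _ IH _].
have [->|/set0P/IH [b Ab Hb]] := eqVneq A set0.
  by exists a; [left|move=> b [->|]].
have [ab|/ltnW ba] := leqP (f a) (f b).
  by exists b; [right|move=> c [->|/Hb]].
by exists a; [left|move=> c [->//|/Hb /leq_trans]; apply].
Qed.

(** List [B] and cut the list into [m] consecutive blocks of length [ncard A]; [f k] sends the [i]th
    element of [A] to the [i]th entry of block [k]. Euclidean division recovers [k] and [i] from the
    position. *)
Lemma ncard_copies A B m : finite_set A -> finite_set B ->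
  (m * ncard A <= ncard B)%N -> exists f : nat -> T -> T,
  (forall k a, (k < m)%N -> A a -> B (f k a)) /\
  (forall k l a b, (k < m)%N -> (l < m)%N -> A a -> A b -> f k a = f l b -> k = l /\ a = b).
Proof.
move=> fA fB mAB.
pose sA := fset_set (A : set {classic T}); pose sB := fset_set (B : set {classic T}).
pose ix a := @index {classic T} a sA.
have iA a : A a -> (ix a < ncard A)%N.
  by move=> Aa; rewrite index_mem in_fset_set // inE.
have lt k a : (k < m)%N -> A a -> (k * ncard A + ix a < ncard B)%N.
  move=> km Aa; apply: leq_trans mAB.
  apply: (@leq_trans (k * ncard A + ncard A)%N); first by rewrite ltn_add2l iA.
  by rewrite -mulSnr leq_mul2r km orbT.
exists (fun k a => nth a sB (k * ncard A + ix a)%N); split=> [k a km Aa|k l a b km lm Aa Ab].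
  have : @nth {classic T} a sB (k * ncard A + ix a)%N \in sB by rewrite mem_nth // lt.
  by rewrite in_fset_set // inE.
rewrite (set_nth_default a b); last exact: lt.
move=> e'; have e : (k * ncard A + ix a = l * ncard A + ix b)%N.
  by apply/eqP; rewrite -(@nth_uniq {classic T} a sB) ?lt ?fset_uniq //; apply/eqP.
have n0 : (0 < ncard A)%N by apply: ncard_gt0 => //; exists a.
have kl : k = l.
  have := congr1 (fun i => (i %/ ncard A)%N) e.
  by rewrite !divnMDl // !divn_small ?iA // !addn0.
split=> //; move: e; rewrite kl => /addnI e.
rewrite -(@nth_index {classic T} a a sA); last by rewrite in_fset_set // inE.
by rewrite -/(ix a) e nth_index // in_fset_set // inE.
Qed.

End counting.

(** * Extension of finitely additive contents *)

Section clopen_content.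
Variables (R : realType) (Z : ptopologicalType) (K : set Z) (m : set Z -> R).
Hypotheses (cK : compact K) (m_ge0 : forall A, 0 <= m A)
  (mU : forall A B, A `&` B = set0 -> m (A `|` B) = m A + m B)
  (mK : m (~` K) = 0).

(** An algebra of subsets of the ambient [Z], where the measures live. What such a set does outside
    [K] is arbitrary and invisible to [m]. *)
Definition trace_clopen : set (set Z) :=
  [set A | clopen (set_val @^-1` A : set (set_type K))].

Lemma trace_clopen0 : trace_clopen set0.
Proof. by rewrite /trace_clopen /= preimage_set0; split; [exact: open0|exact: closed0]. Qed.

Lemma trace_clopenU : setU_closed trace_clopen.
Proof.
move=> A B [oA cA] [oB cB]; rewrite /trace_clopen /= preimage_setU.
by split; [exact: openU|exact: closedU].
Qed.

Lemma trace_clopenC : setC_closed trace_clopen.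
Proof.
move=> A [oA cA]; rewrite /trace_clopen /= preimage_setC.
by split; [exact: closed_openC|exact: open_closedC].
Qed.

Lemma trace_clopen_self : trace_clopen K.
Proof.
rewrite /trace_clopen /= (_ : _ @^-1` K = setT); first by split; [exact: openT|exact: closedT].
by rewrite -subTset => x _; exact: set_valP.
Qed.

Lemma content0 : m set0 = 0.
Proof.
have := mU (setI0 set0); rewrite setU0 => /eqP.
by rewrite -{1}[m set0]addr0 (inj_eq (addrI _)) => /eqP.
Qed.

Lemma content_le A B : A `<=` B -> m A <= m B.
Proof.
move=> AB; rewrite -(setDUK AB) mU ?lerDl //.
by rewrite setDE setIC -setIA setICl setI0.
Qed.

Lemma content_trace A B : A `&` K = B `&` K -> m A = m B.
Proof.
have E C : m C = m (C `&` K).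
  rewrite -{1}(setUIDK C K) mU; last by rewrite setDE setIACA setICr setI0.
  suff -> : m (C `\` K) = 0 by rewrite addr0.
  by apply/le_anti; rewrite m_ge0 andbT -mK content_le // => x [].
by move=> e; rewrite E e -E.
Qed.

Lemma content_sum (F : nat -> set Z) n : trivIset setT F ->
  m (\big[setU/set0]_(i < n) F i) = \sum_(i < n) m (F i).
Proof.
move=> tF; elim: n => [|n IH]; first by rewrite !big_ord0 content0.
rewrite !big_ord_recr /= mU ?IH // -bigcup_mkord -subset0 => x [[i /= i_n Fix] Fnx].
by have ni := tF i n I I (ex_intro _ x (conj Fix Fnx)); rewrite ni ltnn in i_n.
Qed.

(** The trace of the union on [K] is closed in a compact space, hence compact, and the traces of the
    [F n] are an open cover of it. *)
Lemma trace_clopen_cover (F : nat -> set Z) : (forall n, trace_clopen (F n)) ->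
  trace_clopen (\bigcup_n F n) ->
  exists n, K `&` \bigcup_n F n `<=` \bigcup_(i < n) F i.
Proof.
move=> cF [_ cU].
have cKT := compact_setT_set_type cK.
have /choice [W HW] : forall n, exists W : set Z,
    open W /\ set_val @^-1` W = set_val @^-1` F n :> set (set_type K).
  by move=> n; have [[W oW e] _] := cF n; exists W.
have : compact (set_val @` (set_val @^-1` (\bigcup_n F n) : set (set_type K))).
  apply: continuous_compact; last exact: subclosed_compact cU cKT (@subsetT _ _).
  exact/continuous_subspaceT/initial_continuous.
rewrite compact_cover => /(_ nat setT W) [n _|_ [x [n _ Fx] <-]|D _ HD].
- by case: (HW n).
- by exists n => //; have [_ e] := HW n; move: Fx; rewrite -[F n _]/((set_val @^-1` F n) x) -e.
exists (\max_(i <- D) i).+1 => x [Kx Ux].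
pose z : set_type K := exist _ x (mem_set Kx).
have [n /= nD Wx] : cover [set` D] W (\val z) by apply: HD; exists z.
exists n => /=; first by rewrite ltnS; apply: leq_bigmax_seq.
have [_ e] := HW n.
have : (set_val @^-1` W n) z by [].
by rewrite e.
Qed.

(* On clopen subsets of a compact space, finite additivity is countable
   additivity, so the Caratheodory extension applies. *)
Lemma content_extension (G : set (set Z)) : G `<=` <<s trace_clopen >> ->
  exists mu : {measure set (g_sigma_algebraType G) -> \bar R},
    forall A, trace_clopen A -> mu A = (m A)%:E.
Proof.
move=> GB.
pose T : algebraOfSetsType default_measure_display :=
  HB.pack (Z : Type) (Pointed.class Z)
    (isAlgebraOfSets.Build default_measure_display Z
       trace_clopen0 trace_clopenU trace_clopenC).
pose mu0 (A : set T) : \bar R := (m A)%:E.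
have mu00 : mu0 set0 = 0%E by rewrite /mu0 content0.
have mu0_ge0 A : (0 <= mu0 A)%E by rewrite lee_fin.
have mu0_sigma : semi_sigma_additive mu0.
  move=> F mF tF mUF; have [n0 Hn0] := trace_clopen_cover mF mUF.
  apply: cvg_near_cst; exists n0 => // n /= n0n.
  rewrite big_mkord /mu0 sumEFin -content_sum //; congr EFin.
  apply: content_trace; rewrite -bigcup_mkord; apply/seteqP; split=> x [Fx Kx]; split=> //.
    by move: Fx => [i _ Fx]; exists i.
  have [|i /= i_n0 Fix] := Hn0 x; first by split.
  by exists i => //=; exact: leq_trans n0n.
pose mu1 : {measure set T -> \bar R} :=
  HB.pack mu0 (isMeasure.Build _ T R mu0 mu00 mu0_ge0 mu0_sigma).
pose nu := measure_extension mu1.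
have sG : <<s G >> `<=` <<s trace_clopen >>.
  by apply: smallest_sub GB; exact: smallest_sigma_algebra.
pose mu (A : set (g_sigma_algebraType G)) : \bar R := nu A.
have mu_0 : mu set0 = 0%E by exact: measure0.
have mu_ge0 A : (0 <= mu A)%E by exact: measure_ge0.
have mu_sigma : semi_sigma_additive mu.
  move=> F mF tF mUF; apply: (measure_semi_sigma_additive (s := nu)) => //.
    by move=> i; exact: (sG _ (mF i)).
  exact: (sG _ mUF).
pose mu' : {measure set (g_sigma_algebraType G) -> \bar R} :=
  HB.pack mu (isMeasure.Build _ _ R mu mu_0 mu_ge0 mu_sigma).
exists mu' => A cA.
exact: (measurable_mu_extE mu1 cA).
Qed.

End clopen_content.

(** * Probability measures, limits along ultrafilters and disjoint unions *)

Section mass_one.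
Variables (R : realType) (dd : measure_display) (T : measurableType dd)
  (mu : {measure set T -> \bar R}) (muT : mu setT = 1%E).

(** A copy of [mu] whose term mentions the proof that its mass is one, so that a probability
    structure can be attached to it. *)
Definition mass_one (_ : mu setT = 1%E) : set T -> \bar R := mu.

HB.instance Definition _ := Measure.copy (mass_one muT) mu.
HB.instance Definition _ := Measure_isProbability.Build _ _ _ (mass_one muT) muT.

Lemma measure_probability : exists Q : probability T R, forall A, Q A = mu A.
Proof. by exists (mass_one muT). Qed.

End mass_one.

Lemma fmap_ultra (T U : Type) (F : set_system T) (f : T -> U) :
  UltraFilter F -> UltraFilter (f @ F).
Proof.
move=> FU; split=> [|H HH FH];first exact: fmap_proper_filter.
apply/seteqP; split=> A HA; last exact: FH.
have [//|FnA] := in_ultra_setVsetC (f @^-1` A) FU.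
have /FH HnA : (f @ F) (~` A) by [].
by have [x [? ?]] := filter_ex (filterI HA HnA).
Qed.

Lemma ultra_bounded_cvg (R : realType) (T : Type) (F : set_system T) (f : T -> R)
  (a b : R) : UltraFilter F -> (forall i, a <= f i <= b) ->
  exists l : R, f @ F --> l.
Proof.
move=> FU fab; have := @segment_compact R a b.
rewrite compact_ultra => /(_ _ (fmap_ultra f FU)) [|l [_ fl]]; last by exists l.
suff : F (f @^-1` `[a, b]) by [].
by apply: filterE => i; rewrite /= in_itv /= fab.
Qed.

Lemma seqDUP (T : Type) (B : nat -> set T) n x :
  seqDU B n x <-> B n x /\ forall k, (k < n)%N -> ~ B k x.
Proof.
rewrite /seqDU -bigcup_mkord; split=> [[Bx nB]|[Bx nB]]; split=> //.
  by move=> k kn Bk; apply: nB; exists k.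
by move=> [k kn Bk]; exact: (nB k kn Bk).
Qed.

(** Range and source are injective on a graph, so both carry one disjoint decomposition of the graph
    to disjoint decompositions of its images. *)
Lemma image_seqDU (T U : Type) (f : T -> U) (A : set T) (B : nat -> set T) n :
  set_inj A f -> (forall n, B n `<=` A) ->
  f @` (seqDU B n) = seqDU (fun n => f @` B n) n.
Proof.
move=> fI BA; apply/seteqP; split=> [_ [x /seqDUP [Bx nB] <-]|_ /seqDUP [[x Bx <-] nB]].
  apply/seqDUP; split=> [|k kn [y By e]]; first by exists x.
  apply: (nB k kn).
  by rewrite -(fI y x) ?inE //; [exact: BA By|exact: BA Bx].
exists x => //; apply/seqDUP; split=> // k kn Bk.
by apply: (nB k kn); exists x.
Qed.

(** * Translates of tiles *)

Section shifts.
Variables (R : realType) (d : nat) (L : Type).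
Local Notation V := 'cV[R]_d.
Local Notation tile := (ltile R d L).
Implicit Types (x y z : V) (t u : tile) (T Q : set tile).

Lemma shift_tileE x t : shift_tile x t = ([set z | t.1 (z - x)], t.2).
Proof.
congr pair; apply/seteqP; split=> [_ [y ty <-]|z /= tz]; first by rewrite /= addrK.
by exists (z - x) => //; rewrite subrK.
Qed.

Lemma shift_tile1 x t z : (shift_tile x t).1 z = t.1 (z - x).
Proof. by rewrite shift_tileE. Qed.

Lemma shift_tile0 t : shift_tile 0 t = t.
Proof.
rewrite shift_tileE; case: t => A l /=; congr pair.
by apply/seteqP; split=> z /=; rewrite subr0.
Qed.

Lemma shift_tileD x y t : shift_tile x (shift_tile y t) = shift_tile (x + y) t.
Proof.
rewrite !shift_tileE /=; congr pair.
by apply/seteqP; split=> z /=; rewrite opprD addrA.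
Qed.

Lemma shift_tileK x : cancel (@shift_tile R d L x) (shift_tile (- x)).
Proof. by move=> t; rewrite shift_tileD addNr shift_tile0. Qed.

Lemma shift_tileNK x : cancel (@shift_tile R d L (- x)) (shift_tile x).
Proof. by move=> t; rewrite shift_tileD addrN shift_tile0. Qed.

Lemma shift_tile_inj x : injective (@shift_tile R d L x).
Proof. exact: can_inj (shift_tileK x). Qed.

Lemma shiftP x T t : shift x T t <-> T (shift_tile (- x) t).
Proof.
split=> [[u Tu <-]|Tt]; first by rewrite shift_tileK.
by exists (shift_tile (- x) t) => //; rewrite shift_tileNK.
Qed.

Lemma shift_in x T t : T t -> shift x T (shift_tile x t).
Proof. by move=> Tt; exists t. Qed.

Lemma shift0 T : shift 0 T = T.
Proof. by apply/seteqP; split=> t; rewrite shiftP oppr0 shift_tile0. Qed.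

Lemma shiftD x y T : shift x (shift y T) = shift (x + y) T.
Proof.
apply/seteqP; split=> t; rewrite !shiftP shift_tileD.
  by rewrite -opprD addrC.
by rewrite -opprD addrC.
Qed.

Lemma shiftK x : cancel (@shift R d L x) (shift (- x)).
Proof. by move=> T; rewrite shiftD addNr shift0. Qed.

Lemma shiftNK x : cancel (@shift R d L (- x)) (shift x).
Proof. by move=> T; rewrite shiftD addrN shift0. Qed.

Lemma shift_inj x : injective (@shift R d L x).
Proof. exact: can_inj (shiftK x). Qed.

Lemma shift_sub x T Q : Q `<=` T -> shift x Q `<=` shift x T.
Proof. by move=> QT t /shiftP Qt; apply/shiftP; apply: QT. Qed.

Lemma shift_subE x T Q : Q `<=` shift x T <-> shift (- x) Q `<=` T.
Proof.
split=> H; first by rewrite -(shiftK x T); apply: shift_sub.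
by rewrite -(shiftNK x Q); apply: shift_sub.
Qed.

Lemma supp_shift x T z : supp (shift x T) z <-> supp T (z - x).
Proof.
split.
  move=> [_ [t Tt <-]]; rewrite shift_tile1 => tz; by exists t.
move=> [t Tt tz]; exists (shift_tile x t); first exact: shift_in.
by rewrite shift_tile1.
Qed.

Lemma nbhs_shift_tile x t z : nbhs z (shift_tile x t).1 <-> nbhs (z - x) t.1.
Proof.
split=> /nbhs_norm [e e0 H]; apply/nbhs_norm; exists e => // y yz.
  have := H (y + x); rewrite shift_tile1 addrK; apply.
  by rewrite -addrA -(opprB z x).
by rewrite shift_tile1; apply: H; rewrite opprB addrA subrK.
Qed.

Lemma is_tile_shift x t : is_tile t -> is_tile (shift_tile x t).
Proof.
rewrite /is_tile; apply: homeomorphic_trans.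
have cs (c : V) : continuous (fun y : V => y + c).
  by move=> y; apply: (@continuousD _ V V) => //; exact: cst_continuous.
apply: (@homeomorphic_set_type _ _ _ (fun y => y - x) (fun y => y + x)) => //.
- by move=> y; rewrite subrK.
- by move=> y; rewrite addrK.
- by move=> y; rewrite shift_tile1.
- by move=> y; rewrite shift_tile1 addrK.
Qed.

End shifts.

(** * Prototiles and their translates *)

Section prototiles.
Variables (R : realType) (d : nat) (L : Type) (S : substitution_data R d L).
Local Notation V := 'cV[R]_d.
Local Notation tile := (ltile R d L).
Local Notation P := (prototiles S).
Local Notation lam := (expansion S).
Implicit Types (x z : V) (t u p q : tile) (T Q : set tile).

Definition ptile t := exists p x, P p /\ t = shift_tile x p.

(** [r0] and [D] are common inner and outer radii of the prototiles about their punctures, in the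
    sup norm. The size estimates below are made in these two numbers. *)
Record standing (r0 D : R) : Prop := Standing {
  std_sys : substitution_tiling_system S;
  std_prim : primitive S;
  std_flc : finite_local_complexity S;
  std_inj : injective_substitution S;
  std_r0 : 0 < r0;
  std_D : 0 < D;
  std_ball : forall p z, P p -> `|z| < r0 -> p.1 z;
  std_bound : forall p z, P p -> p.1 z -> `|z| <= D }.

Lemma prototile_constants : substitution_tiling_system S ->
  exists r0 D : R, [/\ 0 < r0, 0 < D,
    forall p z, P p -> `|z| < r0 -> p.1 z &
    forall p z, P p -> p.1 z -> `|z| <= D].
Proof.
move=> [[fP _ tP oP _ _] _].
have [r0 r00 rP] : exists2 r0 : R, 0 < r0 & forall p z, P p -> `|z| < r0 -> p.1 z.
  move: (fP) oP => /finite_setP [n]; elim: n P {fP tP} => [|n IH] A.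
    by rewrite II0 card_eq0 => /eqP -> _; exists 1.
  move/eq_cardSP => [p Ap /IH {}IH] oA.
  have [|e e0 eA] := IH; first by move=> q [/oA].
  have /nbhs_norm [e' e'0 e'P] := oA _ Ap.
  exists (Num.min e e'); first by rewrite lt_min e0.
  move=> q z Aq; rewrite lt_min => /andP[ze ze'].
  have [qp|qp] := pselect (q = p); last exact: eA.
  by rewrite qp; apply: e'P; rewrite subr0.
have [D D0 DP] : exists2 D : R, 0 < D & forall p z, P p -> p.1 z -> `|z| <= D.
  move: (fP) tP => /finite_setP [n]; elim: n P {fP oP rP} => [|n IH] A.
    by rewrite II0 card_eq0 => /eqP -> _; exists 1.
  move/eq_cardSP => [p Ap /IH {}IH] tA.
  have [|e e0 eA] := IH; first by move=> q [/tA].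
  have [e' e'0 e'P] := compact_norm_bounded (homeomorphic_ball_compact (tA _ Ap)).
  exists (Num.max e e'); first by rewrite lt_max e0.
  move=> q z Aq qz; rewrite le_max.
  have [qp|qp] := pselect (q = p); last by rewrite (eA q).
  by rewrite e'P ?orbT // -qp.
by exists r0, D; split.
Qed.

Variables (r0 D : R) (std : standing r0 D).

Let pset : prototile_set S := (std_sys std).1.

Lemma lam_gt1 : 1 < lam. Proof. by case: (std_sys std) => _ []. Qed.
Lemma lam_gt0 : 0 < lam. Proof. exact: lt_trans ltr01 lam_gt1. Qed.
Lemma lamX_gt0 n : 0 < lam ^+ n. Proof. by rewrite exprn_gt0 // lam_gt0. Qed.
Lemma lamX_neq0 n : lam ^+ n != 0. Proof. by rewrite gt_eqF // lamX_gt0. Qed.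
Lemma lam_neq0 : lam != 0. Proof. by rewrite gt_eqF // lam_gt0. Qed.
Lemma lamX_ge1 n : 1 <= lam ^+ n. Proof. by rewrite exprn_ege1 // ltW // lam_gt1. Qed.

Lemma lamX_unbounded (M : R) : exists N, forall n, (N <= n)%N -> M < lam ^+ n.
Proof.
have l1 := lam_gt1.
(* Bernoulli's inequality. *)
have H n : 1 + n%:R * (lam - 1) <= lam ^+ n.
  elim: n => [|n IH]; first by rewrite mul0r addr0 expr0.
  rewrite exprS; apply: le_trans (ler_wpM2l (ltW lam_gt0) IH).
  rewrite -natr1 -subr_ge0.
  have -> : lam * (1 + n%:R * (lam - 1)) - (1 + (n%:R + 1) * (lam - 1)) = n%:R * (lam - 1) ^+ 2 by ring.
  by rewrite mulr_ge0 // sqr_ge0.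
have l0 : 0 < lam - 1 by rewrite subr_gt0.
exists (Num.bound `|M / (lam - 1)|) => n Nn.
apply: lt_le_trans (H n); apply: (@lt_le_trans _ _ (n%:R * (lam - 1))); last by rewrite lerDr.
rewrite -ltr_pdivrMr //; apply: le_lt_trans (ler_norm _) _.
apply: lt_le_trans (archi_boundP _) _ => //.
by rewrite ler_nat.
Qed.

Lemma prototile_uniq p q x y : P p -> P q ->
  shift_tile x p = shift_tile y q -> p = q /\ x = y.
Proof.
move=> Pp Pq e; have := congr1 (shift_tile (- y)) e.
rewrite shift_tileK shift_tileD => e'.
have := prototiles_transl pset Pp Pq e'.
move=> /eqP; rewrite addrC subr_eq0 => /eqP xy; split=> //.
by rewrite -e' xy addNr shift_tile0.
Qed.

Lemma puncture_proto p x : P p -> puncture S (shift_tile x p) = x.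
Proof.
move=> Pp; rewrite /puncture; set A := (X in xget _ X).
have Ax : A x by exists p.
have /= [q Pq e] := xgetPex 0 (ex_intro _ x Ax).
by have [_ ->] := prototile_uniq Pp Pq e.
Qed.

Lemma puncture_proto0 p : P p -> puncture S p = 0.
Proof. by move=> Pp; rewrite -{1}[p]shift_tile0 puncture_proto. Qed.

Lemma ptile_proto p : P p -> ptile p.
Proof. by move=> Pp; exists p, 0; rewrite shift_tile0. Qed.

Lemma ptile_shift x t : ptile t -> ptile (shift_tile x t).
Proof. by move=> [p [y [Pp ->]]]; exists p, (x + y); rewrite shift_tileD. Qed.

Lemma puncture_shift x t : ptile t ->
  puncture S (shift_tile x t) = x + puncture S t.
Proof. by move=> [p [y [Pp ->]]]; rewrite shift_tileD !puncture_proto. Qed.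

Definition ptype t := shift_tile (- puncture S t) t.

Lemma ptypeP t : ptile t -> P (ptype t).
Proof.
by move=> [p [y [Pp ->]]]; rewrite /ptype puncture_proto // shift_tileK.
Qed.

Lemma ptypeE t : shift_tile (puncture S t) (ptype t) = t.
Proof. exact: shift_tileNK. Qed.

Lemma ptile_proto_puncture t : ptile t -> puncture S t = 0 -> P t.
Proof. by move=> /ptypeP; rewrite /ptype => Pt e; move: Pt; rewrite e oppr0 shift_tile0. Qed.

Lemma ptile_ball t z : ptile t -> `|z - puncture S t| < r0 -> t.1 z.
Proof.
move=> /ptypeP Pt zt; rewrite -(ptypeE t) shift_tile1.
exact: (std_ball std).
Qed.

Lemma ptile_bound t z : ptile t -> t.1 z -> `|z - puncture S t| <= D.
Proof.
move=> pt; rewrite -{1}(ptypeE t) shift_tile1 => tz.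
exact: (std_bound std (ptypeP pt)).
Qed.

Lemma ptile_nbhs t z : ptile t -> `|z - puncture S t| < r0 -> nbhs z t.1.
Proof.
move=> pt zt; apply/nbhs_norm; exists (r0 - `|z - puncture S t|); first by rewrite subr_gt0.
move=> y yz; apply: ptile_ball => //.
rewrite -(subrK z y) -addrA; apply: le_lt_trans (ler_normD _ _) _.
by rewrite -ltrBrDr.
Qed.

Lemma ptile_puncture_in t : ptile t -> t.1 (puncture S t).
Proof. by move=> pt; apply: ptile_ball => //; rewrite subrr normr0 (std_r0 std). Qed.

Lemma ptile_is_tile t : ptile t -> is_tile t.
Proof.
move=> [p [x [Pp ->]]]; apply: is_tile_shift.
exact: (prototiles_tile pset).
Qed.

Lemma ptile_closed t : ptile t -> closed t.1.
Proof.
move=> /ptile_is_tile /homeomorphic_ball_compact; apply: compact_closed.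
exact: cV_hausdorff.
Qed.

(** The working form of disjointness: tiles sharing one interior point are equal. Being a tile in
    the topological sense is automatic for translates of prototiles. *)
Lemma PstarP T : Pstar S T <-> [/\ forall t, T t -> ptile t &
  forall t u z, T t -> T u -> nbhs z t.1 -> nbhs z u.1 -> t = u].
Proof.
split=> [[[_ H] pT]|[pT H]].
  split=> // t u z Tt Tu tz uz; apply: contrapT => tu.
  by have : ((t.1)° `&` (u.1)°) z by []; rewrite (H _ _ Tt Tu tu).
split=> //; split=> [t /pT /ptile_is_tile //|t u Tt Tu tu].
by apply/seteqP; split=> // z [tz uz]; apply: tu; apply: (H _ _ z).
Qed.

Lemma Pstar_ptile T t : Pstar S T -> T t -> ptile t.
Proof. by move=> /PstarP [H _]; apply: H. Qed.

Lemma Pstar_near T t u : Pstar S T -> T t -> T u ->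
  `|puncture S t - puncture S u| < r0 -> t = u.
Proof.
move=> sT Tt Tu tu; have [pT H] := (PstarP T).1 sT.
apply: (H _ _ (puncture S t)) => //; apply: ptile_nbhs => //; try exact: pT.
by rewrite subrr normr0 (std_r0 std).
Qed.

Lemma Pstar_puncture_inj T t u : Pstar S T -> T t -> T u ->
  puncture S t = puncture S u -> t = u.
Proof.
move=> sT Tt Tu e; apply: (Pstar_near sT) => //.
by rewrite e subrr normr0 (std_r0 std).
Qed.

Lemma Pstar_sub T Q : Pstar S T -> Q `<=` T -> Pstar S Q.
Proof.
move=> /PstarP [pT H] QT; apply/PstarP; split=> [t /QT /pT //|t u z Qt Qu].
by apply: H; apply: QT.
Qed.

Lemma Pstar_shift x T : Pstar S T -> Pstar S (shift x T).
Proof.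
move=> /PstarP [pT H]; apply/PstarP; split=> [_ [t Tt <-]|].
  exact/ptile_shift/pT.
move=> _ _ z [t Tt <-] [u Tu <-] /nbhs_shift_tile tz /nbhs_shift_tile uz.
by congr shift_tile; apply: (H _ _ (z - x)).
Qed.

Lemma Pstar_set1 t : ptile t -> Pstar S [set t].
Proof. by move=> pt; apply/PstarP; split=> [u ->//|u v z -> ->]. Qed.

(** * Supertiles *)

Let rule : substitution_rule S := (std_sys std).2.
Local Notation omega := (omega S).
Local Notation supertile := (supertile S).
Local Notation puncture := (puncture S).
Local Notation Pstar := (Pstar S).

(** [omega] quantifies over presentations of a tile as a translated prototile. The presentation is
    unique, so the substitution of one tile is a function of the tile, written here through its
    puncture. *)
Definition subst_tile t := shift (lam *: puncture t) (subst S (ptype t)).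

Lemma omegaP T u : omega T u <-> exists t, [/\ T t, ptile t & subst_tile t u].
Proof.
split.
  move=> [p [x [Pp Tp pu]]]; exists (shift_tile x p); split=> //.
    by exists p, x.
  by rewrite /subst_tile /ptype puncture_proto // shift_tileK.
move=> [t [Tt pt tu]]; exists (ptype t), (puncture t); split=> //.
  exact: ptypeP.
by rewrite ptypeE.
Qed.

Lemma subst_tile_shift x t : ptile t ->
  subst_tile (shift_tile x t) = shift (lam *: x) (subst_tile t).
Proof.
move=> pt; rewrite /subst_tile /ptype puncture_shift // shiftD scalerDr.
by rewrite shift_tileD opprD [- x - _]addrC -addrA addNr addr0.
Qed.

Lemma omega_mono T Q : T `<=` Q -> omega T `<=` omega Q.
Proof. by move=> TQ u /omegaP [t [Tt pt tu]]; apply/omegaP; exists t; split; [apply: TQ| |]. Qed.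

Lemma omega_shift x T : omega (shift x T) = shift (lam *: x) (omega T).
Proof.
apply/seteqP; split=> u.
  move=> /omegaP [_ [[t Tt <-] pt]].
  have {}pt : ptile t by rewrite -(shift_tileK x t); apply: ptile_shift.
  rewrite subst_tile_shift // => -[v tv <-]; apply: shift_in.
  by apply/omegaP; exists t.
move=> [v /omegaP [t [Tt pt tv]] <-]; apply/omegaP; exists (shift_tile x t).
split; [exact: shift_in|exact: ptile_shift|rewrite subst_tile_shift //].
exact: shift_in.
Qed.

Lemma Pstar_subst_tile t : ptile t -> Pstar (subst_tile t).
Proof. by move=> pt; apply: Pstar_shift; case: (rule.2 _ (ptypeP pt)). Qed.

Lemma supp_subst_tile t z : ptile t ->
  supp (subst_tile t) z <-> t.1 (lam^-1 *: z).
Proof.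
move=> pt; rewrite /subst_tile supp_shift; have [_ ->] := rule.2 _ (ptypeP pt).
rewrite -{3}(ptypeE t) shift_tile1.
have e : lam^-1 *: (z - lam *: puncture t) = lam^-1 *: z - puncture t.
  by rewrite scalerBr scalerA mulVf ?lam_neq0 // scale1r.
rewrite -e; split=> [[y ty <-]|H]; first by rewrite scalerA mulVf ?lam_neq0 // scale1r.
by eexists; [exact: H|]; rewrite scalerA mulfV ?lam_neq0 // scale1r.
Qed.

Lemma supp_omega T z : Pstar T -> supp (omega T) z <-> supp T (lam^-1 *: z).
Proof.
move=> sT; split.
  move=> [u /omegaP [t [Tt pt tu]] uz]; exists t => //.
  by apply/supp_subst_tile => //; exists u.
move=> [t Tt tz]; have pt := Pstar_ptile sT Tt.
by move: tz => /(supp_subst_tile _ pt) [u tu uz]; exists u => //; apply/omegaP; exists t.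
Qed.

Lemma nbhs_scale (c : R) (A : set V) z : 0 < c ->
  nbhs z [set y | A (c^-1 *: y)] -> nbhs (c^-1 *: z) A.
Proof.
move=> c0 /nbhs_norm [e e0 H]; apply/nbhs_norm; exists (c^-1 * e).
  by rewrite mulr_gt0 // invr_gt0.
move=> y yz; have := H (c *: y); rewrite /= scalerA mulVf ?gt_eqF // scale1r; apply.
have -> : c *: y - z = c *: (y - c^-1 *: z).
  by rewrite scalerBr scalerA mulfV ?gt_eqF // scale1r.
by rewrite normrZ gtr0_norm // -ltr_pdivlMl.
Qed.

(** Overlapping tiles of [omega T] come from tiles of [T] that overlap after division by [lam],
    hence from one tile, and inside one substituted tile the rule already gives disjointness. *)
Lemma Pstar_omega T : Pstar T -> Pstar (omega T).
Proof.
move=> sT; have [pT H] := (PstarP T).1 sT; apply/PstarP; split.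
  move=> u /omegaP [t [Tt pt tu]]; exact: Pstar_ptile (Pstar_subst_tile pt) tu.
move=> u v z /omegaP [t [Tt pt tu]] /omegaP [s [Ts ps sv]] uz vz.
suff ts : t = s.
  move: sv; rewrite -ts => sv.
  by have [_] := (PstarP _).1 (Pstar_subst_tile pt); apply; [exact: tu|exact: sv|exact: uz|exact: vz].
have l0 := lam_gt0.
apply: (H _ _ (lam^-1 *: z)) => //; apply: nbhs_scale => //.
  by apply: filterS uz => y uy; apply/supp_subst_tile => //; exists u.
by apply: filterS vz => y vy; apply/supp_subst_tile => //; exists v.
Qed.

Lemma iter_omega_shift n x T :
  iter n omega (shift x T) = shift (lam ^+ n *: x) (iter n omega T).
Proof.
elim: n => [|n IH]; first by rewrite expr0 scale1r.
by rewrite !iterS IH omega_shift scalerA -exprS.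
Qed.

Lemma iter_omega_mono n T Q : T `<=` Q -> iter n omega T `<=` iter n omega Q.
Proof. by elim: n => // n IH TQ; rewrite !iterS; apply/omega_mono/IH. Qed.

Lemma supertile_shift n x t :
  supertile n (shift_tile x t) = shift (lam ^+ n *: x) (supertile n t).
Proof.
rewrite /Defs.supertile -iter_omega_shift; congr (iter n _ _).
by apply/seteqP; split=> [u ->|_ [_ -> <-] //]; apply: shift_in.
Qed.

Lemma supertileE n t :
  supertile n t = shift (lam ^+ n *: puncture t) (supertile n (ptype t)).
Proof. by rewrite -supertile_shift ptypeE. Qed.

Lemma iter_omegaP n T u : iter n omega T u <-> exists2 t, T t & supertile n t u.
Proof.
split; last first.
  by move=> [t Tt]; apply: iter_omega_mono => _ ->.
elim: n u => [|n IH] u /=; first by move=> Tu; exists u.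
move=> /omegaP [v [/IH [t Tt tv] pv vu]]; exists t => //.
by apply/omegaP; exists v.
Qed.

Lemma supertileD m n t : supertile (m + n) t = iter m omega (supertile n t).
Proof. by rewrite /Defs.supertile iterD. Qed.

Lemma supertileDP m n t u : supertile (m + n) t u <->
  exists2 v, supertile n t v & supertile m v u.
Proof. by rewrite supertileD; apply: iter_omegaP. Qed.

Lemma iter_omega_Pstar n T : Pstar T -> Pstar (iter n omega T).
Proof. by move=> sT; elim: n => // n; exact: Pstar_omega. Qed.

Lemma supertile_Pstar n t : ptile t -> Pstar (supertile n t).
Proof. by move=> pt; apply/iter_omega_Pstar/Pstar_set1. Qed.

Lemma supertile_ptile n t u : ptile t -> supertile n t u -> ptile u.
Proof. by move=> pt; apply/Pstar_ptile/supertile_Pstar. Qed.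

Lemma supp_iter_omega n T z : Pstar T ->
  supp (iter n omega T) z <-> supp T ((lam ^+ n)^-1 *: z).
Proof.
move=> sT; elim: n z => [|n IH] z; first by rewrite expr0 invr1 scale1r.
rewrite iterS supp_omega ?IH; last exact: iter_omega_Pstar.
by rewrite scalerA -invfM -exprSr.
Qed.

Lemma supp_supertile n t z : ptile t ->
  supp (supertile n t) z <-> t.1 ((lam ^+ n)^-1 *: z).
Proof.
move=> pt; rewrite supp_iter_omega; last exact: Pstar_set1.
by split=> [[_ ->]//|H]; exists t.
Qed.

Lemma supertile_sub_supp n t u z : ptile t -> supertile n t u -> u.1 z ->
  t.1 ((lam ^+ n)^-1 *: z).
Proof. by move=> pt tu uz; apply/supp_supertile => //; exists u. Qed.

Lemma supertile_neq0 n t : ptile t -> supertile n t !=set0.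
Proof.
move=> pt.
have /supp_supertile : t.1 ((lam ^+ n)^-1 *: (lam ^+ n *: puncture t)).
  by rewrite scalerA mulVf ?lamX_neq0 // scale1r; apply: ptile_puncture_in.
by move=> /(_ pt) [u tu _]; exists u.
Qed.

(* A tile of [supertile n t] determines [t], even when only the interior of the
   tile is known to overlap the support of the supertile. *)
Lemma supertile_overlap T n t t' u z : Pstar T -> T t -> T t' ->
  supertile n t u -> nbhs z u.1 ->
  nbhs z [set y | t'.1 ((lam ^+ n)^-1 *: y)] -> t = t'.
Proof.
move=> sT Tt Tt' tu uz t'z; have [pT H] := (PstarP T).1 sT.
have pt := pT _ Tt; have l0 := lamX_gt0 n.
apply: (H _ _ ((lam ^+ n)^-1 *: z)) => //; apply: nbhs_scale => //.
by apply: filterS uz => y uy; apply: (supertile_sub_supp pt tu).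
Qed.

Lemma ptile_nbhs_puncture t : ptile t -> nbhs (puncture t) t.1.
Proof. by move=> pt; apply: ptile_nbhs => //; rewrite subrr normr0 (std_r0 std). Qed.

Lemma supertile_inj T n t t' u : Pstar T -> T t -> T t' ->
  supertile n t u -> supertile n t' u -> t = t'.
Proof.
move=> sT Tt Tt' tu t'u.
have pt := Pstar_ptile sT Tt; have pt' := Pstar_ptile sT Tt'.
have pu := supertile_ptile pt tu.
apply: (supertile_overlap sT Tt Tt' tu (ptile_nbhs_puncture pu)).
apply: filterS (ptile_nbhs_puncture pu) => y uy.
exact: (supertile_sub_supp pt' t'u).
Qed.

(** Primitivity is stated for one order and persists for larger ones: substitute once, choose any
    tile of the result and continue from its type. *)
Lemma prim_ge : exists N, forall n p q, (N <= n)%N -> P p -> P q ->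
  exists x, supertile n p (shift_tile x q).
Proof.
have [N HN] := std_prim std; exists N => n p q Nn.
rewrite -(subnKC Nn); elim: (n - N)%N p q => [|k IH] p q Pp Pq.
  by rewrite addn0; apply: HN.
have [v pv] := supertile_neq0 1 (ptile_proto Pp).
have pv' := supertile_ptile (ptile_proto Pp) pv.
have [x H] := IH _ _ (ptypeP pv') Pq.
exists (lam ^+ (N + k) *: puncture v + x).
rewrite -addSnnS -addn1 addnAC; apply/supertileDP; exists v => //.
by rewrite supertileE -shift_tileD; apply: shift_in.
Qed.

Lemma prim_ptile : exists N, forall n t q, (N <= n)%N -> ptile t -> P q ->
  exists x, supertile n t (shift_tile x q).
Proof.
have [N HN] := prim_ge; exists N => n t q Nn pt Pq.
have [x H] := HN n _ q Nn (ptypeP pt) Pq.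
exists (lam ^+ n *: puncture t + x).
by rewrite supertileE -shift_tileD; apply: shift_in.
Qed.

(** * The tiling space *)

Local Notation Omega := (Omega S).

Definition legal Q := exists n p x, P p /\ Q `<=` shift x (supertile n p).

Lemma legal_sub Q Q' : Q `<=` Q' -> legal Q' -> legal Q.
Proof.
by move=> QQ' [n [p [x [Pp H]]]]; exists n, p, x; split=> //; exact: subset_trans H.
Qed.

Lemma legal_shift x Q : legal Q -> legal (shift x Q).
Proof.
move=> [n [p [y [Pp H]]]]; exists n, p, (x + y); split=> //.
by rewrite -shiftD; apply: shift_sub.
Qed.

Lemma legal_supertile n t : ptile t -> legal (supertile n t).
Proof.
move=> pt; exists n, (ptype t), (lam ^+ n *: puncture t).
by split; [exact: ptypeP|rewrite -supertileE].
Qed.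

Lemma legal_omega Q : legal Q -> legal (omega Q).
Proof.
move=> [n [p [x [Pp H]]]]; exists n.+1, p, (lam *: x); split=> //.
by rewrite /Defs.supertile iterS -omega_shift; apply: omega_mono.
Qed.

(** The order can be raised at will because, by primitivity, a supertile of [p] of order [N + k]
    contains a translate of [p] itself. *)
Lemma legal_ge k Q : legal Q -> exists n p x,
  [/\ (k <= n)%N, P p & Q `<=` shift x (supertile n p)].
Proof.
move=> [n [p [x [Pp H]]]]; have [N HN] := prim_ge.
have [y Hy] := HN (N + k)%N p p (leq_addr _ _) Pp Pp.
exists (n + (N + k))%N, p, (x - lam ^+ n *: y); split=> //.
  by rewrite addnA leq_addl.
rewrite -shiftD; apply: subset_trans H _; apply: shift_sub.
rewrite shift_subE opprK -supertile_shift supertileD.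
by apply: iter_omega_mono => _ ->.
Qed.

Lemma OmegaP T : Omega T <-> [/\ Pstar T, forall z, supp T z &
  forall Q, Q `<=` T -> finite_set Q -> legal Q].
Proof.
split.
  move=> [sT cT H]; split=> //; first by move=> z; rewrite cT.
  move=> Q QT fQ; apply: H => //; split=> //.
  by case: (Pstar_sub sT QT).
move=> [sT cT H]; split=> //; first by apply/seteqP; split.
by move=> Q QT [_ fQ]; apply: H.
Qed.

Lemma Omega_Pstar T : Omega T -> Pstar T. Proof. by case/OmegaP. Qed.

Lemma Omega_ptile T t : Omega T -> T t -> ptile t.
Proof. by move=> /Omega_Pstar; apply: Pstar_ptile. Qed.

Lemma Omega_legal T Q : Omega T -> Q `<=` T -> finite_set Q -> legal Q.
Proof. by move=> /OmegaP [_ _]; apply. Qed.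

Lemma Omega_near T z : Omega T -> exists2 t, T t & `|puncture t - z| <= D.
Proof.
move=> oT; have [_ /(_ z) [t Tt tz] _] := (OmegaP T).1 oT.
exists t => //; rewrite distrC; apply: ptile_bound => //; exact: Omega_ptile oT Tt.
Qed.

Lemma Omega_shift x T : Omega T -> Omega (shift x T).
Proof.
move=> /OmegaP [sT cT H]; apply/OmegaP; split.
- exact: Pstar_shift.
- by move=> z; apply/supp_shift.
- move=> Q /shift_subE QT fQ; rewrite -(shiftNK x Q); apply: legal_shift.
  by apply: H => //; apply: finite_image.
Qed.

Lemma Omega_omega T : Omega T -> Omega (omega T).
Proof.
move=> /OmegaP [sT cT H]; apply/OmegaP; split.
- exact: Pstar_omega.
- by move=> z; apply/supp_omega.
- move=> Q QT fQ.
  have /choice [f Hf] : forall u, exists t, Q u -> [/\ T t, ptile t & subst_tile t u].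
    move=> u; have [Qu|Qu] := pselect (Q u); last by exists u.
    by have /omegaP [t Ht] := QT u Qu; exists t.
  have /legal_omega : legal (f @` Q).
    apply: H; last exact: finite_image.
    by move=> _ [u Qu <-]; case: (Hf u Qu).
  apply: legal_sub => u Qu; apply/omegaP; exists (f u).
  by case: (Hf u Qu) => ? ? ?; split=> //; exists u.
Qed.

Lemma iter_Omega n T : Omega T -> Omega (iter n omega T).
Proof. by move=> oT; elim: n => // n; exact: Omega_omega. Qed.

(** A self-similar tiling: a tile [t] with 0 in its interior that belongs to its own [m]th
    supertile, so that the supertiles of orders [k * m] increase and exhaust space. Primitivity
    finds every supertile inside a late enough stage. *)
Lemma Omega_star : exists T, Omega T /\
  forall n q, P q -> exists x, shift x (supertile n q) `<=` T.
Proof.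
have [p Pp] := prototiles_neq0 pset; have pp := ptile_proto Pp.
have r00 := std_r0 std; have D0 := std_D std.
(* This order makes the vector [c] below shorter than [r0]: the copy of [p] is found at some [x] of
   norm at most [lam ^+ N * (2 * D)], while [lam ^+ m - 1] is at least
   [lam ^+ N * (lam ^+ n - 1)]. *)
have [n /(_ n (leqnn _)) Hn] := lamX_unbounded (2 * D / r0 + 1).
have [v pv v0] : supp (supertile n p) 0.
  by apply/supp_supertile => //; rewrite scaler0 -(puncture_proto0 Pp); exact: ptile_puncture_in.
have ptv := supertile_ptile pp pv.
have [N HN] := prim_ptile.
have [x Hx] := HN N v p (leqnn _) ptv Pp.
have x_le : `|x| <= lam ^+ N * (2 * D).
  have pu : ptile (shift_tile x p) by exists p, x.
  have := supertile_sub_supp ptv Hx (ptile_puncture_in pu).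
  rewrite puncture_proto // => /(ptile_bound ptv) H1.
  have H0 := ptile_bound ptv v0.
  rewrite -ler_pdivrMl ?lamX_gt0 // -[X in X * `|x|]gtr0_norm ?invr_gt0 ?lamX_gt0 //.
  rewrite -normrZ -[X in `|X|](subrK (puncture v)) (le_trans (ler_normD _ _)) //.
  by rewrite mulrDl mul1r lerD // -normrN -sub0r.
pose m := (N + n)%N; have pm : supertile m p (shift_tile x p).
  by apply/supertileDP; exists v.
pose a : R := lam ^+ m - 1.
have a_ge : lam ^+ N * (lam ^+ n - 1) <= a.
  by rewrite /a /m exprD mulrBr mulr1 lerB // lamX_ge1.
have n1 : 2 * D < r0 * (lam ^+ n - 1).
  by rewrite -ltr_pdivrMl // mulrC ltrBrDr.
have a_gt0 : 0 < a.
  apply: lt_le_trans a_ge; rewrite mulr_gt0 ?lamX_gt0 // -(pmulr_rgt0 _ r00).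
  by apply: lt_trans n1; rewrite mulr_gt0.
(* [c] is the fixed point of the map sending [y] to [lam ^+ m *: y + x], which places [p] at its own
   position in the [m]th supertile. *)
pose c := - (a^-1 *: x); pose t := shift_tile c p.
have pt : ptile t by exists p, c.
have c_lt : `|c| < r0.
  rewrite normrN normrZ gtr0_norm ?invr_gt0 // ltr_pdivrMl // mulrC.
  apply: le_lt_trans x_le _; rewrite (lt_le_trans _ (ler_wpM2l (ltW r00) a_ge)) //.
  by rewrite [ltRHS]mulrCA ltr_pM2l ?lamX_gt0.
have tt : supertile m t t.
  rewrite {1}/t supertile_shift.
  have -> : t = shift_tile (lam ^+ m *: c) (shift_tile x p).
    rewrite shift_tileD; congr shift_tile.
    have -> : lam ^+ m = a + 1 by rewrite /a subrK.
    by rewrite scalerDl scale1r /c scalerN scalerA mulfV ?gt_eqF // scale1r addrAC addNr add0r.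
  exact: shift_in.
have m0 : (0 < m)%N.
  rewrite lt0n; apply/eqP => m0; move: a_gt0; rewrite /a m0 expr0 subrr.
  by rewrite ltxx.
pose F k := supertile (k * m) t.
have mF i j : (i <= j)%N -> F i `<=` F j.
  move=> /subnKC <-; elim: (j - i)%N => [|l IH]; first by rewrite addn0.
  apply: subset_trans IH _; rewrite /F addnS mulSn => u tu.
  by rewrite (addnC m); apply/supertileDP; exists t.
exists (\bigcup_k F k); split; first (apply/OmegaP; split).
- apply/PstarP; split=> [u [k _]|u w z [i _ iu] [j _ jw]].
    exact: supertile_ptile.
  have [_] := (PstarP _).1 (supertile_Pstar (maxn i j * m) pt); apply.
    by apply: mF iu; rewrite leq_maxl.
  by apply: mF jw; rewrite leq_maxr.
- move=> z; have [k Hk] := lamX_unbounded (`|z| / (r0 - `|c|)).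
  have /supp_supertile : t.1 ((lam ^+ (k * m))^-1 *: z).
    apply: ptile_ball => //; rewrite puncture_proto //.
    apply: le_lt_trans (ler_normB _ _) _; rewrite -ltrBrDr normrZ.
    rewrite gtr0_norm ?invr_gt0 ?lamX_gt0 // ltr_pdivrMl ?lamX_gt0 // mulrC.
    by rewrite -ltr_pdivrMl ?subr_gt0 // mulrC Hk // leq_pmulr.
  by move=> /(_ pt) [u tu uz]; exists u => //; exists k.
- move=> Q QF fQ; have [k Qk] := finite_sub_chain mF fQ QF.
  by apply: legal_sub Qk _; exact: legal_supertile.
- move=> k q Pq; pose j := ((N + k) * m - k)%N.
  have km : (N + k <= (N + k) * m)%N by rewrite leq_pmulr.
  have jN : (N <= j)%N by rewrite leq_subRL ?(leq_trans _ km) ?leq_addl // addnC.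
  have [y Hy] := HN j t q jN pt Pq.
  exists (lam ^+ k *: y) => u; rewrite -supertile_shift => yu.
  exists (N + k)%N => //; rewrite /F.
  have -> : ((N + k) * m = k + j)%N by rewrite subnKC // (leq_trans _ km) // leq_addl.
  by apply/supertileDP; exists (shift_tile y q).
Qed.

(* Finite local complexity is only assumed tiling by tiling; it is used here
   through two-tile patches, all of which occur in the tiling of [Omega_star]. *)
Lemma local_finite (r : R) : exists F : set tile, finite_set F /\
  forall Q p t, legal Q -> P p -> Q p -> Q t -> `|puncture t| <= r -> F t.
Proof.
have [T [oT HT]] := Omega_star.
have D0 := std_D std; pose e := `|r| + D.
have e0 : 0 <= e by rewrite addr_ge0 // ltW.
(* A patch [{p, t}] lies in a sup-norm ball of radius [e], so its Euclidean diameter is at most [d]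
   times [e + e]; adding 1 makes the inequality strict. *)
have [|FF [fF HF]] := std_flc std oT (r := d%:R * (e + e) + 1).
  by rewrite ltr_wpDl // mulr_ge0 // addr_ge0.
pose sh Q0 u0 := @shift_tile R d L (- puncture u0) @` Q0.
(* The patches in [FF] are known up to translation only. The translation is recovered by putting the
   puncture of one of the tiles, the one corresponding to [p], at the origin. *)
exists (\bigcup_(Q0 in FF `&` finite_set) \bigcup_(u0 in Q0) sh Q0 u0); split.
  apply: bigcup_finite; first exact: finite_setIl.
  by move=> Q0 [_ fQ0]; apply: bigcup_finite => // u0 _; apply: finite_image.
move=> Q p t [n [q [x [Pq Qx]]]] Pp Qp Qt tr.
have pp := ptile_proto Pp.
have ptt : ptile t.
  by apply: Pstar_ptile (Qx _ Qt); apply/Pstar_shift/supertile_Pstar/ptile_proto.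
have [y HTy] := HT n q Pq.
pose w := y - x; pose Q2 : set tile := [set p; t].
have fQ2 : finite_set Q2 by rewrite /Q2 finite_setU; split; exact: finite_set1.
have Q2Q : Q2 `<=` Q by move=> _ [->|->].
have wQ : shift w Q2 `<=` T.
  apply: subset_trans HTy; rewrite shift_subE shiftD /w addrA addNr add0r.
  by rewrite -shift_subE; apply: subset_trans Qx.
clearbody w.
have bd z : supp (shift w Q2) z -> `|z - w| <= e.
  rewrite supp_shift => -[u [->|->]] uz.
    by rewrite (le_trans (std_bound std Pp uz)) // /e lerDr.
  have := ptile_bound ptt uz; set z' := z - w => H.
  rewrite -[z'](subrK (puncture t)) (le_trans (ler_normD _ _)) // /e addrC lerD //.
  exact: le_trans tr (ler_norm _).
have [] := HF (shift w Q2) _ wQ.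
- split; last exact: finite_image.
  by case: (Pstar_sub (Omega_Pstar oT) wQ).
- apply: (@le_lt_trans _ _ (d%:R * (e + e))%:E); last by rewrite lte_fin ltrDl.
  apply: ge_ereal_sup => _ [z1 /bd H1] [z2 /bd H2] <-; rewrite lee_fin.
  apply: le_trans (enorm_le _) _; apply: ler_wpM2l => //.
  have -> : z1 - z2 = (z1 - w) - (z2 - w) by rewrite opprD opprK addrACA addNr addr0.
  by apply: le_trans (ler_normB _ _) _; exact: lerD.
move=> Q0 [x0 [FQ0 eQ0]].
have eQ : Q2 = shift (- w + x0) Q0 by rewrite -shiftD -eQ0 shiftK.
have fQ0 : finite_set Q0.
  by rewrite -(shiftK (- w + x0) Q0) -eQ; apply: finite_image.
have : Q2 t by right.
have : Q2 p by left.
rewrite {1 2}eQ => -[u0 Qu0 e1] [u Qu <-].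
exists Q0 => //; exists u0 => //; exists u => //; congr shift_tile.
have pu0 : ptile u0 by rewrite -(shift_tileK (- w + x0) u0) e1; apply: ptile_shift.
move: (puncture_proto0 Pp); rewrite -e1 puncture_shift // => /eqP.
by rewrite addr_eq0 => /eqP.
Qed.

Lemma local_finite_at (r : R) u : ptile u -> exists F : set tile, finite_set F /\
  forall Q t, legal Q -> Q u -> Q t -> `|puncture t| <= r -> F t.
Proof.
move=> pu; have [F [fF HF]] := local_finite (r + `|puncture u|).
exists (shift_tile (puncture u) @` F); split; first exact: finite_image.
move=> Q t lQ Qu Qt tr.
have ptt : ptile t.
  have [n [p [x [Pp Qx]]]] := lQ.
  by apply: Pstar_ptile (Qx _ Qt); apply/Pstar_shift/supertile_Pstar/ptile_proto.
exists (shift_tile (- puncture u) t); last by rewrite shift_tileNK.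
apply: (HF (shift (- puncture u) Q) (ptype u)).
- exact: legal_shift.
- exact: ptypeP.
- exact: shift_in.
- exact: shift_in.
- by rewrite puncture_shift // addrC (le_trans (ler_normB _ _)) // lerD2r.
Qed.

Lemma Omega_locally_finite T (r : R) : Omega T ->
  finite_set [set t | T t /\ `|puncture t| <= r].
Proof.
move=> oT; have [u Tu _] := Omega_near 0 oT.
have [F [fF HF]] := local_finite_at r (Omega_ptile oT Tu).
apply: sub_finite_set fF => t [Tt tr].
have sT : [set u; t] `<=` T by move=> _ [->|->].
apply: (HF [set u; t]) => //; [|by left|by right].
exact: (Omega_legal oT).
Qed.

Lemma supertile_finite n t : ptile t -> finite_set (supertile n t).
Proof.
move=> pt; have [u tu] := supertile_neq0 n pt.
have [F [fF HF]] := local_finite_at (lam ^+ n * (D + `|puncture t|)) (supertile_ptile pt tu).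
apply: sub_finite_set fF => v tv; apply: (HF _ _ (legal_supertile n pt) tu tv).
have pv := supertile_ptile pt tv.
have := ptile_bound pt (supertile_sub_supp pt tv (ptile_puncture_in pv)).
set z := _ *: _ => H.
have -> : puncture v = lam ^+ n *: z by rewrite /z scalerA mulfV ?lamX_neq0 // scale1r.
rewrite normrZ gtr0_norm ?lamX_gt0 // ler_pM2l ?lamX_gt0 //.
by rewrite -{1}[z](subrK (puncture t)) (le_trans (ler_normD _ _)) // lerD2r.
Qed.

(** * Ultralimits of tilings *)

Section ultralimits.
Variables (I : Type) (F : set_system I) (FU : UltraFilter F) (T_ : I -> set tile).

Definition ulim : set tile := [set t | F [set i | T_ i t]].

Lemma ulim_finite Q : finite_set Q ->
  F [set i | forall t, Q t -> (T_ i t <-> ulim t)].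
Proof.
move=> fQ; apply: filter_finite_forall => // t _.
have [H|H] := in_ultra_setVsetC [set i | T_ i t] FU.
  by apply: filterS (H) => i /= Tt; split.
apply: filterS (H) => i /= Tt; split=> // H'.
by have [j [/= ? ?]] := filter_ex (filterI H H').
Qed.

Hypothesis tight : forall r : R, exists A : set tile, finite_set A /\
  F [set i | forall t, T_ i t -> `|puncture t| <= r -> A t].

(** Tightness turns agreement tile by tile into agreement on a whole ball, since only finitely many
    tiles are in question there. *)
Lemma ulim_near (r : R) :
  F [set i | forall t, `|puncture t| <= r -> (T_ i t <-> ulim t)].
Proof.
have [A [fA FA]] := tight r.
apply: filterS (filterI FA (ulim_finite fA)) => i [Hi Ai] t tr.
split=> [Tt|Ut].
  by rewrite -(Ai t) //; apply: Hi.
rewrite Ai //; have [j [/= Tj Hj]] := filter_ex (filterI Ut FA).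
exact: Hj.
Qed.

(** Disjointness and legality concern finitely many tiles and pass to any ultralimit. Covering is
    where tightness enters: the tile over a given point could otherwise change forever. *)
Lemma ulim_Omega : (forall r : R, F [set i | [/\ Pstar (T_ i),
    forall Q, Q `<=` T_ i -> finite_set Q -> legal Q &
    forall z, `|z| <= r -> supp (T_ i) z]]) -> Omega ulim.
Proof.
move=> H; apply/OmegaP; split.
- apply/PstarP; split=> [t Ut|t u z Ut Uu].
    have [i [[sT _ _] Tt]] := filter_ex (filterI (H 0) Ut).
    exact: Pstar_ptile sT Tt.
  have [i [[[sT _ _] Tt] Tu]] := filter_ex (filterI (filterI (H 0) Ut) Uu).
  by have [_] := (PstarP _).1 sT; apply.
- move=> z; have [i [[sT _ cT] Hi]] := filter_ex (filterI (H `|z|) (ulim_near (`|z| + D))).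
  have [t Tt tz] := cT z (lexx _); exists t => //.
  rewrite -Hi //; have := ptile_bound (Pstar_ptile sT Tt) tz.
  move=> H1; rewrite -[puncture t](subrK z) (le_trans (ler_normD _ _)) //.
  by rewrite addrC lerD2l distrC.
- move=> Q QU fQ.
  have [i [[_ lT _] Hi]] := filter_ex (filterI (H 0) (ulim_finite fQ)).
  by apply: lT => // t Qt; rewrite Hi //; apply: QU.
Qed.

End ultralimits.

(** * Desubstitution, aperiodicity and minimality *)

Lemma Omega_meets T t : Omega T -> ptile t ->
  exists u z, [/\ T u, nbhs z u.1 & nbhs z t.1].
Proof.
move=> oT pt.
(* [U] is a ball inside [t], and the finitely many tiles of [N] include every tile of [T] that can
   reach it. *)
pose N := [set u | T u /\ `|puncture u| <= `|puncture t| + r0 + D].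
pose U := [set z : V | `|z - puncture t| < r0].
have UE : U = ball (puncture t) r0.
  by apply/seteqP; split=> z; rewrite /U -ball_normE /= distrC.
have [|||||u [z [[Tu _] Uz uz]]] :=
    @finite_closed_cover V tile N (fun u => u.1) U.
- exact: Omega_locally_finite.
- by move=> u [Tu _]; apply/ptile_closed/(Omega_ptile oT).
- by rewrite UE; apply: ball_open; exact: std_r0 std.
- by exists (puncture t); rewrite /U /= subrr normr0 (std_r0 std).
- move=> z; rewrite /U /= => zt.
  have [_ /(_ z) [u Tu uz] _] := (OmegaP T).1 oT; exists u => //; split=> //.
  have := ptile_bound (Omega_ptile oT Tu) uz => zu.
  rewrite -[puncture u](subrK z) (le_trans (ler_normD _ _)) // addrC.
  rewrite -[puncture u - z]opprB normrN lerD //.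
  rewrite -[X in `|X|](subrK (puncture t)) (le_trans (ler_normD _ _)) // addrC.
  by rewrite lerD2l ltW.
by exists u, z; split=> //; exact: ptile_nbhs.
Qed.

Lemma Omega_maximal T T' : Omega T -> Pstar T' -> T `<=` T' -> T' = T.
Proof.
move=> oT sT' TT'; apply/seteqP; split=> // t T't.
have [u [z [Tu uz tz]]] := Omega_meets oT (Pstar_ptile sT' T't).
have [_ H] := (PstarP T').1 sT'.
by rewrite (H _ _ z T't (TT' _ Tu)).
Qed.

Lemma subst_tile_near t u : ptile t -> subst_tile t u ->
  `|puncture t - lam^-1 *: puncture u| <= D.
Proof.
move=> pt tu; have pu := Pstar_ptile (Pstar_subst_tile pt) tu.
rewrite distrC; apply: ptile_bound => //.
by apply/supp_subst_tile => //; exists u => //; exact: ptile_puncture_in.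
Qed.

Lemma supertile1 t : ptile t -> supertile 1 t = subst_tile t.
Proof.
move=> pt; apply/seteqP; split=> u.
  by move=> /omegaP [_ [-> _]].
by move=> tu; apply/omegaP; exists t.
Qed.

(** Such a [t] is determined by its type and by the tile [v] of the substituted type that becomes
    [u]: its puncture is then [lam^-1] times the difference of the two punctures. *)
Lemma subst_tile_preim_finite u : finite_set [set t | ptile t /\ subst_tile t u].
Proof.
pose C := \bigcup_(p in P) \bigcup_(v in subst_tile p)
   [set shift_tile (lam^-1 *: (puncture u - puncture v)) p].
have : finite_set C.
  apply: bigcup_finite; first exact: prototiles_finite pset.
  move=> p Pp; apply: bigcup_finite => [|v _]; last exact: finite_set1.
  by rewrite -supertile1; [apply/supertile_finite|]; exact: ptile_proto.
apply: sub_finite_set => t [pt tu]; exists (ptype t); first exact: ptypeP.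
move: tu; rewrite -{1}(ptypeE t) subst_tile_shift; last exact/ptile_proto/ptypeP.
move=> [v tv <-]; exists v => //=.
have pv : ptile v by apply: Pstar_ptile tv; apply/Pstar_subst_tile/ptile_proto/ptypeP.
by rewrite puncture_shift // addrK scalerA mulVf ?lam_neq0 // scale1r ptypeE.
Qed.

(** Every finite patch of [T] lies in a supertile of positive order, hence in the substitution of
    some legal set. An ultralimit of these sets over growing patches is the desubstituted tiling. *)
Lemma omega_surj T : Omega T -> exists2 T', Omega T' & omega T' = T.
Proof.
move=> oT; have l0 := lam_gt0; have D0 := std_D std.
have [t0 Tt0 _] := Omega_near 0 oT.
(* Keeping [t0] in every patch anchors the desubstituted sets: each contains one of the finitely
   many tiles whose substitution contains [t0], which gives tightness. *)
pose Q (n : nat) := [set t | T t /\ `|puncture t| <= n%:R] `|` [set t0].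
have /choice [P_ HP] : forall n, exists X, [/\ Pstar X,
    forall Q, Q `<=` X -> finite_set Q -> legal Q & Q n `<=` omega X].
  move=> n.
  have /(legal_ge 1) [m [p [x [m0 Pp Hx]]]] : legal (Q n).
    apply: (Omega_legal oT); first by move=> t [[]//|->].
    rewrite finite_setU; split; last exact: finite_set1.
    exact: Omega_locally_finite.
  case: m m0 Hx => // m _ Hx.
  exists (shift (lam^-1 *: x) (supertile m p)); split.
  - exact/Pstar_shift/supertile_Pstar/ptile_proto.
  - move=> X XS _; apply: legal_sub XS _; apply: legal_shift.
    exact/legal_supertile/ptile_proto.
  - by rewrite omega_shift scalerA mulfV ?lam_neq0 // scale1r.
have [G [GU sG]] := ultraFilterLemma (F := \oo) _.
have Gge (r : R) : G [set n : nat | r <= n%:R].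
  apply: sG; exists (Num.bound `|r|) => // n /= rn.
  apply: le_trans (ler_norm _) _; apply: le_trans (ltW (archi_boundP _)) _ => //.
  by rewrite ler_nat.
have GQ t : T t -> G [set n | Q n t].
  by move=> Tt; apply: filterS (Gge `|puncture t|) => n Hn; left.
have tight : forall r : R, exists A : set tile, finite_set A /\
  G [set i | forall t, P_ i t -> `|puncture t| <= r -> A t].
  move=> r; pose C := [set t | ptile t /\ subst_tile t t0].
  have /choice [f Hf] : forall q, exists A : set tile, ptile q -> finite_set A /\
    forall Q t, legal Q -> Q q -> Q t -> `|puncture t| <= r -> A t.
    move=> q; have [pq|pq] := pselect (ptile q); last by exists set0.
    by have [A HA] := local_finite_at r pq; exists A.
  exists (\bigcup_(q in C) f q); split.
    apply: bigcup_finite; first exact: subst_tile_preim_finite.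
    by move=> q [/Hf []].
  apply: filterS (@filterT _ G _) => n _ t Pt tr.
  have [sP lP QP] := HP n.
  have /QP /omegaP [q [Pq pq qt0]] : Q n t0 by right.
  exists q => //; have [_ H] := Hf q pq.
  apply: (H [set q; t]) => //; [|by left|by right].
  by apply: lP => [_ [->|->] //|].
exists (ulim G P_).
  apply: ulim_Omega => // r.
  apply: filterS (Gge (lam * r + D)) => n /= Hn.
  have [sP lP QP] := HP n; split=> // z zr.
  have : supp (omega (P_ n)) (lam *: z).
    have [_ /(_ (lam *: z)) [t Tt tz] _] := (OmegaP T).1 oT.
    exists t => //; apply: QP; left; split=> //; apply: le_trans Hn.
    have := ptile_bound (Omega_ptile oT Tt) tz => H.
    rewrite -[puncture t](subrK (lam *: z)) (le_trans (ler_normD _ _)) // addrC.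
    by rewrite -[_ - lam *: z]opprB normrN lerD // normrZ gtr0_norm // ler_pM2l.
  by move=> /supp_omega; rewrite scalerA mulVf ?lam_neq0 // scale1r; apply.
(* It is enough that [T] is contained in the substituted limit, since a tiling has no proper
   extension to a partial tiling. *)
apply: Omega_maximal => //.
  apply/Pstar_omega/PstarP; split=> [t Ut|t u z Ut Uu].
    have [i Tt] := filter_ex Ut; have [sP _ _] := HP i.
    exact: Pstar_ptile sP Tt.
  have [i [Tt Tu]] := filter_ex (filterI Ut Uu); have [sP _ _] := HP i.
  by have [_] := (PstarP _).1 sP; apply.
move=> u Tu.
have [n [Qu Hn]] := filter_ex (filterI (GQ _ Tu)
   (ulim_near GU tight (`|lam^-1 *: puncture u| + D))).
have [sP lP QP] := HP n; have /omegaP [q [Pq pq qu]] := QP _ Qu.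
apply/omegaP; exists q; split=> //; rewrite -Hn //.
rewrite -[puncture q](subrK (lam^-1 *: puncture u)) (le_trans (ler_normD _ _)) //.
by rewrite addrC lerD2l; exact: subst_tile_near.
Qed.

Lemma iter_omega_surj n T : Omega T -> exists2 T', Omega T' & iter n omega T' = T.
Proof.
elim: n T => [|n IH] T oT; first by exists T.
have [T1 oT1 <-] := omega_surj oT; have [T2 oT2 <-] := IH _ oT1.
by exists T2.
Qed.

Lemma iter_omega_inj n T T' : Omega T -> Omega T' ->
  iter n omega T = iter n omega T' -> T = T'.
Proof.
move=> oT oT'; elim: n => //= n IH H; apply: IH.
by apply: (std_inj std) => //; rewrite inE; exact: iter_Omega.
Qed.

(** Cancelling [omega] [n] times, by injectivity, turns a period [x] into a period smaller by the
    factor [lam ^+ n]. Once it is shorter than [r0] a tile overlaps its own translate, so the period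
    vanishes. *)
Lemma aperiodic T x : Omega T -> shift x T = T -> x = 0.
Proof.
move=> oT xT; apply/eqP; rewrite -normr_le0 leNgt; apply/negP => x0.
have [n /(_ n (leqnn n)) Hn] := lamX_unbounded (`|x| / r0).
have [T' oT' T'E] := iter_omega_surj n oT.
have e : shift ((lam ^+ n)^-1 *: x) T' = T'.
  apply: (@iter_omega_inj n) => //; first exact: Omega_shift.
  by rewrite iter_omega_shift scalerA mulfV ?lamX_neq0 // scale1r T'E.
have [t T't _] := Omega_near 0 oT'.
have pt := Omega_ptile oT' T't.
have : T' (shift_tile ((lam ^+ n)^-1 *: x) t) by rewrite -e; exact: shift_in.
move=> /(Pstar_near (Omega_Pstar oT') T't).
rewrite puncture_shift // opprD addrCA addrN addr0 normrN normrZ.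
rewrite gtr0_norm ?invr_gt0 ?lamX_gt0 // ltr_pdivrMl ?lamX_gt0 // -ltr_pdivrMr ?(std_r0 std) //.
move=> /(_ Hn) /(congr1 puncture); rewrite puncture_shift // => /eqP.
rewrite -subr_eq subrr eq_sym scaler_eq0 invr_eq0 (negbTE (lamX_neq0 n)) /=.
by move=> /eqP x00; move: x0; rewrite x00 normr0 ltxx.
Qed.

Lemma Omega_supertile T n q : Omega T -> P q ->
  exists x, shift x (supertile n q) `<=` T.
Proof.
move=> oT Pq; have [N HN] := prim_ptile.
have [T' oT' <-] := iter_omega_surj (n + N) oT.
have [t T't _] := Omega_near 0 oT'.
have [x Hx] := HN N t q (leqnn _) (Omega_ptile oT' T't) Pq.
exists (lam ^+ n *: x); rewrite -supertile_shift => u xu.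
apply/iter_omegaP; exists t => //; apply/supertileDP.
by exists (shift_tile x q).
Qed.

(** Minimality: all tilings contain the same finite patches up to translation. *)
Lemma Omega_legal_shift T Q : Omega T -> legal Q -> exists x, shift x Q `<=` T.
Proof.
move=> oT [n [p [x [Pp Qx]]]]; have [y Hy] := Omega_supertile n oT Pp.
exists (y - x); apply: subset_trans Hy; rewrite shift_subE shiftD.
by rewrite addrA addNr add0r -shift_subE.
Qed.

(** * Addresses in supertiles *)

Local Notation Omega_punc := (Omega_punc S).
Local Notation Rpunc := (Rpunc S).
Local Notation RAF_level := (RAF_level S).

Lemma Omega_puncP T : Omega_punc T <-> Omega T /\ exists2 p, P p & T p.
Proof.
split=> [[oT [t Tt t0]]|[oT [p Pp Tp]]]; split=> //.
  by exists t => //; apply: ptile_proto_puncture => //; exact: Omega_ptile oT Tt.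
by exists p => //; exact: puncture_proto0.
Qed.

Lemma Omega_punc_shift T t : Omega T -> T t -> Omega_punc (shift (- puncture t) T).
Proof.
move=> oT Tt; split; first exact: Omega_shift.
exists (shift_tile (- puncture t) t); first exact: shift_in.
by rewrite puncture_shift ?addNr //; exact: Omega_ptile oT Tt.
Qed.

Lemma Omega_punc_shiftP T x : Omega T ->
  Omega_punc (shift (- x) T) <-> exists2 t, T t & puncture t = x.
Proof.
move=> oT; split=> [[_ [u /shiftP Tu u0]]|[t Tt <-]]; last exact: Omega_punc_shift.
eexists; first exact: Tu.
rewrite opprK puncture_shift ?u0 ?addr0 //.
have := Omega_ptile oT Tu; rewrite opprK => /(ptile_shift (- x)).
by rewrite shift_tileK.
Qed.

Lemma Rpunc_shift a : Rpunc a -> exists x, a.2 = shift (- x) a.1.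
Proof. by move=> [_ _ [x ->]]; exists (- x); rewrite opprK. Qed.

Lemma shift_eq_inj T x y : Omega T -> shift x T = shift y T -> x = y.
Proof.
move=> oT e; apply/eqP; rewrite -subr_eq0; apply/eqP.
apply: (aperiodic oT); rewrite addrC -shiftD e shiftD addNr.
by rewrite shift0.
Qed.

(* The position of the origin in the [n]th order supertile of [T] containing
   it: that supertile is a translate of [supertile n p], with the tile at the
   origin corresponding to [t]; [T0] is the desubstituted tiling. *)
Definition address n T p T0 t :=
  [/\ P p, Omega T0, T0 p, supertile n p t &
      T = shift (- puncture t) (iter n omega T0)].

Lemma address_ptile n T p T0 t : address n T p T0 t -> ptile t.
Proof. by move=> [Pp _ _ pt _]; apply: supertile_ptile pt; exact: ptile_proto. Qed.

Lemma address_in n p T0 t : P p -> T0 p -> supertile n p t -> iter n omega T0 t.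
Proof. by move=> Pp Tp pt; apply/iter_omegaP; exists p. Qed.

Lemma address_origin n T p T0 t : address n T p T0 t -> T (ptype t).
Proof. by move=> [Pp oT Tp pt ->]; apply: shift_in; exact: address_in pt. Qed.

Lemma address_punc n T p T0 t : address n T p T0 t -> Omega_punc T.
Proof.
move=> H; have [Pp oT Tp pt ->] := H.
apply: Omega_punc_shift; first exact: iter_Omega.
exact: address_in pt.
Qed.

Lemma address_ex n T : Omega_punc T -> exists p T0 t, address n T p T0 t.
Proof.
move=> /Omega_puncP [oT [q Pq Tq]]; have [T1 oT1 T1E] := iter_omega_surj n oT.
have /iter_omegaP [s T1s sq] : iter n omega T1 q by rewrite T1E.
have ps := Omega_ptile oT1 T1s.
exists (ptype s), (shift (- puncture s) T1), (shift_tile (- (lam ^+ n *: puncture s)) q).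
split.
- exact: ptypeP.
- exact: Omega_shift.
- exact: shift_in.
- by rewrite /ptype supertile_shift scalerN; apply: shift_in.
- rewrite puncture_shift; last exact: ptile_proto.
  rewrite (puncture_proto0 Pq) addr0 opprK iter_omega_shift shiftD T1E scalerN.
  by rewrite addrN shift0.
Qed.

(** Translates of [T0] and [T0'] have the same [n]th substitution [T], so injectivity identifies
    them; the tile at the origin then lies in only one supertile. *)
Lemma address_uniq n T p T0 t p' T0' t' : address n T p T0 t ->
  address n T p' T0' t' -> [/\ p = p', T0 = T0' & t = t'].
Proof.
move=> H H'; have := address_origin H'; have := address_origin H.
have pt := address_ptile H; have pt' := address_ptile H'.
have [sT _ _] := (OmegaP T).1 (address_punc H).1.
case: H H' => Pp oT Tp pn TE [Pp' oT' Tp' pn' TE'] Tt Tt'.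
have tt' : ptype t = ptype t'.
  by apply: (Pstar_puncture_inj sT) => //; rewrite !puncture_proto0 //; exact: ptypeP.
(* Translating [T0] by [x] corresponds, after [n] substitutions, to translating by minus the
   puncture of [t]. *)
pose x := - ((lam ^+ n)^-1 *: puncture t); pose x' := - ((lam ^+ n)^-1 *: puncture t').
have lx : lam ^+ n *: x = - puncture t.
  by rewrite /x scalerN scalerA mulfV ?lamX_neq0 // scale1r.
have lx' : lam ^+ n *: x' = - puncture t'.
  by rewrite /x' scalerN scalerA mulfV ?lamX_neq0 // scale1r.
have e : shift x T0 = shift x' T0'.
  apply: (@iter_omega_inj n); [exact: Omega_shift|exact: Omega_shift|].
  by rewrite !iter_omega_shift lx lx' -TE -TE'.
have /(prototile_uniq Pp Pp') [pp' xx'] : shift_tile x p = shift_tile x' p'.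
  apply: (supertile_inj (Omega_Pstar (Omega_shift x oT)) _ _ (n := n) (u := ptype t)).
  - exact: shift_in.
  - by rewrite e; exact: shift_in.
  - by rewrite supertile_shift lx; exact: shift_in.
  - by rewrite tt' supertile_shift lx'; exact: shift_in.
split=> //; first by move: e; rewrite xx' => /shift_inj.
by rewrite -(ptypeE t) -(ptypeE t') tt'; congr shift_tile; rewrite -[LHS]opprK -lx xx' lx' opprK.
Qed.

Lemma address_shift n T p T0 t t' : address n T p T0 t -> supertile n p t' ->
  address n (shift (- (puncture t' - puncture t)) T) p T0 t'.
Proof.
move=> [Pp oT Tp pt TE] pt'; split=> //.
by rewrite TE shiftD opprB addrAC subrr add0r.
Qed.

Lemma address_diff n T T' p T0 t t' : address n T p T0 t -> address n T' p T0 t' ->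
  T' = shift (- (puncture t' - puncture t)) T.
Proof.
by move=> [_ _ _ _ ->] [_ _ _ _ ->]; rewrite shiftD opprB addrAC subrr add0r.
Qed.

(** A symmetric form of the definition: both tilings are the same substituted tiling, centred at two
    tiles of one supertile. With uniqueness of addresses the equivalence relation axioms are
    immediate. *)
Lemma RAF_levelP n a : RAF_level n a <-> exists p T0 t1 t2,
  address n a.1 p T0 t1 /\ address n a.2 p T0 t2.
Proof.
case: a => T T' /=; split.
  move=> [_ [T0 [t [t1 [t2 [x /= [[oT0 T0E] T0t [tt1 t10] [tt2 t2x] T'E]]]]]]].
  have pt := Omega_ptile oT0 T0t; pose y := - (lam ^+ n *: puncture t).
  have py (u : tile) : supertile n t u -> supertile n (ptype t) (shift_tile y u).
    by rewrite /ptype supertile_shift scalerN => tu; apply: shift_in.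
  have pu (u : tile) : supertile n t u -> ptile u by exact: supertile_ptile.
  have yE : iter n omega (shift (- puncture t) T0) = shift y T.
    by rewrite iter_omega_shift T0E scalerN.
  exists (ptype t), (shift (- puncture t) T0), (shift_tile y t1), (shift_tile y t2).
  split; split; rewrite ?puncture_shift; try exact: ptypeP; try exact: Omega_shift;
    try exact: shift_in; try exact: py; try exact: pu.
    by rewrite yE shiftD t10 addr0 addNr shift0.
  by rewrite yE shiftD t2x opprD addrAC addNr add0r.
move=> [p [T0 [t1 [t2 [H1 H2]]]]].
have pt1 := address_ptile H1; have pt2 := address_ptile H2.
split; first split=> /=; [exact: address_punc H1|exact: address_punc H2| |].
  by rewrite (address_diff H1 H2); eexists.
case: (H1) => Pp oT0 T0p pt TE; case: (H2) => _ _ _ pt' T'E.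
pose z := - ((lam ^+ n)^-1 *: puncture t1).
have lz : lam ^+ n *: z = - puncture t1.
  by rewrite /z scalerN scalerA mulfV ?lamX_neq0 // scale1r.
exists (shift z T0), (shift_tile z p), (ptype t1), (shift_tile (- puncture t1) t2).
exists (puncture t2 - puncture t1); split.
- by split; [exact: Omega_shift|rewrite iter_omega_shift lz].
- exact: shift_in.
- split; last by rewrite puncture_proto0 //; exact: ptypeP.
  by rewrite supertile_shift lz; exact: shift_in.
- split; last by rewrite puncture_shift // addrC.
  by rewrite supertile_shift lz; exact: shift_in.
- exact: address_diff H1 H2.
Qed.

Lemma RAF_level_Rpunc n a : RAF_level n a -> Rpunc a.
Proof. by case. Qed.

Lemma RAF_level_refl n T : Omega_punc T -> RAF_level n (T, T).
Proof.
move=> /(address_ex n) [p [T0 [t H]]]; apply/RAF_levelP.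
by exists p, T0, t, t.
Qed.

Lemma RAF_level_sym n T T' : RAF_level n (T, T') -> RAF_level n (T', T).
Proof.
move=> /RAF_levelP [p [T0 [t [t' [H H']]]]]; apply/RAF_levelP.
by exists p, T0, t', t.
Qed.

Lemma RAF_level_trans n T T' T'' :
  RAF_level n (T, T') -> RAF_level n (T', T'') -> RAF_level n (T, T'').
Proof.
move=> /RAF_levelP [p [T0 [t [t' [/= H H']]]]] /RAF_levelP [q [U [u [u' [/= K K']]]]].
apply/RAF_levelP; have [pq T0U _] := address_uniq H' K.
by exists p, T0, t, u'; split=> //=; rewrite pq T0U.
Qed.

Lemma RAF_levelS n : RAF_level n `<=` RAF_level n.+1.
Proof.
move=> [T T'] [Ra [T0 [t [t1 [t2 [x [[oT0 T0E] T0t [tt1 t10] [tt2 t2x] T'E]]]]]]].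
split=> //; have [T1 oT1 T1E] := omega_surj oT0.
have /(iter_omegaP 1) [s T1s st] : omega T1 t by rewrite T1E.
exists T1, s, t1, t2, x; split=> //.
- by rewrite iterSr T1E.
- by split=> //; rewrite -addn1; apply/supertileDP; exists t.
- by split=> //; rewrite -addn1; apply/supertileDP; exists t.
Qed.

Lemma RAF_level_le m n : (m <= n)%N -> RAF_level m `<=` RAF_level n.
Proof.
move=> /subnKC <-; elim: (n - m)%N => [|k IH]; first by rewrite addn0.
by rewrite addnS; apply: subset_trans IH _; exact: RAF_levelS.
Qed.

(** The extra [r0] leaves room for the inner ball of any tile with puncture within [r]. That ball
    lies in the supertile, which forces the whole tile to belong to it. *)
Definition deep r n p t :=
  forall z, `|z - puncture t| < r + r0 -> p.1 ((lam ^+ n)^-1 *: z).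

Lemma address_deep r n T p T0 t u : address n T p T0 t -> deep r n p t ->
  T u -> `|puncture u| <= r ->
  exists2 t', address n (shift (- puncture u) T) p T0 t' &
    puncture u = puncture t' - puncture t.
Proof.
move=> H dp Tu ur; have [Pp oT0 T0p pt TE] := H.
have pp := ptile_proto Pp.
move: (Tu); rewrite TE => -[t' Tt' t'u].
have ptt' : ptile t' by exact: Omega_ptile (iter_Omega n oT0) Tt'.
have uE : puncture u = puncture t' - puncture t by rewrite -t'u puncture_shift // addrC.
exists t' => //; rewrite uE; apply: address_shift => //.
have /iter_omegaP [s T0s st'] := Tt'.
suff -> : p = s by [].
apply/esym; apply: (supertile_overlap (Omega_Pstar oT0) T0s T0p st' (ptile_nbhs_puncture ptt')).
apply/nbhs_norm; exists r0; first exact: std_r0 std.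
move=> y yt' /=; apply: dp.
have -> : y - puncture t = puncture u + (y - puncture t') by rewrite uE [RHS]addrC addrA subrK.
by apply: le_lt_trans (ler_normD _ _) _; exact: ler_ltD.
Qed.

(** * The action of the symmetry group *)

Variables (G : set 'M[R]_d) (la : 'M[R]_d -> L -> L).
Hypotheses (sym : symmetry_group S G la) (fG : finite_set G)
  (freeG : free_on_prototiles S G la).
Implicit Types g h : 'M[R]_d.
Local Notation rot_tile := (rot_tile la).
Local Notation rot := (rot la).

Lemma G_unit g : G g -> g \in unitmx.
Proof. by move=> /(symmetry_orthogonal sym) /mulmx1_unit []. Qed.

Lemma G_mulVmx g : G g -> invmx g *m g = 1%:M.
Proof. by move=> /G_unit /mulVmx. Qed.

Lemma G_mulmxV g : G g -> g *m invmx g = 1%:M.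
Proof. by move=> /G_unit /mulmxV. Qed.

Lemma G1 : G 1%:M. Proof. exact: symmetry_1 sym. Qed.
Lemma GM g h : G g -> G h -> G (g *m h). Proof. exact: symmetry_M sym _ _. Qed.
Lemma GV g : G g -> G (invmx g). Proof. exact: symmetry_V sym _. Qed.

Lemma rot_tileD g x t : rot_tile g (shift_tile x t) = shift_tile (g *m x) (rot_tile g t).
Proof.
congr pair; apply/seteqP; split=> z.
  by move=> [_ [y ty <-] <-]; exists (g *m y); [exists y|rewrite mulmxDr].
by move=> [_ [y ty <-] <-]; exists (y + x); [exists y|rewrite mulmxDr].
Qed.

Lemma rot_tile1 t : rot_tile 1%:M t = t.
Proof.
case: t => A l; congr pair; last exact: symmetry_label1 sym _.
apply/seteqP; split=> z; first by move=> [y Ay <-]; rewrite mul1mx.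
by move=> Az; exists z => //; rewrite mul1mx.
Qed.

Lemma rot_tileM g h t : G g -> G h -> rot_tile (g *m h) t = rot_tile g (rot_tile h t).
Proof.
move=> Gg Gh; case: t => A l; congr pair; last exact: symmetry_labelM sym _ _ _ _ _.
apply/seteqP; split=> z.
  by move=> [y Ay <-]; exists (h *m y); [exists y|rewrite mulmxA].
by move=> [_ [y Ay <-] <-]; exists y => //; rewrite mulmxA.
Qed.

Lemma rot_tileK g : G g -> cancel (rot_tile g) (rot_tile (invmx g)).
Proof. by move=> Gg t; rewrite -rot_tileM ?G_mulVmx ?rot_tile1 //; exact: GV. Qed.

Lemma rot_tileVK g : G g -> cancel (rot_tile (invmx g)) (rot_tile g).
Proof. by move=> Gg t; rewrite -rot_tileM ?G_mulmxV ?rot_tile1 //; exact: GV. Qed.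

Lemma rotP g T t : G g -> rot g T t <-> T (rot_tile (invmx g) t).
Proof.
move=> Gg; split=> [[u Tu <-]|Tt]; first by rewrite rot_tileK.
by exists (rot_tile (invmx g) t) => //; rewrite rot_tileVK.
Qed.

Lemma rot_in g T t : T t -> rot g T (rot_tile g t).
Proof. by move=> Tt; exists t. Qed.

Lemma rot1 T : rot 1%:M T = T.
Proof.
apply/seteqP; split=> [_ [t Tt <-]|t Tt]; first by rewrite rot_tile1.
by exists t => //; rewrite rot_tile1.
Qed.

Lemma rotM g h T : G g -> G h -> rot (g *m h) T = rot g (rot h T).
Proof.
move=> Gg Gh; apply/seteqP; split=> [_ [t Tt <-]|_ [_ [t Tt <-] <-]].
  by rewrite rot_tileM //; exists (rot_tile h t) => //; exists t.
by exists t => //; rewrite rot_tileM.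
Qed.

Lemma rotK g : G g -> cancel (rot g) (rot (invmx g)).
Proof. by move=> Gg T; rewrite -rotM ?G_mulVmx ?rot1 //; exact: GV. Qed.

Lemma rotVK g : G g -> cancel (rot (invmx g)) (rot g).
Proof. by move=> Gg T; rewrite -rotM ?G_mulmxV ?rot1 //; exact: GV. Qed.

Lemma rot_shift g x T : rot g (shift x T) = shift (g *m x) (rot g T).
Proof.
apply/seteqP; split=> [_ [_ [t Tt <-] <-]|_ [_ [t Tt <-] <-]].
  by rewrite rot_tileD; exact/shift_in/rot_in.
by rewrite -rot_tileD; exact/rot_in/shift_in.
Qed.

Lemma rot_sub g T Q : T `<=` Q -> rot g T `<=` rot g Q.
Proof. by move=> TQ _ [t Tt <-]; exact/rot_in/TQ. Qed.

Lemma ptile_rot g t : G g -> ptile t -> ptile (rot_tile g t).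
Proof.
move=> Gg [p [x [Pp ->]]]; exists (rot_tile g p), (g *m x).
by rewrite rot_tileD; split=> //; exact: symmetry_prototiles sym _ _ _ _.
Qed.

Lemma puncture_rot g t : G g -> ptile t -> puncture (rot_tile g t) = g *m puncture t.
Proof.
move=> Gg [p [x [Pp ->]]]; rewrite rot_tileD !puncture_proto //.
exact: symmetry_prototiles sym _ _ _ _.
Qed.

Lemma ptype_rot g t : G g -> ptile t -> ptype (rot_tile g t) = rot_tile g (ptype t).
Proof. by move=> Gg pt; rewrite /ptype puncture_rot // rot_tileD mulmxN. Qed.

Lemma subst_tile_rot g t : G g -> ptile t ->
  subst_tile (rot_tile g t) = rot g (subst_tile t).
Proof.
move=> Gg pt; rewrite /subst_tile puncture_rot // ptype_rot // rot_shift scalemxAr.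
by rewrite (symmetry_subst sym) //; exact: ptypeP.
Qed.

Lemma omega_rot g T : G g -> omega (rot g T) = rot g (omega T).
Proof.
move=> Gg; apply/seteqP; split=> u.
  move=> /omegaP [_ [[t Tt <-] pt]].
  have {}pt : ptile t by rewrite -(rot_tileK Gg t); apply: ptile_rot => //; exact: GV.
  rewrite subst_tile_rot // => -[v tv <-]; apply: rot_in.
  by apply/omegaP; exists t.
move=> [v /omegaP [t [Tt pt tv]] <-]; apply/omegaP; exists (rot_tile g t).
split; [exact: rot_in|exact: ptile_rot|rewrite subst_tile_rot //].
exact: rot_in.
Qed.

Lemma iter_omega_rot n g T : G g -> iter n omega (rot g T) = rot g (iter n omega T).
Proof. by move=> Gg; elim: n => //= n ->; rewrite omega_rot. Qed.

Lemma supertile_rot n g t : G g ->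
  supertile n (rot_tile g t) = rot g (supertile n t).
Proof.
move=> Gg; rewrite /Defs.supertile -iter_omega_rot //; congr (iter n _ _).
by apply/seteqP; split=> [u ->|_ [_ -> <-] //]; apply: rot_in.
Qed.

Lemma supp_rot g T z : G g -> supp (rot g T) z <-> supp T (invmx g *m z).
Proof.
move=> Gg; split.
  move=> [_ [t Tt <-] [y ty <-]]; exists t => //.
  by rewrite mulmxA G_mulVmx // mul1mx.
move=> [t Tt tz]; exists (rot_tile g t); first exact: rot_in.
by exists (invmx g *m z) => //; rewrite mulmxA G_mulmxV // mul1mx.
Qed.

Lemma legal_rot g Q : G g -> legal Q -> legal (rot g Q).
Proof.
move=> Gg [n [p [x [Pp Qx]]]]; exists n, (rot_tile g p), (g *m x); split.
  exact: symmetry_prototiles sym _ _ _ _.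
by rewrite supertile_rot // -rot_shift; apply: rot_sub.
Qed.

(** Orthogonal matrices need not preserve the sup norm; boundedness is enough to transport interior
    points. *)
Lemma mulmx_norm g : exists2 M : R, 0 < M & forall x : V, `|g *m x| <= M * `|x|.
Proof.
pose M : R := (\sum_i \sum_j `|g i j|) + 1.
have M0 : 0 < M by rewrite ltr_wpDl // !sumr_ge0 // => i _; rewrite sumr_ge0.
exists M => // x; apply: norm_le; first by rewrite mulr_ge0 // ltW.
move=> i; rewrite mxE (le_trans (ler_norm_sum _ _ _)) //.
apply: (@le_trans _ _ ((\sum_j `|g i j|) * `|x|)).
  by rewrite mulr_suml ler_sum // => j _; rewrite normrM ler_wpM2l // coord_norm.
rewrite ler_wpM2r // /M [X in _ <= X + _](bigD1 i) //= -addrA lerDl addr_ge0 //.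
by rewrite sumr_ge0 // => k _; rewrite sumr_ge0.
Qed.

Lemma nbhs_rot g t z : G g -> nbhs z (rot_tile g t).1 -> nbhs (invmx g *m z) t.1.
Proof.
move=> Gg /nbhs_norm [e e0 H]; have [M M0 HM] := mulmx_norm g.
apply/nbhs_norm; exists (M^-1 * e); first by rewrite mulr_gt0 // invr_gt0.
move=> y yz; have [|w tw gw] := H (g *m y).
  have -> : g *m y - z = g *m (y - invmx g *m z).
    by rewrite mulmxBr mulmxA G_mulmxV // mul1mx.
  by apply: le_lt_trans (HM _) _; rewrite -ltr_pdivlMl.
by rewrite -[y]mul1mx -(G_mulVmx Gg) -mulmxA -gw mulmxA G_mulVmx // mul1mx.
Qed.

Lemma Pstar_rot g T : G g -> Pstar T -> Pstar (rot g T).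
Proof.
move=> Gg /PstarP [pT H]; apply/PstarP; split=> [_ [t Tt <-]|].
  exact/ptile_rot/pT.
move=> _ _ z [t Tt <-] [u Tu <-] /(nbhs_rot Gg) tz /(nbhs_rot Gg) uz.
by congr (rot_tile _ _); apply: (H _ _ _ Tt Tu tz uz).
Qed.

Lemma Omega_rot g T : G g -> Omega T -> Omega (rot g T).
Proof.
move=> Gg /OmegaP [sT cT H]; apply/OmegaP; split.
- exact: Pstar_rot.
- by move=> z; apply/supp_rot.
- move=> Q QT fQ; rewrite -(rotVK Gg Q); apply: legal_rot => //.
  apply: H; last exact: finite_image.
  by rewrite -(rotK Gg T); apply: rot_sub.
Qed.

Lemma Omega_punc_rot g T : G g -> Omega_punc T -> Omega_punc (rot g T).
Proof.
move=> Gg /Omega_puncP [oT [p Pp Tp]]; apply/Omega_puncP; split; first exact: Omega_rot.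
by exists (rot_tile g p); [exact: symmetry_prototiles sym _ _ _ _|exact: rot_in].
Qed.

Lemma Rpunc_rot g T T' : G g -> Rpunc (T, T') -> Rpunc (rot g T, rot g T').
Proof.
move=> Gg [oT oT' [x /= T'E]]; split=> /=; [exact: Omega_punc_rot|exact: Omega_punc_rot|].
by exists (g *m x); rewrite T'E rot_shift.
Qed.

Lemma address_rot g n T p T0 t : G g -> address n T p T0 t ->
  address n (rot g T) (rot_tile g p) (rot g T0) (rot_tile g t).
Proof.
move=> Gg H; have pt' := address_ptile H; have [Pp oT0 T0p pt ->] := H; split.
- exact: symmetry_prototiles sym _ _ _ _.
- exact: Omega_rot.
- exact: rot_in.
- by rewrite supertile_rot //; exact: rot_in.
- by rewrite rot_shift iter_omega_rot // puncture_rot // mulmxN.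
Qed.

Lemma RAF_level_rot g n T T' : G g -> RAF_level n (T, T') ->
  RAF_level n (rot g T, rot g T').
Proof.
move=> Gg /RAF_levelP [p [T0 [t [t' [/= H H']]]]]; apply/RAF_levelP.
exists (rot_tile g p), (rot g T0), (rot_tile g t), (rot_tile g t').
by split; exact: address_rot.
Qed.

(* Freeness of the action on prototiles makes the semidirect products with the
   finite levels principal. *)
Lemma RAF_level_free n g T : G g -> Omega_punc T -> RAF_level n (T, rot g T) -> g = 1%:M.
Proof.
move=> Gg oT /RAF_levelP [p [T0 [t [t' [/= H H']]]]].
have [e _ _] := address_uniq H' (address_rot Gg H).
by case: H => Pp _ _ _ _; apply: (freeG Gg Pp).
Qed.

(** * Topology of the groupoid *)

Local Notation X := (cylinder_space S).
Local Notation Y := (semidirect X R d).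

Definition basic (F : set tile) (x : V) : set X :=
  [set a | [/\ Rpunc a, F `<=` a.1 & a.2 = shift (- x) a.1]].

Lemma Rpunc_uniq a x y : Rpunc a -> a.2 = shift (- x) a.1 ->
  a.2 = shift (- y) a.1 -> x = y.
Proof.
move=> [[oT _] _ _] -> /(shift_eq_inj oT) e.
by rewrite -[x]opprK e opprK.
Qed.

Lemma open_cylinders (A : set X) : cylinders S A -> open A.
Proof.
move=> cA; exists [set A] => [_ ->|]; last by rewrite bigcup_set1.
exact: (@finI_from1 _ _ (cylinders S) id).
Qed.

(** Around each of its points, adding to [F] the tiles with punctures 0 and [x] turns the condition
    into a cylinder. *)
Lemma open_basic F x : finite_set F -> open (basic F x).
Proof.
move=> fF; rewrite openE => -[T T'] [Ra Fa /= T'E]; rewrite /interior.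
have [[oT [t1 Tt1 t10]] oT' _] := Ra; rewrite /= in oT oT' Fa Tt1.
have [t2 Tt2 t2x] : exists2 t, T t & puncture t = x.
  by apply/(Omega_punc_shiftP _ oT); rewrite -T'E.
pose Q := F `|` [set t1; t2].
have QT : Q `<=` T by move=> t [/Fa|[->|->]].
have fQ : finite_set Q by rewrite /Q finite_setU.
suff : nbhs ((T, T') : X) (cylinder S Q t1 t2 : set X).
  apply: filterS => -[U U'] [Rb /=]; rewrite t10 oppr0 shift0 t2x sub0r => QU U'E.
  by split=> // t Ft; apply: QU; left.
apply: open_nbhs_nbhs; split; last first.
  by split=> //=; rewrite t10 ?oppr0 ?shift0 // t2x sub0r.
apply: open_cylinders; exists Q, t1, t2; split=> //.
- split; last by exists T.
  by split=> //; case: (Pstar_sub (Omega_Pstar oT) QT).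
- by right; left.
- by right; right.
Qed.

(** All cylinders through [a] prescribe the same translation, by aperiodicity, so a finite
    intersection of them only accumulates finitely many required tiles. *)
Lemma nbhs_basic (a : X) A : Rpunc a ->
  nbhs a A <-> exists F x, [/\ finite_set F, basic F x a & basic F x `<=` A].
Proof.
move=> Ra; split; last first.
  move=> [F [x [fF Fa FA]]]; apply: filterS FA _.
  by apply: open_nbhs_nbhs; split=> //; exact: open_basic.
rewrite nbhsE => -[B [[D' D'E <-] [k D'k ka]] BA].
have [E [fE ED kE]] : exists E : set (set X),
    [/\ finite_set E, E `<=` cylinders S & \bigcap_(i in E) i = k].
  exact: finI_from_finite (D'E _ D'k).
have [x ax] := Rpunc_shift Ra.
have /choice [f Hf] : forall i : set X, exists F, E i ->
    [/\ finite_set F, F `<=` a.1 & basic F x `<=` i].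
  move=> i; have [iE|] := pselect (E i); last by exists set0.
  have := ED _ iE => -[Q [t1 [t2 [[[_ fQ] _] Qt1 Qt2 iE']]]].
  have : i a by move: ka; rewrite /= -kE; apply.
  rewrite iE' => -[_ Qa a2]; exists (shift (- puncture t1) Q) => _; split=> //.
    exact: finite_image.
  move=> b [Rb Fb b2]; split=> //; rewrite b2; congr shift.
  have := Ra; case: a Ra ax {ka} Qa a2 => T T' /= _ -> _ e [[oT _] _ _].
  exact: shift_eq_inj oT e.
exists (\bigcup_(i in E) f i), x; split.
- by apply: bigcup_finite => // i /Hf [].
- by split=> // t [i /Hf [_ H _] /H].
- move=> b [Rb Fb b2]; apply: BA; exists k => //.
  suff : (\bigcap_(i in E) i) b by rewrite kE.
  move=> i iE; have [_ _] := Hf i iE; apply; split=> //.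
  by apply: subset_trans Fb; exact: bigcup_sup.
Qed.

Definition basicY F x (g : 'M[R]_d) : set Y := basic F x `*` [set g].

Lemma nbhsY (y : Y) (A : set Y) : Rpunc y.1 ->
  nbhs y A <-> exists F x, [/\ finite_set F, basic F x y.1 &
    basicY F x y.2 `<=` A].
Proof.
case: y => a g /= Ra; split.
  move=> [[P' Q'] /= [aP gQ] PQ].
  have /(nbhs_basic _ Ra) [F [x [fF Fa FP]]] := aP.
  exists F, x; split=> // -[b h] [/= /FP Pb ->]; apply: PQ; split=> //=.
  exact: nbhs_singleton gQ.
move=> [F [x [fF Fa FA]]]; apply: filterS FA _.
exists (basic F x, [set g]); last by [].
split=> /=; last exact: discrete_set1.
by apply/nbhs_basic => //; exists F, x; split.
Qed.

Lemma open_basicY F x g : finite_set F -> open (basicY F x g).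
Proof.
move=> fF; rewrite openE => -[a h] [/= Fa ->]; apply/nbhsY; first by case: Fa.
by exists F, x; split.
Qed.

Lemma nbhs_basicY F x g (y : Y) : finite_set F -> basicY F x g y -> nbhs y (basicY F x g).
Proof. by move=> fF yB; apply: open_nbhs_nbhs; split=> //; exact: open_basicY. Qed.

Lemma Omega_punc_tight (r : R) : exists A, finite_set A /\
  forall T t, Omega_punc T -> T t -> `|puncture t| <= r -> A t.
Proof.
have [A [fA HA]] := local_finite r; exists A; split=> // T t.
move=> /Omega_puncP [oT [p Pp Tp]] Tt tr.
apply: (HA [set p; t] p) => //; [|by left|by right].
by apply: (Omega_legal oT) => // _ [->|->].
Qed.

(** An ultrafilter of arrows converges to the ultralimit of the first tilings paired with its
    translate by [- x]. Tightness holds because every punctured tiling has a prototile at the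
    origin. *)
Lemma compact_basic F x : compact (basic F x).
Proof.
rewrite compact_ultra => U FU UB.
pose T_ (a : X) := a.1; pose T := ulim U T_.
have tight (r : R) : exists A, finite_set A /\
    U [set i | forall t, T_ i t -> `|puncture t| <= r -> A t].
  have [A [fA HA]] := Omega_punc_tight r; exists A; split=> //.
  by apply: filterS UB => a [[oa _ _] _ _] t; apply: HA.
have near := ulim_near FU tight.
have oT : Omega T.
  apply: ulim_Omega => // r; apply: filterS UB => -[T1 T2] [[[oT _] _ _] _ _].
  by have [? ? ?] := (OmegaP _).1 oT; split.
have pT : Omega_punc T.
  apply/Omega_puncP; split=> //.
  have [a [[[/Omega_puncP [oa [p Pp ap]] _ _] _ _] Ha]] := filter_ex (filterI UB (near 0)).
  by exists p => //; apply: (Ha p _).1; rewrite // puncture_proto0 // normr0.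
have pT' : Omega_punc (shift (- x) T).
  apply/Omega_punc_shiftP => //.
  have [a [[[[oa _] a2 _] _ aE] Ha]] := filter_ex (filterI UB (near `|x|)).
  move: a2; rewrite aE => /(Omega_punc_shiftP _ oa) [t at_ tx].
  by exists t => //; apply: (Ha t _).1; rewrite ?tx.
have RT : Rpunc (T, shift (- x) T) by split=> //=; exists (- x).
have FT : F `<=` T by move=> t Ft; apply: filterS UB => a [_ Fa _]; exact: Fa.
exists (T, shift (- x) T); split; first by split.
move=> A /(nbhs_basic _ RT) [F' [x' [fF' [_ F'T e] FA]]].
have xx' := Rpunc_uniq RT erefl e.
apply: filterS FA _; rewrite -xx'.
have UF' : U [set a : X | forall t, F' t -> T_ a t].
  by apply: filter_finite_forall => // t /F'T.
by apply: filterS (filterI UB UF') => a [[Ra _ a2] F'a]; split.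
Qed.

Lemma compact_basicY F x g : compact (basicY F x g).
Proof. by apply: compact_setX; [exact: compact_basic|exact: compact_set1]. Qed.

Local Notation C := (Rpunc `*` G : set Y).
Local Notation O := (semidirect_ops (pair_ops S) (rot_pair la) : groupoid_ops Y).

Definition diag T : Y := ((T, T), 1%:M).

Lemma C_groupoid : is_groupoid O C.
Proof.
have rK g T : G g -> rot g (rot (invmx g) T) = T by move=> Gg; rewrite rotVK.
have Rdiag T : Omega_punc T -> Rpunc (T, T).
  by move=> oT; split=> //; exists 0; rewrite shift0.
have Rsym T T' : Rpunc (T, T') -> Rpunc (T', T).
  by move=> [oT oT' [x /= e]]; split=> //=; exists (- x); rewrite e shiftK.
have src T T' g : Rpunc (T, T') -> G g -> Omega_punc (rot (invmx g) T').
  by move=> [_ oT' _] Gg; apply: Omega_punc_rot => //; exact: GV.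
split.
- by move=> [[T T'] g] [[oT _ _] Gg]; split; [exact: Rdiag|exact: G1].
- move=> [[T T'] g] [Ra Gg]; split; last exact: G1.
  by apply: Rdiag; exact: src Ra Gg.
- move=> [[T T'] g] [[U U'] h] [[/= Ra Gg] [/= Rb Gh] [e _]].
  split=> /=; last exact: GM.
  have [oT _ [x /= xE]] := Ra; have [_ oU' [y /= yE]] := Rb.
  split=> //=; first exact: Omega_punc_rot.
  by exists (g *m y + x); rewrite yE rot_shift -e rK // xE shiftD.
- move=> [[T T'] g] [Ra Gg]; split=> /=; last exact: GV.
  by apply: Rpunc_rot; [exact: GV|exact: Rsym].
- by move=> [[T T'] g] [Ra Gg]; split=> //=; rewrite /rot_pair /= invmx1 rot1.
- by move=> [[T T'] g] [Ra Gg]; split=> //=; rewrite /rot_pair /= invmx1 rot1.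
- by [].
- move=> [[T T'] g] [[U U'] h] [[/= Ra Gg] [/= Rb Gh] [e _]].
  congr pair; rewrite /rot_pair /=.
  have -> : invmx (g *m h) = invmx h *m invmx g.
    have ug := G_unit Gg; have uh := G_unit Gh.
    have ugh : g *m h \in unitmx by rewrite unitmx_mul ug.
    rewrite -[RHS]mul1mx -(mulVmx ugh) -!mulmxA (mulmxA h) mulmxV //.
    by rewrite mul1mx mulmxV // mulmx1.
  by rewrite rotM ?rotK //; exact: GV.
- move=> [[T T'] g] [[U U'] h] [[V' V''] k] [[/= Ra Gg] [/= Rb Gh] [e _]] [_ [/= Rc Gk] [e' _]].
  by rewrite /rot_pair /= mulmxA rotM.
- move=> [[T T'] g] [Ra Gg]; rewrite /= /rot_pair /= rot1 rK // mul1mx mulmx1.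
  by [].
- by move=> [[T T'] g] [Ra Gg].
- move=> [[T T'] g] [Ra Gg]; rewrite /= /rot_pair /= invmxK rK //.
- move=> [[T T'] g] [Ra Gg]; rewrite /= /rot_pair /= rK // G_mulmxV // G_mulVmx //.
Qed.

(** Made for the Hausdorff property: if two arrows cannot be separated, any tile of one and any tile
    of the other occur together in a third tiling. *)
Lemma Omega_eq T T' : Omega T -> Omega T' ->
  (forall t u, T t -> T' u -> exists2 T'', Pstar T'' & T'' t /\ T'' u) -> T = T'.
Proof.
wlog suff sub : T T' / Omega T -> Omega T' ->
  (forall t u, T t -> T' u -> exists2 T'', Pstar T'' & T'' t /\ T'' u) -> T `<=` T'.
  move=> oT oT' HT; apply/seteqP; split; first exact: sub.
  by apply: sub => // t u Tt Tu; have [U ? []] := HT _ _ Tu Tt; exists U.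
move=> oT oT' HT t Tt.
have [u [z [Tu uz tz]]] := Omega_meets oT' (Omega_ptile oT Tt).
have [U sU [Ut Uu]] := HT _ _ Tt Tu.
by have [_ /(_ _ _ _ Ut Uu tz uz) ->] := (PstarP U).1 sU.
Qed.

Implicit Types (y : Y).

Lemma C_sub_Rpunc (A : set Y) y : A `<=` C -> A y -> Rpunc y.1.
Proof. by move=> AC /AC []. Qed.

(** Continuity in terms of basic sets: near [y] the group component and the translation [w] of the
    image are constant, and finitely many tiles of the argument force any finite set of tiles of the
    image. *)
Lemma within_continuousY (A : set Y) (f : Y -> Y) : A `<=` C ->
  (forall y, A y -> Rpunc (f y).1) ->
  (forall y x, A y -> y.1.2 = shift (- x) y.1.1 -> exists w, forall F,
    finite_set F -> F `<=` (f y).1.1 -> exists F',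
    [/\ finite_set F', F' `<=` y.1.1 & forall z : Y, A z -> basicY F' x y.2 z ->
      [/\ (f z).2 = (f y).2, F `<=` (f z).1.1 & (f z).1.2 = shift (- w) (f z).1.1]]) ->
  {within A, continuous f}.
Proof.
move=> AC Rf H; apply/subspace_continuousP => y Ay B.
have Ry := C_sub_Rpunc AC Ay; have Rfy := Rf _ Ay.
move=> /(nbhsY _ Rfy) [F [w' [fF [_ Ffy fyE] FB]]].
have [x yE] := Rpunc_shift Ry.
have [w Hw] := H y x Ay yE.
have [F' [fF' F'y HF']] := Hw F fF Ffy.
have ww' : w' = w.
  have [|_ _ e] := HF' y Ay; first by split=> //=; split.
  exact: Rpunc_uniq Rfy fyE e.
have yF' : basicY F' x y.2 y by split=> //; split.
apply: filterS (nbhs_basicY fF' yF') => z zF' Az; apply: FB.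
by have [e1 e2 e3] := HF' z Az zF'; split=> //; split=> //; [exact: Rf|rewrite ww'].
Qed.

Lemma C_rng_continuous : {within C, continuous (grng O)}.
Proof.
apply: within_continuousY => // [y|y x Cy yE].
  by case: y => [[T T'] g] [[oT _ _] _]; split=> //; exists 0; rewrite shift0.
exists 0 => F fF Fy; exists F; split=> // z [Rz Gz] [[_ Fz _] _].
by split=> //=; rewrite oppr0 shift0.
Qed.

Lemma C_inv_continuous : {within C, continuous (ginv O)}.
Proof.
apply: within_continuousY => // [y Cy|y x Cy yE].
  by case: (groupoid_inv C_groupoid Cy).
have [_ Gg] := Cy; have Gg' := GV Gg.
exists (- (invmx y.2 *m x)) => F fF Fy; exists (shift x (rot y.2 F)); split.
- by do 2!apply: finite_image.
- have -> : y.1.1 = shift x y.1.2 by rewrite yE shiftNK.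
  apply: shift_sub; rewrite -[y.1.2](rotVK Gg); exact: rot_sub.
- move=> z [Rz Gz] [[_ Fz zE] /= zg]; rewrite /= /rot_pair /= zg; split=> //.
    have -> : z.1.2 = shift (- x) z.1.1 by [].
    rewrite -[F](rotK Gg); apply: rot_sub.
    by rewrite shift_subE opprK.
  by rewrite opprK -rot_shift zE shiftNK.
Qed.

Lemma C_src_continuous : {within C, continuous (gsrc O)}.
Proof.
apply: within_continuousY => // [y Cy|y x Cy yE].
  by case: (groupoid_src C_groupoid Cy).
have [_ Gg] := Cy; have Gg' := GV Gg.
exists 0 => F fF Fy; exists (shift x (rot y.2 F)); split.
- by do 2!apply: finite_image.
- have -> : y.1.1 = shift x y.1.2 by rewrite yE shiftNK.
  apply: shift_sub; rewrite -[y.1.2](rotVK Gg); exact: rot_sub.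
- move=> z [Rz Gz] [[_ Fz zE] /= zg]; rewrite /= /rot_pair /= zg; split=> //.
    have -> : z.1.2 = shift (- x) z.1.1 by [].
    rewrite -[F](rotK Gg); apply: rot_sub.
    by rewrite shift_subE opprK.
  by rewrite oppr0 shift0.
Qed.

Lemma C_mul_continuous :
  {within composable O C, continuous (fun p : Y * Y => gmul O p.1 p.2)}.
Proof.
apply/subspace_continuousP => -[y z] Cyz B.
have [[Ry Gy] [Rz Gz] /= yz] := Cyz.
have [Rf _] := groupoid_mul C_groupoid Cyz.
move=> /(nbhsY _ Rf) [F [w [fF [_ Ff fE] FB]]].
have [x1 yE] := Rpunc_shift Ry; have [x2 zE] := Rpunc_shift Rz.
have mulE (y' z' : Y) : composable O C (y', z') -> basicY F x1 y.2 y' ->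
    basicY set0 x2 z.2 z' ->
    (gmul O y' z').1.2 = shift (- (x1 + y.2 *m x2)) y'.1.1.
  move=> [_ [_ Gz'] /= [e _]] [[_ _ y'E] /= y'g] [[_ _ z'E] _].
  rewrite y'g z'E rot_shift -e y'g rotVK // y'E shiftD mulmxN.
  by rewrite opprD addrC.
have yB : basicY F x1 y.2 y by split=> //; split.
have zB : basicY set0 x2 z.2 z by split=> //; split.
have ww : w = x1 + y.2 *m x2.
  apply: (Rpunc_uniq Rf) => //; exact: mulE yB zB.
(* The product has the range of its first factor, so the second factor need only fix its translation
   and group element. *)
exists (basicY F x1 y.2, basicY set0 x2 z.2).
  by split; apply: nbhs_basicY.
move=> [y' z'] /= [yB' zB'] Cyz'; apply: FB.
have [Rf' _] := groupoid_mul C_groupoid Cyz'.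
split; last by case: yB' => _ /= ->; case: zB' => _ /= ->.
split=> //; first by case: yB' => -[].
by rewrite ww; exact: mulE yB' zB'.
Qed.

Lemma diag_C T : Omega_punc T -> C (diag T).
Proof. by move=> oT; split; [split=> //; exists 0; rewrite shift0|exact: G1]. Qed.

Lemma unitsP (u : Y) : units O C u <-> exists2 T, Omega_punc T & u = diag T.
Proof.
split=> [[[[T T'] g] [[oT _ _] _] <-]|[T oT ->]]; first by exists T.
by exists (diag T) => //; exact: diag_C.
Qed.

Lemma units_basicY : units O C = basicY set0 0 1%:M.
Proof.
apply/seteqP; split=> u.
  move=> /unitsP [T oT ->]; split=> //; split=> //=; last by rewrite oppr0 shift0.
  by case: (diag_C oT).
move: u => [[T T'] g] [[[oT _ _] _ /= T'E] /= gE]; apply/unitsP; exists T => //.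
by rewrite T'E gE oppr0 shift0.
Qed.

Lemma basic0P F T : basic F 0 (T, T) <-> Omega_punc T /\ F `<=` T.
Proof.
split=> [[[oT _ _] FT _]|[oT FT]] //.
split=> //=; last by rewrite oppr0 shift0.
by split=> //; exists 0; rewrite shift0.
Qed.

Lemma basicY0P F T : basicY F 0 1%:M (diag T) <-> Omega_punc T /\ F `<=` T.
Proof. by split=> [[/basic0P]|/basic0P ?]. Qed.

Lemma basicY0_units F : basicY F 0 1%:M = basicY set0 0 1%:M `&` basicY F 0 1%:M.
Proof.
apply/seteqP; split=> [z zF|z []//]; split=> //.
by case: zF => -[? _ ?] ?; split=> //; split.
Qed.

(** * Open subgroupoids are etale *)

Section subgroupoids.
Variable (H : set Y).
Hypotheses (subH : subgroupoid O C H) (openH : rel_open C H).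

Lemma units_sub : units O H = units O C.
Proof.
have [HC uH _ _] := subH; apply/seteqP; split=> [_ [a /HC Ca <-]|u Cu].
  by exists a.
exists u; first exact: uH.
by case: Cu => a Ca <-; case: (groupoid_rng_unit C_groupoid Ca).
Qed.

Lemma sub_groupoid : is_groupoid O H.
Proof.
have [HC uH mH iH] := subH; have gC := C_groupoid.
have cC a b : composable O H (a, b) -> composable O C (a, b).
  by move=> [/HC Ha /HC Hb e].
have Hs a : H a -> H (gsrc O a).
  move=> Ha; apply: uH; exists (ginv O a); first exact/HC/iH.
  exact: groupoid_rng_inv gC _ (HC _ Ha).
split=> //.
- by move=> a Ha; apply: uH; exists a => //; exact: HC.
- by move=> a /HC; exact: groupoid_rng_unit gC a.
- by move=> a /HC; exact: groupoid_src_unit gC a.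
- by move=> a b /cC /(groupoid_src_mul gC).
- by move=> a b c /cC ab /cC; exact: groupoid_mulA gC a b c ab.
- by move=> a /HC; exact: groupoid_mul1 gC a.
- by move=> a /HC; exact: groupoid_src_inv gC a.
- by move=> a /HC; exact: groupoid_mulV gC a.
Qed.

Lemma basicY_C F x g : G g -> basicY F x g `<=` C.
Proof. by move=> Gg y [[Ry _ _] /= ->]. Qed.

Lemma H_basicY y x : H y -> y.1.2 = shift (- x) y.1.1 ->
  exists F, [/\ finite_set F, F `<=` y.1.1 & basicY F x y.2 `<=` H].
Proof.
have [HC _ _ _] := subH; have [W oW HE] := openH.
move=> Hy yE; have Ry : Rpunc y.1 by case: (HC _ Hy).
have Gy : G y.2 by case: (HC _ Hy).
have : nbhs y W by apply: open_nbhs_nbhs; split=> //; move: Hy; rewrite HE => -[].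
move=> /(nbhsY _ Ry) [F [x' [fF [_ Fy yE'] FW]]].
exists F; split=> //; rewrite (Rpunc_uniq Ry yE yE') HE => z zF.
by split; [exact: basicY_C zF|exact: FW].
Qed.

Lemma nbhs_H (z : set_type H) (A : set (set_type H)) : nbhs z A <->
  exists F x, [/\ finite_set F, basicY F x (\val z).2 (\val z),
   basicY F x (\val z).2 `<=` H &
   forall z' : set_type H, basicY F x (\val z).2 (\val z') -> A z'].
Proof.
have [HC _ _ _] := subH; have Hz := set_valP z; have [Rz Gz] := HC _ Hz.
split; last first.
  move=> [F [x [fF zF _ FA]]]; apply/nbhs_set_type; exists (basicY F x (\val z).2) => //.
  exact: nbhs_basicY zF.
move=> /nbhs_set_type [W /(nbhsY _ Rz) [F [x [fF [Rz' Fz zE] FW]]] WA].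
have [F' [fF' F'z F'H]] := H_basicY Hz zE.
exists (F `|` F'), x; split.
- by rewrite finite_setU.
- by split=> //; split=> // t [/Fz|/F'z].
- by move=> y [[Ry Fy yE] yg]; apply: F'H; split=> //; split=> // t Ft; apply: Fy; right.
- move=> z' [[Ry Fy yE] yg]; apply: WA; apply: FW.
  by split=> //; split=> // t Ft; apply: Fy; left.
Qed.

Lemma compact_val_basicY F x g : basicY F x g `<=` H ->
  compact (set_val @^-1` basicY F x g : set (set_type H)).
Proof.
move=> FH; apply: compact_set_type.
have -> : set_val @` (set_val @^-1` basicY F x g : set (set_type H)) = basicY F x g.
  apply/seteqP; split=> [_ [y yF <-] //|y yF].
  by exists (exist _ y (mem_set (FH _ yF))).
exact: compact_basicY.
Qed.

Lemma H_hausdorff : hausdorff_space (set_type H).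
Proof.
have [HC _ _ _] := subH.
move=> z1 z2 z12; apply: val_inj.
have [R1 _] := HC _ (set_valP z1); have [R2 _] := HC _ (set_valP z2).
have [x1 E1] := Rpunc_shift R1; have [x2 E2] := Rpunc_shift R2.
have nz (z : set_type H) x F : (\val z).1.2 = shift (- x) (\val z).1.1 ->
  finite_set F -> F `<=` (\val z).1.1 -> nbhs z (set_val @^-1` basicY F x (\val z).2).
  move=> zE fF Fz; have [Rz _] := HC _ (set_valP z).
  by apply/nbhs_set_type; exists (basicY F x (\val z).2) => //; apply: nbhs_basicY => //; split.
(* If the two points were not separated, basic neighbourhoods of both would share an arrow. It
   carries both translations and both group elements, which must then agree. *)
have meet F1 F2 : finite_set F1 -> finite_set F2 -> F1 `<=` (\val z1).1.1 ->
  F2 `<=` (\val z2).1.1 -> exists y : Y, [/\ Rpunc y.1, F1 `<=` y.1.1, F2 `<=` y.1.1,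
   y.1.2 = shift (- x1) y.1.1 /\ y.1.2 = shift (- x2) y.1.1 & (\val z1).2 = (\val z2).2].
  move=> f1 f2 s1 s2.
  have [y [[[Ry ? ?] /= yg1] [[_ ? ?] /= yg2]]] := z12 _ _ (nz _ _ _ E1 f1 s1) (nz _ _ _ E2 f2 s2).
  by exists (\val y); split=> //; rewrite -yg1 -yg2.
have [y [Ry _ _ [yE1 yE2] g12]] := meet set0 set0 (finite_set0 _) (finite_set0 _) (@sub0set _ _) (@sub0set _ _).
have x12 := Rpunc_uniq Ry yE1 yE2.
have [[oT1 _] _ _] := R1; have [[oT2 _] _ _] := R2.
have T12 : (\val z1).1.1 = (\val z2).1.1.
  apply: Omega_eq => // t u Tt Tu.
  have [||w [[[ow _] _ _] wt wu _ _]] := meet [set t] [set u] (finite_set1 _) (finite_set1 _).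
  - by move=> _ ->.
  - by move=> _ ->.
  - by exists w.1.1; [exact: Omega_Pstar|split; [exact: wt|exact: wu]].
move: E1 E2 T12 g12; rewrite x12.
by case: (\val z1) => -[? ?] ?; case: (\val z2) => -[? ?] ? /= -> -> -> ->.
Qed.

Lemma H_locally_compact : locally_compact [set: set_type H].
Proof.
move=> z _; have /nbhs_H [F [x [fF zF FH _]]] : nbhs z [set: set_type H] by exact: filterT.
exists (set_val @^-1` basicY F x (\val z).2).
  suff : nbhs z (set_val @^-1` basicY F x (\val z).2) by apply: filterS.
  by apply/nbhs_H; exists F, x.
split; first exact: compact_val_basicY.
by apply: compact_closed; [exact: H_hausdorff|exact: compact_val_basicY].
Qed.

(* For a point [y] of [H], both the range and the source map are
   homeomorphisms from a basic neighbourhood to an open set of units. *)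
Lemma H_nbhd y : H y -> exists F x, [/\ finite_set F, basicY F x y.2 y,
  basicY F x y.2 `<=` H, exists2 t, F t & puncture t = 0 &
  exists2 t, F t & puncture t = x].
Proof.
have [HC _ _ _] := subH; move=> Hy; have [Ry Gy] := HC _ Hy.
have [x yE] := Rpunc_shift Ry; have [F [fF Fy FH]] := H_basicY Hy yE.
have [[oT [t1 Tt1 t10]] oT' _] := Ry.
move: oT'; rewrite yE => /(Omega_punc_shiftP _ oT) [t2 Tt2 t2x].
(* The tile at 0 guarantees a puncture at the origin of the range, the tile at [x] one at the origin
   of its translate, so range and source alone decide membership. *)
exists (F `|` [set t1; t2]), x; split.
- by rewrite finite_setU.
- by split=> //; split=> // t [/Fy|[->|->]].
- by move=> z [[Rz Fz zE] zg]; apply: FH; split=> //; split=> // t Ft; apply: Fz; left.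
- by exists t1 => //; right; left.
- by exists t2 => //; right; right.
Qed.

Lemma H_rng_local_homeomorphism : local_homeomorphism H (units O H) (grng O).
Proof.
have [HC _ _ _] := subH; split=> [_ [y Hy <-]|y Hy]; first by exists y.
have [F [x [fF yF FH _ [t2 Ft2 t2x]]]] := H_nbhd Hy.
have [_ Gy] := HC _ Hy.
pose U := basicY F x y.2.
have rU : grng O @` U = basicY F 0 1%:M.
  apply/seteqP; split=> [_ [[[T T'] g] [[[oT _ _] FT _] _] <-]|].
    by apply/basicY0P.
  move=> [[T T'] g] [[[oT _ _] FT /= T'E] /= ->].
  exists ((T, shift (- x) T), y.2).
    split=> //; split=> //; split=> //=; last by exists (- x).
    by apply/Omega_punc_shiftP; [case: oT|exists t2 => //; exact: FT].
  by rewrite T'E oppr0 shift0.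
exists U; split=> //.
- exists U; first exact: open_basicY.
  by apply/seteqP; split=> [z Uz|z []] //; split=> //; exact: FH.
- rewrite rU units_sub units_basicY; exists (basicY F 0 1%:M); first exact: open_basicY.
  exact: basicY0_units.
- pose k (u : Y) : Y := ((u.1.1, shift (- x) u.1.1), y.2).
  exists k; split.
  + move=> [[T T'] g]; rewrite inE => -[[_ _ /= ->] /= ->]; by [].
  + apply: continuous_subspaceW C_rng_continuous; exact: basicY_C.
  + rewrite rU; apply: within_continuousY => [|u [[Ru Fu uE] _]|u w [[Ru Fu uE] ug] _].
    * exact: basicY_C G1.
    * have [oT _ _] := Ru; split=> //=; last by exists (- x).
      by apply/Omega_punc_shiftP; [case: oT|exists t2 => //; exact: Fu].
    * by exists x => F1 fF1 F1u; exists F1; split=> // z _ [[Rz F1z zE] zg]; split.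
Qed.

Lemma H_src_local_homeomorphism : local_homeomorphism H (units O H) (gsrc O).
Proof.
have [HC _ _ iH] := subH; split=> [_ [y Hy <-]|y Hy].
  exists (ginv O y); first exact: iH.
  exact: groupoid_rng_inv C_groupoid _ (HC _ Hy).
have [F [x [fF yF FH [t1 Ft1 t10] _]]] := H_nbhd Hy.
have [_ Gy] := HC _ Hy; have Gy' := GV Gy.
(* [F'] is the condition [F] seen from the source: it is rotated and translated together with the
   tiling. *)
pose U := basicY F x y.2; pose F' := rot (invmx y.2) (shift (- x) F).
have fF' : finite_set F' by do 2!apply: finite_image.
have F'P T : F' `<=` T <-> F `<=` shift x (rot y.2 T).
  rewrite shift_subE; split=> FT.
    by rewrite -(rotVK Gy (shift _ F)); apply: rot_sub.
  by rewrite -(rotK Gy T); apply: rot_sub.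
have punc T : Omega_punc T -> F' `<=` T -> Rpunc (shift x (rot y.2 T), rot y.2 T).
  move=> oT /F'P FT; have oT' := Omega_punc_rot Gy oT; split=> //=.
    split; first by apply: Omega_shift; case: oT'.
    by exists t1 => //; exact: FT.
  by exists (- x); rewrite shiftK.
have sU : gsrc O @` U = basicY F' 0 1%:M.
  apply/seteqP; split=> [_ [[[T T'] g] [[[_ oT' _] /= FT T'E] /= ->] <-]|].
    apply/basicY0P; split; first exact: Omega_punc_rot.
    apply/F'P; rewrite (rotVK Gy).
    by rewrite T'E shiftNK.
  move=> [[T T'] g] [[[oT _ _] FT /= T'E] /= ->].
  exists ((shift x (rot y.2 T), rot y.2 T), y.2).
    split=> //; split=> //=; [exact: punc|exact/F'P|].
    by rewrite shiftK.
  by rewrite /= /rot_pair /= (rotK Gy) T'E oppr0 shift0.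
exists U; split=> //.
- exists U; first exact: open_basicY.
  by apply/seteqP; split=> [z Uz|z []] //; split=> //; exact: FH.
- rewrite sU units_sub units_basicY; exists (basicY F' 0 1%:M); first exact: open_basicY.
  exact: basicY0_units.
- pose k (u : Y) : Y := ((shift x (rot y.2 u.1.1), rot y.2 u.1.1), y.2).
  exists k; split.
  + move=> [[T T'] g]; rewrite inE => -[[_ _ /= T'E] /= ->].
    by rewrite /k /= (rotVK Gy) T'E shiftNK.
  + apply: continuous_subspaceW C_src_continuous; exact: basicY_C.
  + rewrite sU; apply: within_continuousY => [|u [[[oT _ _] Fu uE] _]|u w _ _].
    * exact: basicY_C G1.
    * exact: punc.
    * exists x => F1 fF1 F1u; exists (rot (invmx y.2) (shift (- x) F1)); split.
      - by do 2!apply: finite_image.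
      - by rewrite -(rotK Gy u.1.1); apply: rot_sub; rewrite -shift_subE.
      - move=> z _ [[Rz F1z zE] zg]; split=> //=; last by rewrite shiftK.
        by rewrite shift_subE -(rotVK Gy (shift _ F1)); apply: rot_sub.
Qed.

End subgroupoids.

(** * Countability, recurrence and the Cantor unit space *)

Lemma tile_enum : exists e : nat -> tile,
  forall T t, Omega_punc T -> T t -> exists n, e n = t.
Proof.
have [p _] := prototiles_neq0 pset.
have /choice [A HA] := fun n : nat => Omega_punc_tight n%:R.
have cA : countable (\bigcup_n A n).
  by apply: bigcup_countable => // n _; apply: finite_set_countable; case: (HA n).
have [e He] := countable_enum p cA; exists e => T t oT Tt; apply: He.
exists (Num.bound `|puncture t|) => //; have [_] := HA (Num.bound `|puncture t|).
by apply; [exact: oT|exact: Tt|rewrite ltW // archi_boundP].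
Qed.

Lemma Omega_two (d_gt0 : (0 < d)%N) T : Omega T -> exists t t', [/\ T t, T t' & t <> t'].
Proof.
move=> oT; have [t Tt _] := Omega_near 0 oT; have D0 := std_D std.
pose w : V := const_mx (2 * D).
have [t' Tt' tt'] := Omega_near (puncture t + w) oT.
exists t, t'; split=> // e; move: tt'; rewrite -e opprD addNKr normrN leNgt => /negP; apply.
apply: lt_le_trans (coord_norm w (Ordinal d_gt0)).
by rewrite mxE gtr0_norm ?mulr_gt0 // mulr_natl mulr2n ltrDl.
Qed.

(** Two different tiles of a tiling desubstituted [n + N] times have supertiles without common
    tiles, each containing a copy of [Q]; equal positions would give a common tile at level [N]. *)
Lemma Omega_recurrent (d_gt0 : (0 < d)%N) T Q : Omega T -> legal Q ->
  exists x w : V, [/\ x <> w, shift x Q `<=` T & shift w Q `<=` T].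
Proof.
move=> oT [n [p [z [Pp Qz]]]]; have [N HN] := prim_ptile.
have [T3 oT3 T3E] := iter_omega_surj (n + N) oT.
have [s [s' [Ts Ts' ss']]] := Omega_two d_gt0 oT3.
have copy u : T3 u -> exists x, supertile N u (shift_tile x p) /\
    shift (lam ^+ n *: x - z) Q `<=` T.
  move=> Tu; have [x Hx] := HN N u p (leqnn _) (Omega_ptile oT3 Tu) Pp.
  exists x; split=> //; rewrite -shiftD.
  apply: (@subset_trans _ (shift (lam ^+ n *: x) (supertile n p))).
    by apply: shift_sub; rewrite -shift_subE.
  rewrite -supertile_shift -T3E => v xv; apply/iter_omegaP; exists u => //.
  by apply/supertileDP; exists (shift_tile x p).
have [x [sx xT]] := copy _ Ts; have [x' [sx' xT']] := copy _ Ts'.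
exists (lam ^+ n *: x - z), (lam ^+ n *: x' - z); split=> //.
move=> /(congr1 (fun w => w + z)); rewrite !subrK => e; apply: ss'.
apply: (supertile_inj (Omega_Pstar oT3) Ts Ts' sx).
suff -> : x = x' by [].
by rewrite -[x]scale1r -(mulVf (lamX_neq0 n)) -scalerA e scalerA mulVf ?lamX_neq0 // scale1r.
Qed.

Section subgroupoids_etale.
Variable (H : set Y).
Hypotheses (subH : subgroupoid O C H) (openH : rel_open C H).

Lemma H_second_countable : @second_countable (set_type H).
Proof.
have [HC _ _ _] := subH; have [e He] := tile_enum.
have [gam Hgam] := countable_enum 1%:M (finite_set_countable fG).
pose W (k : {fset nat} * nat * nat) : set (set_type H) :=
  set_val @^-1` basicY (e @` [set` k.1.1]) (puncture (e k.1.2)) (gam k.2).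
exists (W @` setT); first exact: card_le_trans (card_image_le _ _) (countableP _).
split=> [_ [k _ <-]|z A].
  apply: open_comp; first by move=> ? _; exact: initial_continuous.
  by apply: open_basicY; exact: finite_image.
move=> /(nbhs_H subH openH) [F [x [fF [[Rz Fz zE] _] _ FA]]].
have [oT oT' _] := Rz; have [_ Gz] := HC _ (set_valP z).
have /choice [c Hc] : forall t, exists n, F t -> e n = t.
  move=> t; have [Ft|Ft] := pselect (F t); last by exists 0.
  by have [n en] := He _ _ oT (Fz _ Ft); exists n.
have [i ix] : exists i, puncture (e i) = x.
  move: oT'; rewrite zE => /(Omega_punc_shiftP _ oT.1) [t Tt tx].
  by have [i ei] := He _ _ oT Tt; exists i; rewrite ei.
have [j gj] := Hgam _ Gz.
have FE : e @` [set` fset_set (c @` F)] = F.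
  apply/seteqP; split=> [_ [n /= nF <-]|t Ft].
    move: nF; rewrite in_fset_set ?inE => [[t Ft <-]|]; last exact: finite_image.
    by rewrite Hc.
  exists (c t); last exact: Hc.
  by rewrite /= in_fset_set ?inE; [exists t|exact: finite_image].
exists (W (fset_set (c @` F), i, j)).
  split; first by exists (fset_set (c @` F), i, j).
  by rewrite /W /= FE ix gj.
by move=> z'; rewrite /W /= FE ix gj; exact: FA.
Qed.

Lemma H_etale : etale O H.
Proof.
have [HC _ _ _] := subH; split.
- exact: sub_groupoid.
- by apply: continuous_subspaceW C_mul_continuous => -[a b] [/HC Ha /HC Hb e].
- exact: continuous_subspaceW HC C_inv_continuous.
- exact: H_locally_compact.
- exact: H_hausdorff.
- exact: H_second_countable.
- exact: H_rng_local_homeomorphism.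
- exact: H_src_local_homeomorphism.
Qed.

End subgroupoids_etale.

Lemma C_subgroupoid : subgroupoid O C C.
Proof.
have gC := C_groupoid; split=> //.
- by move=> _ [a Ca <-]; exact: groupoid_rng gC _ Ca.
- by move=> a b ab; have := groupoid_mul gC ab.
- by move=> a Ca; have := groupoid_inv gC Ca.
Qed.

Lemma rel_open_self (A : set Y) : rel_open A A.
Proof. by exists setT; [exact: openT|rewrite setIT]. Qed.

Lemma units_subgroupoid : subgroupoid O C (units O C).
Proof.
split=> //.
- by move=> _ /unitsP [T oT ->]; exact: diag_C.
- move=> a b [/= /unitsP [T oT ->] /unitsP [T' oT' ->] /=].
  rewrite /rot_pair /= invmx1 rot1 => -[TT' _]; apply/unitsP; exists T => //.
  by rewrite mul1mx -TT' rot1.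
- move=> _ /unitsP [T oT ->]; apply/unitsP; exists T => //.
  by rewrite /= /rot_pair /= invmx1 rot1.
Qed.

Lemma units_open : rel_open C (units O C).
Proof.
exists (basicY set0 0 1%:M); first exact: open_basicY.
rewrite -units_basicY; apply/seteqP; split=> [u uC|u []] //; split=> //.
by case: units_subgroupoid => H _ _ _; exact: H.
Qed.

Lemma nbhs_units (z : set_type (units O C)) A : nbhs z A -> exists F,
  [/\ finite_set F, basicY F 0 1%:M (\val z) &
  forall z' : set_type (units O C), basicY F 0 1%:M (\val z') -> A z'].
Proof.
move=> /(nbhs_H units_subgroupoid units_open) [F [x [fF zF _ FA]]].
have /unitsP [T oT zE] := set_valP z; rewrite zE /= in zF FA *.
have x0 : x = 0.
  case: zF => -[RT _ e] _; apply: (Rpunc_uniq RT e).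
  by rewrite /= oppr0 shift0.
by rewrite x0 in zF FA; exists F.
Qed.

Lemma units_cantor (d_gt0 : (0 < d)%N) :
  homeomorphic (set_type (units O C)) cantor_space.
Proof.
have [e He] := tile_enum.
pose U n : set (set_type (units O C)) := set_val @^-1` basicY [set e n] 0 1%:M.
have UP n (z : set_type (units O C)) T : \val z = diag T -> U n z <-> T (e n).
  move=> zE; have /unitsP [T' oT' zE'] := set_valP z.
  have TT' : T = T' by move: zE'; rewrite zE => -[].
  have -> : U n z = basicY [set e n] 0 1%:M (\val z) by [].
  rewrite zE; split=> [/basicY0P [_]|Te]; first by apply.
  by apply/basicY0P; split; [rewrite TT'|move=> _ ->].
have hU := H_hausdorff units_subgroupoid.
have bU F : basicY F 0 1%:M `<=` units O C.
  rewrite units_basicY basicY0_units; exact: subIsetl.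
have clU n : clopen (U n).
  split.
    apply: open_comp; first by move=> ? _; exact: initial_continuous.
    exact: open_basicY (finite_set1 _).
  apply: compact_closed hU _; exact: compact_val_basicY.
have sep (x y : set_type (units O C)) : (forall n, U n x <-> U n y) -> x = y.
  move=> xy; apply: val_inj.
  have /unitsP [T oT xE] := set_valP x; have /unitsP [T' oT' yE] := set_valP y.
  rewrite xE yE; congr diag; apply/seteqP; split=> t Tt.
    by have [n en] := He _ _ oT Tt; move: Tt; rewrite -en -!(UP _ _ _ xE) -(UP _ _ _ yE) xy.
  by have [n en] := He _ _ oT' Tt; move: Tt; rewrite -en -!(UP _ _ _ xE) -(UP _ _ _ yE) xy.
apply: (homeomorphic_cantor_space R _ _ clU sep).
- split=> //.
  (* At an isolated point [T], a finite patch around the origin would determine [T]. It recurs at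
     two distinct positions, and recentring at either would return [T], making both positions
     periods and hence 0. *)
  + apply/perfectTP => z oz.
    have /unitsP [T oT zE] := set_valP z.
    have /nbhs_units [F [fF zF Fz]] : nbhs z [set z] by exact: open_nbhs_nbhs.
    have /Omega_puncP [oT' [p Pp Tp]] := oT.
    move: zF; rewrite zE => /basicY0P [_ FT].
    have lQ : legal (F `|` [set p]).
      apply: (Omega_legal oT'); last by rewrite finite_setU.
      by move=> t [/FT|->].
    have [x [y [xy xT yT]]] := Omega_recurrent d_gt0 oT' lQ.
    have zero w : shift w (F `|` [set p]) `<=` T -> w = 0.
      move=> wT.
      have oTw : Omega_punc (shift (- w) T).
        apply/Omega_punc_shiftP => //; exists (shift_tile w p); last exact: puncture_proto.
        by apply: wT; apply: shift_in; right.
      have zw : units O C (diag (shift (- w) T)) by apply/unitsP; exists (shift (- w) T).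
      have : [set z] (exist (fun u' : Y => u' \in units O C) _ (mem_set zw)).
        apply: Fz => /=; apply/basicY0P; split=> // t Ft.
        by apply/shiftP; rewrite opprK; apply: wT; apply: shift_in; left.
      move=> e0; have : diag (shift (- w) T) = diag T by rewrite -zE -e0.
      move=> [/(aperiodic oT') /eqP + _].
      by rewrite oppr_eq0 => /eqP.
    by apply: xy; rewrite (zero _ xT) (zero _ yT).
  + by apply: compact_setT_set_type; rewrite units_basicY; exact: compact_basicY.
  + move=> x y xy; apply: contrapT => H.
    move/eqP: xy; apply; apply: sep => n; apply: contrapT => nn; apply: H.
    have [Ux|Ux] := pselect (U n x); first by exists (U n); split=> // Uy; apply: nn.
    exists (~` U n); split=> //.
      by have [? ?] := clU n; split; [exact: closed_openC|exact: open_closedC].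
    by move=> nUy; apply: nn; split=> [/Ux|/nUy].
- have [T [oT _]] := Omega_star; have [t Tt _] := Omega_near 0 oT.
  have zw : units O C (diag (shift (- puncture t) T)).
    by apply/unitsP; exists (shift (- puncture t) T) => //; exact: Omega_punc_shift.
  by exists (exist (fun u' : Y => u' \in units O C) _ (mem_set zw)).
Qed.

Lemma cantor_groupoid_sub (d_gt0 : (0 < d)%N) (H : set Y) :
  subgroupoid O C H -> rel_open C H -> cantor_groupoid O H.
Proof.
move=> subH openH; split; first exact: H_etale.
by rewrite units_sub //; exact: units_cantor.
Qed.

(** * The AF subgroupoid *)

Lemma Rpunc_diag T : Omega_punc T -> Rpunc (T, T).
Proof. by move=> oT; split=> //; exists 0; rewrite shift0. Qed.

Definition address_codes n : set (tile * tile) :=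
  [set c | P c.1 /\ supertile n c.1 c.2].

Lemma address_codes_finite n : finite_set (address_codes n).
Proof.
have : finite_set (\bigcup_(p in P) (pair p @` supertile n p)).
  apply: bigcup_finite; first exact: prototiles_finite pset.
  by move=> p Pp; apply: finite_image; apply: supertile_finite; exact: ptile_proto.
apply: sub_finite_set => -[p t] [/= Pp pt]; by exists p => //; exists t.
Qed.

(* Recognizability: the address at the origin is a locally constant function of
   the tiling. *)
Lemma address_locally_constant n T p T0 t : address n T p T0 t ->
  exists F, [/\ finite_set F, F `<=` T & forall T', Omega_punc T' -> F `<=` T' ->
    exists T0', address n T' p T0' t].
Proof.
move=> H; apply: contrapT => noF.
have oT := address_punc H.
(* If no finite patch forces the address, the sets [bad F] generate a filter of tilings that agree
   with [T] on ever larger patches but have another address. *)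
pose bad F := [set T' | [/\ Omega_punc T', F `<=` T' & forall T0', ~ address n T' p T0' t]].
pose base := [set F : set tile | finite_set F /\ F `<=` T].
have bad_neq0 F : base F -> bad F !=set0.
  move=> [fF FT]; apply: contrapT => H'; apply: noF; exists F; split=> // T' oT' FT'.
  apply: contrapT => H''; apply: H'; exists T'; split=> // T0' HT0'.
  by apply: H''; exists T0'.
have PF : ProperFilter (filter_from base bad).
  apply: filter_from_proper; last exact: bad_neq0.
  apply: filter_from_filter; first by exists set0; split.
  move=> A B [fA AT] [fB BT]; exists (A `|` B).
    by split; [rewrite finite_setU|move=> u [/AT|/BT]].
  move=> T' [oT' FT' HT']; split; split=> // u Au; apply: FT'; by [left|right].
have [U [UU sU]] := ultraFilterLemma PF.
have Ubad F : finite_set F -> F `<=` T -> U (bad F).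
  by move=> fF FT; apply: sU; exists F.
have U0 := Ubad set0 (finite_set0 _) (@sub0set _ _).
(* Only finitely many addresses exist, so ultrafilter-most of these tilings share one. *)
have [[q u] [/= Pq qu] Uqu] : exists2 c, address_codes n c &
    U [set T' | exists T0', address n T' c.1 T0' c.2].
  apply: (ultra_finite_cover (B := bad set0)) => //; first exact: address_codes_finite.
  move=> T' [oT' _ _]; have [q [T0' [u Hu]]] := address_ex n oT'.
  by exists (q, u); [case: Hu|exists T0'].
have [T1 [[_ _ nT1] [T01 HT01]]] := filter_ex (filterI U0 Uqu).
have cpq : (p, t) <> (q, u) by move=> [pq tu]; apply: (nT1 T01); rewrite pq tu.
have /choice [D_ HD] : forall T', exists T0', (exists T0', address n T' q T0' u) ->
    address n T' q T0' u.
  move=> T'; have [[T0' ?]|?] := pselect (exists T0', address n T' q T0' u).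
    by exists T0'.
  by exists T'.
have UD : U [set T' | address n T' q (D_ T') u] by apply: filterS Uqu => T' /HD.
have UD' : U [set T' | Omega (D_ T') /\ D_ T' q].
  by apply: filterS UD => T' [].
have tight (r : R) : exists A, finite_set A /\
    U [set i | forall v, D_ i v -> `|puncture v| <= r -> A v].
  have [A [fA HA]] := local_finite_at r (ptile_proto Pq); exists A; split=> //.
  apply: filterS UD' => i [oi qi] v iv; apply: (HA [set q; v]) => //; [|by left|by right].
  by apply: (Omega_legal oi) => // _ [->|->].
have oL : Omega (ulim U D_).
  apply: ulim_Omega => // r; apply: filterS UD' => i [oi _].
  by have [? ? ?] := (OmegaP _).1 oi; split.
(* [M] contains both [T] and the recentred substitution of the limit of the desubstituted tilings.
   By maximality all three coincide, so [T] acquires the second address [(q, u)]. *)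
pose M := ulim U id.
have TM : T `<=` M.
  move=> v Tv; have vT : [set v] `<=` T by move=> _ ->.
  by apply: filterS (Ubad _ (finite_set1 v) vT) => T' [_ HT' _]; exact: HT'.
have sM : Pstar M.
  have Up : U [set T' | Pstar T'] by apply: filterS U0 => T' [[oT' _] _ _]; exact: Omega_Pstar.
  apply/PstarP; split=> [v Uv|v w z Uv Uw].
    have [i [sT Tt]] := filter_ex (filterI Up Uv); exact: Pstar_ptile sT Tt.
  have [i [[sT Tt] Tu]] := filter_ex (filterI (filterI Up Uv) Uw).
  by have [_] := (PstarP _).1 sT; apply.
have LM : shift (- puncture u) (iter n omega (ulim U D_)) `<=` M.
  move=> _ [v /iter_omegaP [s Us sv] <-].
  apply: filterS (filterI Us UD) => T' [/= sT' [_ _ _ _ T'E]].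
  suff : shift (- puncture u) (iter n omega (D_ T')) (shift_tile (- puncture u) v).
    by rewrite -T'E.
  apply: shift_in.
  by apply/iter_omegaP; exists s.
have H2 : address n T q (ulim U D_) u.
  split=> //; first by apply: filterS UD' => T' [].
  rewrite -(Omega_maximal oT.1 sM TM); apply: Omega_maximal => //.
  exact/Omega_shift/iter_Omega.
by have [pq _ tu] := address_uniq H H2; apply: cpq; rewrite pq tu.
Qed.

Lemma RAF_level_basic n a : RAF_level n a -> exists F x,
  [/\ finite_set F, basic F x a & basic F x `<=` RAF_level n].
Proof.
move=> La; have Ra := RAF_level_Rpunc La.
move: La => /RAF_levelP [p [T0 [t1 [t2 [H1 H2]]]]].
have [F [fF FT HF]] := address_locally_constant H1.
exists F, (puncture t2 - puncture t1); split=> //.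
  by split=> //; exact: address_diff H1 H2.
move=> b [Rb Fb bE]; have [ob _ _] := Rb.
have [T0' H'] := HF _ ob Fb; apply/RAF_levelP; exists p, T0', t1, t2; split=> //.
by rewrite bE; apply: address_shift => //; case: H2.
Qed.

(** The address of the range and the displacement [x] are constant near [a]. An arrow there lying in
    the level would exhibit a tile of that supertile at displacement [x], and this tile would put
    [a] in the level too. *)
Lemma not_RAF_level_basic n a : Rpunc a -> ~ RAF_level n a -> exists F x,
  [/\ finite_set F, basic F x a & basic F x `<=` ~` RAF_level n].
Proof.
move=> Ra nL; have [x aE] := Rpunc_shift Ra; have [wa wb _] := Ra.
have [p [T0 [t1 H1]]] := address_ex n wa.
have [q [U0 [t2 H2]]] := address_ex n wb.
have [F1 [fF1 FT1 HF1]] := address_locally_constant H1.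
have [F2 [fF2 FT2 HF2]] := address_locally_constant H2.
exists (F1 `|` shift x F2), x; split.
- by rewrite finite_setU; split=> //; exact: finite_image.
- split=> // t [/FT1 //|/shiftP tF].
  by have := FT2 _ tF; rewrite aE shiftP opprK shift_tileNK.
- move=> b [Rb Fb bE] Lb; have [ob1 ob2 _] := Rb.
  have [|T0' H1'] := HF1 _ ob1; first by move=> t Ft; apply: Fb; left.
  have [|U0' H2'] := HF2 _ ob2.
    by rewrite bE -[F2](shiftK x); apply: shift_sub => t Ft; apply: Fb; right.
  move: Lb => /RAF_levelP [p' [V0 [s1 [s2 [K1 K2]]]]].
  have [pp' _ ts1] := address_uniq H1' K1; have [qp' _ ts2] := address_uniq H2' K2.
  have xE := Rpunc_uniq Rb bE (address_diff K1 K2).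
  apply: nL; apply/RAF_levelP; exists p, T0, t1, s2; split=> //.
  rewrite aE xE -ts1; apply: address_shift => //.
  by rewrite pp'; case: K2.
Qed.

(** Finitely many pairs of addresses give finitely many displacements, so an ultrafilter on the
    level lives on one compact basic set; the level is closed there. *)
Lemma compact_RAF_level n : compact (RAF_level n : set X).
Proof.
rewrite compact_ultra => U FU UL.
pose J := [set c : (tile * tile) * (tile * tile) | address_codes n c.1 /\ address_codes n c.2].
have fJ : finite_set J by apply: finite_setX; exact: address_codes_finite.
have [c _ Uc] : exists2 c, J c &
    U (basic set0 (puncture c.2.2 - puncture c.1.2)).
  apply: (ultra_finite_cover _ fJ UL) => a La; have Ra := RAF_level_Rpunc La.
  move: La => /RAF_levelP [p [T0 [t1 [t2 [H1 H2]]]]].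
  exists ((p, t1), (p, t2)); first by case: H1; case: H2.
  by split=> //; exact: address_diff H1 H2.
have := @compact_basic set0 (puncture c.2.2 - puncture c.1.2).
rewrite compact_ultra => /(_ U FU Uc) [a [[Ra _ _] Ua]].
exists a; split=> //; apply: contrapT => nL.
have [F [x [fF Fa FL]]] := not_RAF_level_basic Ra nL.
have : U (basic F x) by apply: Ua; apply/nbhs_basic => //; exists F, x; split.
by move=> UF; have [b [Lb /FL]] := filter_ex (filterI UL UF).
Qed.

Local Notation K n := (RAF_level n `*` G : set Y).

Lemma K_open n : rel_open C (K n).
Proof.
exists [set y : Y | exists F x, [/\ finite_set F, basic F x y.1 & basic F x `<=` RAF_level n]].
  rewrite openE => -[a g] [F [x [fF /= Fa FL]]]; have Ra : Rpunc a by case: Fa.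
  apply/nbhsY => //; exists F, x; split=> // -[b h] [Fb _]; exists F, x.
  by split.
apply/seteqP; split=> [[a g] [La Gg]|[a g] [[Ra Gg] [F [x [_ Fa FL]]]]].
  by split; [split=> //; exact: RAF_level_Rpunc La|exact: RAF_level_basic].
by split=> //; exact: FL.
Qed.

Lemma K_subgroupoid n : subgroupoid O C (K n).
Proof.
split.
- by move=> [a g] [La Gg]; split=> //; exact: RAF_level_Rpunc La.
- by move=> _ /unitsP [T oT ->]; split; [exact: RAF_level_refl|exact: G1].
- move=> [[T T'] g] [[U U'] h] [[/= La Gg] [/= Lb Gh] [e _]].
  split=> /=; last exact: GM.
  apply: RAF_level_trans La _; have := RAF_level_rot Gg Lb.
  by rewrite -e rotVK.
- move=> [[T T'] g] [La Gg]; split=> /=; last exact: GV.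
  by apply: RAF_level_rot; [exact: GV|exact: RAF_level_sym].
Qed.

Lemma K_compact n : compact (K n).
Proof.
apply: compact_setX; first exact: compact_RAF_level.
exact: (@finite_compact (discrete_topology 'M[R]_d)).
Qed.

(** Two arrows with equal endpoints and group parts [g] and [h] make a tiling equivalent, within the
    level, to its image under [h *m invmx g]; freeness leaves only the identity. *)
Lemma K_principal n : principal O (K n).
Proof.
move=> x y [[T T'] g] [[U U'] h] _ _ [/= La Gg] [/= Lb Gh] <- <- [UT _] [+ _].
rewrite /rot_pair /= UT in Lb * => e.
have eU : U' = rot (h *m invmx g) T'.
  by rewrite rotM //; [rewrite -e rotVK|exact: GV].
have k1 : h *m invmx g = 1%:M.
  apply: (@RAF_level_free n _ T'); first by apply: GM => //; exact: GV.
    by case: (RAF_level_Rpunc La).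
  by rewrite -eU; exact: RAF_level_trans (RAF_level_sym La) Lb.
have gh : h = g by rewrite -[h]mulmx1 -(G_mulVmx Gg) mulmxA k1 mul1mx.
by rewrite gh eU k1 rot1.
Qed.

Local Notation C0 := (RAF S `*` G : set Y).

Lemma C0_bigcup : C0 = \bigcup_n K n.
Proof.
by apply/seteqP; split=> [[a g] [[n _ La] Gg]|[a g] [n _ [La Gg]]]; [exists n|split=> //; exists n].
Qed.

Lemma C0_open : rel_open C C0.
Proof.
have /choice [W HW] : forall n, exists W : set Y, open W /\ K n = C `&` W.
  by move=> n; have [W oW e] := K_open n; exists W.
exists (\bigcup_n W n); first by apply: bigcup_open => n _; case: (HW n).
rewrite C0_bigcup setI_bigcupr; apply: eq_bigcupr => n _.
by case: (HW n).
Qed.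

Lemma C0_subgroupoid : subgroupoid O C C0.
Proof.
split.
- by rewrite C0_bigcup => y [n _]; case: (K_subgroupoid n) => KC _ _ _; exact: KC.
- rewrite C0_bigcup => y uy; exists 0 => //; case: (K_subgroupoid 0) => _ uK _ _; exact: uK.
- move=> a b; rewrite C0_bigcup => -[[n _ Ka] [m _ Kb] e].
  exists (maxn n m) => //; case: (K_subgroupoid (maxn n m)) => _ _ mK _; apply: mK.
  split=> //.
    by case: Ka => La Ga; split=> //; apply: RAF_level_le La; rewrite leq_maxl.
  by case: Kb => Lb Gb; split=> //; apply: RAF_level_le Lb; rewrite leq_maxr.
- move=> a; rewrite C0_bigcup => -[n _ Ka]; exists n => //.
  by case: (K_subgroupoid n) => _ _ _; apply.
Qed.

Lemma C0_AF (d_gt0 : (0 < d)%N) : AF_groupoid O C0.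
Proof.
split; first exact: (cantor_groupoid_sub d_gt0 C0_subgroupoid C0_open).
have KC0 n : K n `<=` C0 by move=> y Ky; rewrite C0_bigcup; exists n.
exists (fun n => K n); split.
- move=> n; split.
  + have [_ uK mK iK] := K_subgroupoid n; split=> //.
    by rewrite (units_sub C0_subgroupoid).
  + exact: K_compact.
  + have [W oW e] := K_open n; exists W => //; rewrite e in KC0 *.
    have [C0C _ _ _] := C0_subgroupoid.
    apply/seteqP; split=> [y [Cy Wy]|y [/C0C Cy Wy]] //.
    by split=> //; apply: (KC0 n); rewrite e.
  + exact: K_principal.
  + exact: (cantor_groupoid_sub d_gt0 (K_subgroupoid n) (K_open n)).
- by move=> n [a g] [La Gg]; split=> //; exact: RAF_levelS.
- exact: C0_bigcup.
Qed.

(** * Shallow tiles and thinness *)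

(** Inflate [p] by [k1] steps and take the tile [v] at the origin. Its supertile of order [N]
    contains every type and, measured before the last [N] steps, lies with margin within [D + D + 1]
    of 0, less than [lam ^+ k1 * r0]. *)
Lemma supertile_interior : exists k, forall p q, P p -> P q -> exists x,
  supertile k p (shift_tile x q) /\
  forall z w : V, (shift_tile x q).1 z -> `|w - z| <= 1 -> p.1 ((lam ^+ k)^-1 *: w).
Proof.
have [N HN] := prim_ptile.
have [k1 /(_ k1 (leqnn k1)) Hk1] := lamX_unbounded ((D + D + 1) / r0).
exists (N + k1)%N => p q Pp Pq; have pp := ptile_proto Pp.
have p0 : p.1 0 by rewrite -(puncture_proto0 Pp); exact: ptile_puncture_in.
have /(supp_supertile k1 _ pp) [v pv v0] : p.1 ((lam ^+ k1)^-1 *: (0 : V)) by rewrite scaler0.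
have pv' := supertile_ptile pp pv.
have [x vx] := HN N _ q (leqnn N) pv' Pq.
exists x; split; first by apply/supertileDP; exists v.
move=> z w /(supertile_sub_supp pv' vx) /(ptile_bound pv') zD wz.
have := ptile_bound pv' v0; rewrite sub0r normrN => vD.
have -> : (lam ^+ (N + k1))^-1 *: w = (lam ^+ k1)^-1 *: ((lam ^+ N)^-1 *: w).
  by rewrite scalerA exprD invfM mulrC.
apply: (ptile_ball pp); rewrite puncture_proto0 // subr0.
rewrite normrZ gtr0_norm ?invr_gt0 ?lamX_gt0 //.
rewrite mulrC ltr_pdivrMr ?lamX_gt0 //.
rewrite ltr_pdivrMr ?(std_r0 std) // mulrC in Hk1; apply: le_lt_trans Hk1.
have -> : (lam ^+ N)^-1 *: w = ((lam ^+ N)^-1 *: z - puncture v + puncture v) + (lam ^+ N)^-1 *: (w - z).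
  by rewrite subrK -scalerDr addrC subrK.
apply: le_trans (ler_normD _ _) _; apply: lerD.
  by apply: le_trans (ler_normD _ _) _; apply: lerD.
rewrite normrZ gtr0_norm ?invr_gt0 ?lamX_gt0 //.
by rewrite -[1]mulr1 ler_pM // ?invr_ge0 ?(ltW (lamX_gt0 _)) // invf_le1 ?lamX_ge1 ?lamX_gt0.
Qed.

Definition shallow r n t := [set u | supertile n t u /\ ~ deep r n t u].

Lemma shallow_finite r n t : ptile t -> finite_set (shallow r n t).
Proof. by move=> pt; apply: sub_finite_set (supertile_finite n pt) => u []. Qed.

Lemma ncard_shift x T : finite_set T -> ncard (shift x T) = ncard T.
Proof. by move=> fT; apply: ncard_image => // a b _ _ /shift_tile_inj. Qed.

Lemma ncard_supertile n t : ptile t ->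
  ncard (supertile n t) = ncard (supertile n (ptype t)).
Proof.
move=> pt; rewrite supertileE ncard_shift //.
by apply: supertile_finite; exact/ptile_proto/ptypeP.
Qed.

Lemma ncard_supertile_gt0 n t : ptile t -> (0 < ncard (supertile n t))%N.
Proof. by move=> pt; apply: ncard_gt0; [exact: supertile_finite|exact: supertile_neq0]. Qed.

Lemma supertile_bigcup m n t : supertile (m + n) t = \bigcup_(u in supertile n t) supertile m u.
Proof.
apply/seteqP; split=> [u /supertileDP [v tv vu]|u [v tv vu]]; first by exists v.
by apply/supertileDP; exists v.
Qed.

Lemma supertile_trivIset m n t : ptile t -> trivIset (supertile n t) (supertile m).
Proof.
move=> pt u v tu tv [w [uw vw]].
exact: (supertile_inj (supertile_Pstar n pt) tu tv uw vw).
Qed.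

Lemma supertile_size_bound n :
  exists2 q, P q & forall p, P p ->
    (ncard (supertile n p) <= ncard (supertile n q))%N.
Proof.
by apply: finite_argmax; [exact: prototiles_finite pset|exact: prototiles_neq0 pset].
Qed.

Definition shallow_le r n (b : R) := forall t, ptile t ->
  (ncard (shallow r n t))%:R <= b * (ncard (supertile n t))%:R.

(* Each supertile of order [n + k] contains a tile whose [n]th supertile is
   entirely deep; choosing its type so that this supertile is the largest one,
   it carries a definite proportion of the tiles. *)
Lemma shallow_step : exists k (c : R), 0 <= c < 1 /\ forall (r : R) n (b : R), 0 <= b ->
  r + r0 <= lam ^+ n -> shallow_le r n b -> shallow_le r (n + k) (b * c).
Proof.
have [k Hk] := supertile_interior.
have [p0 Pp0 maxp0] := supertile_size_bound k.
set kap := ncard (supertile k p0) in maxp0.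
have kap0 : 0 < kap%:R :> R by rewrite ltr0n ncard_supertile_gt0 //; exact: ptile_proto.
have kap1 : 1 <= kap%:R :> R by rewrite ler1n ncard_supertile_gt0 //; exact: ptile_proto.
(* A supertile of order [n + k] splits into at most [kap] supertiles of order [n], none larger than
   the chosen deep one, whence its share of at least [kap^-1]. *)
exists k, (1 - kap%:R^-1); split.
  by rewrite subr_ge0 invf_le1 // kap1 ltrBlDr ltrDl invr_gt0.
move=> r n b b0 rn Hb t pt.
have [q Pq maxq] := supertile_size_bound n.
have [x [px Hx]] := Hk _ _ (ptypeP pt) Pq.
pose y : V := lam ^+ k *: puncture t.
pose u0 := shift_tile (y + x) q.
have tu0 : supertile k t u0 by rewrite supertileE /u0 -shift_tileD; exact: shift_in.
have pu0 := supertile_ptile pt tu0.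
(* Substituting [n] times expands the margin 1 to [lam ^+ n], which is at least [r + r0]. *)
have deep0 u : supertile n u0 u -> deep r (n + k) t u.
  move=> u0u z zu; have pu := supertile_ptile pu0 u0u.
  have H1 : u0.1 ((lam ^+ n)^-1 *: puncture u).
    exact: (supertile_sub_supp pu0 u0u (ptile_puncture_in pu)).
  have H2 : (ptype t).1 ((lam ^+ k)^-1 *: ((lam ^+ n)^-1 *: z - y)).
    apply: (Hx ((lam ^+ n)^-1 *: puncture u - y)).
      move: H1; rewrite /u0 -shift_tileD => -[w qw <-].
      by rewrite addrK.
    rewrite opprB addrA subrK -scalerBr normrZ gtr0_norm ?invr_gt0 ?lamX_gt0 //.
    rewrite mulrC ler_pdivrMr ?lamX_gt0 // mul1r; apply: le_trans rn; exact: ltW.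
  move: H2; rewrite -{2}(ptypeE t) => H2.
  exists ((lam ^+ k)^-1 *: ((lam ^+ n)^-1 *: z - y)) => //.
  by rewrite /y scalerBr !scalerA mulVf ?lamX_neq0 // scale1r subrK exprD invfM mulrC.
pose J := supertile k t `\ u0.
have Jt : J `<=` supertile k t by move=> u [].
have fJ : finite_set J by apply: sub_finite_set Jt _; exact: supertile_finite.
have pJ u : J u -> ptile u by move=> /Jt; exact: supertile_ptile.
pose A := \bigcup_(u in J) supertile n u.
have fA : finite_set A.
  by apply: bigcup_finite => // u /pJ; exact: supertile_finite.
have E1 : supertile (n + k) t = A `|` supertile n u0.
  have -> : supertile (n + k) t = \bigcup_(u in u0 |` J) supertile n u.
    rewrite supertile_bigcup; congr (\bigcup_(_ in _) _).
    by apply/seteqP; split=> u; [have [->|nu] := pselect (u = u0); [left|right; split]|move=> [->|[]]].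
  by rewrite bigcup_setU1 setUC.
have A0 : A `&` supertile n u0 = set0.
  rewrite -subset0 => u [[v [tv vu0] vu] u0u]; apply: vu0.
  exact: (supertile_inj (supertile_Pstar k pt) tv tu0 vu u0u).
have fu0 := supertile_finite n pu0.
have NE : ncard (supertile (n + k) t) = (ncard A + ncard (supertile n u0))%N.
  by rewrite E1 ncardU.
have NM : (ncard (supertile (n + k) t) <= kap * ncard (supertile n u0))%N.
  rewrite supertile_bigcup (ncard_supertile n pu0) /u0.
  have -> : ptype (shift_tile (y + x) q) = q.
    by rewrite /ptype puncture_proto // shift_tileK.
  have fk := supertile_finite k pt.
  apply: leq_trans (ncard_bigcup_le (m := ncard (supertile n q)) fk _ _) _.
  - by move=> u tu; apply: supertile_finite; exact: supertile_ptile tu.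
  - move=> u tu; have pu := supertile_ptile pt tu.
    by rewrite ncard_supertile //; apply/maxq/ptypeP.
  - by rewrite leq_mul2r (ncard_supertile k pt) maxp0 ?orbT //; exact: ptypeP.
(* A tile deep in its supertile of order [n] is deep in the larger one, so shallow tiles come from
   shallow ones outside the chosen supertile. *)
have ss : shallow r (n + k) t `<=` \bigcup_(u in J) shallow r n u.
  move=> u [/supertileDP [v tv vu] nd]; exists v; last first.
    split=> // dv; apply: nd => z /dv H; rewrite exprD invfM mulrC -scalerA.
    exact: (supertile_sub_supp pt tv).
  by split=> // e; apply: nd; apply: deep0; rewrite -e.
apply: (@le_trans _ _ (b * (ncard A)%:R)).
  apply: (@le_trans _ _ (ncard (\bigcup_(u in J) shallow r n u))%:R).
    rewrite ler_nat; apply: ncard_sub ss.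
    by apply: bigcup_finite => // u /pJ; exact: shallow_finite.
  apply: ncard_bigcup_ratio => // [||u Ju|u Ju].
  - by move=> u v /Jt tu /Jt; exact: supertile_trivIset.
  - by move=> u /pJ; exact: supertile_finite.
  - by move=> v [].
  - exact/Hb/pJ.
rewrite -mulrA ler_wpM2l // NE natrD mulrBl mul1r lerBrDr lerD2l.
by rewrite mulrC ler_pdivrMr // -natrD -NE -natrM ler_nat mulnC.
Qed.

Lemma shallow_ratio (r eta : R) : 0 < eta -> exists n, shallow_le r n eta.
Proof.
move=> eta0; have [k [c [/andP[c0 c1] Hk]]] := shallow_step.
have [n0 Hn0] := lamX_unbounded (r + r0).
have H0 j : shallow_le r (n0 + j * k) (c ^+ j).
  elim: j => [|j IH].
    rewrite expr0 mul0n addn0 => t pt; rewrite mul1r ler_nat.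
    by apply: ncard_sub; [exact: supertile_finite|move=> u []].
  rewrite exprSr mulSnr addnA; apply: Hk => //; first exact: exprn_ge0.
  by apply/ltW/Hn0; rewrite leq_addr.
have cc : `|c| < 1 by rewrite ger0_norm.
have /cvgrPdist_lt /(_ eta eta0) [j _ /(_ j (leqnn j))] := cvg_expr cc.
rewrite /= sub0r normrN ger0_norm ?exprn_ge0 // => /ltW cj.
exists (n0 + j * k)%N => t pt; apply: le_trans (H0 j t pt) _.
by rewrite ler_wpM2r.
Qed.

(** Arrows of bounded displacement form an increasing open cover. The vector is rotated back by
    [invmx y.2] because the displacement is measured in the source tiling. *)
Lemma compact_shift_bound (K : set Y) : compact K -> K `<=` C ->
  exists r : R, forall (y : Y) x, K y -> y.1.2 = shift (- x) y.1.1 ->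
    `|invmx y.2 *m x| <= r.
Proof.
rewrite compact_cover => cK KC.
pose J (n : nat) := [set c : V * 'M[R]_d | `|invmx c.2 *m c.1| <= n%:R].
pose B n : set Y := \bigcup_(c in J n) basicY set0 c.1 c.2.
have oB n : [set: nat] n -> open (B n).
  by move=> _; apply: bigcup_open => c _; apply: open_basicY.
have KB : K `<=` cover setT B.
  move=> y Ky; have Ry := C_sub_Rpunc KC Ky; have [x yE] := Rpunc_shift Ry.
  exists (Num.bound `|invmx y.2 *m x|) => //; exists (x, y.2).
    by rewrite /J /=; apply/ltW/archi_boundP.
  by split=> //; split.
have [D' _ HD'] := cK _ _ _ oB KB.
exists (\max_(i <- D') i)%:R => y x Ky yE.
have [n /= nD [[w g] /= wg [[Ry _ wE] /= gE]]] := HD' _ Ky.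
rewrite gE (Rpunc_uniq Ry yE wE); apply: le_trans wg _.
by rewrite ler_nat; apply: leq_bigmax_seq.
Qed.

(** Inside its supertile, a shallow origin is sent to the tile assigned by each of [m] injections
    with disjoint images. Uniqueness of addresses makes the resulting ranges disjoint and local
    constancy makes the graphs compact. *)
Lemma thin_shallow (r : R) (K : set Y) : K `<=` units O C -> compact K ->
  (forall n T p T0 t, K (diag T) -> address n T p T0 t -> ~ deep r n p t) ->
  thin O C0 K.
Proof.
move=> KU cK Ksh; split=> //; first by rewrite (units_sub C0_subgroupoid).
have KO T : K (diag T) -> Omega_punc T.
  by move=> KT; have /unitsP [T' oT' e] := KU _ KT; case: e => ->.
move=> m.
(* Using [m.+1] keeps the ratio positive when [m] is 0. *)
have [n Hn] : exists n, shallow_le r n (m.+1%:R^-1) by apply: shallow_ratio.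
have /choice [f Hf] : forall p, exists f : nat -> tile -> tile, P p ->
    (forall k a, (k < m)%N -> shallow r n p a -> supertile n p (f k a)) /\
    (forall k l a b, (k < m)%N -> (l < m)%N -> shallow r n p a -> shallow r n p b ->
       f k a = f l b -> k = l /\ a = b).
  move=> p; have [Pp|] := pselect (P p); last by exists (fun _ => id).
  have pp := ptile_proto Pp.
  have [|f Hf] := ncard_copies (shallow_finite r n pp) (supertile_finite n pp) (m := m).
    have := Hn _ pp; rewrite mulrC ler_pdivlMr // -natrM ler_nat.
    by apply: leq_trans; rewrite mulnC leq_mul2l leqnSn orbT.
  by exists f.
have /choice [c Hc] : forall T, exists c : tile * set tile * tile, Omega_punc T ->
    address n T c.1.1 c.1.2 c.2.
  move=> T; have [oT|] := pselect (Omega_punc T); last first.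
    by have [p0 _] := prototiles_neq0 pset; exists (p0, T, p0).
  by have [p [T0 [t Ht]]] := address_ex n oT; exists (p, T0, t).
pose h k T := f (c T).1.1 k (c T).2.
pose w k T := puncture (h k T) - puncture (c T).2.
(* [sg k] turns the unit [T] into an arrow with source [T], whose range is [T] recentred at the tile
   chosen by the [k]th injection. *)
pose sg k (y : Y) : Y := ((shift (- w k y.1.1) y.1.1, y.1.1), 1%:M).
have hK T k : K (diag T) -> (k < m)%N ->
    address n (shift (- w k T) T) (c T).1.1 (c T).1.2 (h k T).
  move=> KT km; have oT := KO _ KT.
  have H := Hc _ oT; have [Pp _ _ pt _] := H.
  apply: address_shift => //; have [+ _] := Hf _ Pp; apply=> //.
  by split=> //; exact: Ksh KT H.
have hinj T T' k l : K (diag T) -> K (diag T') -> (k < m)%N -> (l < m)%N ->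
    shift (- w k T) T = shift (- w l T') T' -> k = l /\ T = T'.
  move=> KT KT' km lm e.
  have H1 := hK _ _ KT km; have H2 := hK _ _ KT' lm; rewrite e in H1.
  have [e1 e2 e3] := address_uniq H1 H2.
  have oT := KO _ KT; have oT' := KO _ KT'.
  have HT := Hc _ oT; have HT' := Hc _ oT'; have [Pp _ _ pt TE] := HT.
  have [_ _ _ pt' TE'] := HT'.
  have [_ inj] := Hf _ Pp; have [|||e4 e5] := inj k l (c T).2 (c T').2 km lm.
  - by split=> //; exact: Ksh KT HT.
  - by rewrite e1; split=> //; exact: Ksh KT' HT'.
  - by rewrite {2}e1.
  - by split=> //; rewrite TE TE' e2 e5.
have Kdiag y : K y -> exists2 T, K (diag T) & y = diag T.
  by move=> Ky; have /unitsP [T _ yE] := KU _ Ky; exists T => //; rewrite -yE.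
have src_sg k T : gsrc O (sg k (diag T)) = diag T.
  by rewrite /= /rot_pair /= (_ : invmx 1%:M = 1%:M) ?rot1 // invmx1.
exists (fun k : 'I_m => sg k @` K); split=> [k|k|k l kl].
- split.
    split.
    + move=> _ [_ /Kdiag [T KT ->] <-]; split; last exact: G1.
      exists n => //; apply/RAF_levelP.
      have oT := KO _ KT.
      exists (c T).1.1, (c T).1.2, (h k T), (c T).2; split; [exact: hK|exact: Hc].
    + move=> a b; rewrite !inE => -[_ /Kdiag [T KT ->] <-] [_ /Kdiag [T' KT' ->] <-] [/= e].
      by have [_ ->] := hinj _ _ _ _ KT KT' (ltn_ord k) (ltn_ord k) e.
    + move=> a b; rewrite !inE => -[_ /Kdiag [T KT ->] <-] [_ /Kdiag [T' KT' ->] <-].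
      by rewrite !src_sg => ->.
  apply: continuous_compact => //; apply: within_continuousY.
  + move=> y /Kdiag [T KT ->]; have oT := KO _ KT.
    exact: diag_C.
  + move=> y /Kdiag [T KT ->]; have oT := KO _ KT.
    split=> //=; first by have := address_punc (hK _ _ KT (ltn_ord k)).
    by exists (w k T); rewrite shiftNK.
  + move=> y x /Kdiag [T KT ->] /= _; have oT := KO _ KT.
    have H := Hc _ oT.
    have [F' [fF' FT' HF']] := address_locally_constant H.
    exists (- w k T) => F fF FT; exists (F' `|` shift (w k T) F); split.
    * by rewrite finite_setU; split=> //; exact: finite_image.
    * by move=> t [/FT'//|[s Fs <-]]; have /shiftP := FT _ Fs; rewrite opprK.
    * move=> z /Kdiag [T' KT' ->] [[_ /= FT2 _] _].
      have oT' := KO _ KT'.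
      have [|T0' H'] := HF' _ oT'; first by move=> t Ft; apply: FT2; left.
      have [e1 _ e3] := address_uniq (Hc _ oT') H'.
      have wE : w k T' = w k T by rewrite /w /h e1 e3.
      split=> //=; last by rewrite opprK wE shiftNK.
      by rewrite wE shift_subE opprK => t Ft; apply: FT2; right.
- apply/seteqP; split=> [_ [_ [_ /Kdiag [T KT ->] <-] <-]|_ /Kdiag [T KT ->]].
    by rewrite src_sg.
  by exists (sg k (diag T)); [exists (diag T)|exact: src_sg].
- rewrite -subset0 => _ [[_ [_ /Kdiag [T KT ->] <-] <-] [_ [_ /Kdiag [T' KT' ->] <-] [/= e]]].
  have [e1 _] := hinj _ _ _ _ KT' KT (ltn_ord l) (ltn_ord k) e.
  by move=> _; move/eqP: kl; apply; apply: val_inj.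
Qed.

(** If the origin of a source were deep for the displacement bound [r] at some level, the range
    would be centred in the same supertile, up to rotation, and the arrow would lie in [RAF]. *)
Lemma RAF_thin (K : set Y) : compact K -> K `<=` C `\` C0 -> thin O C0 (gsrc O @` K).
Proof.
move=> cK KC; have KC' : K `<=` C by move=> y /KC [].
have [r Hr] := compact_shift_bound cK KC'.
apply: (@thin_shallow r).
- by move=> _ [y /KC' Cy <-]; exists (gsrc O y); [exact: (groupoid_src C_groupoid)|case: (groupoid_src_unit C_groupoid Cy)].
- by apply: continuous_compact => //; apply: continuous_subspaceW C_src_continuous.
move=> n T p T0 t [y Ky [e _]] H dt.
have [[Ry Gg] nC0] := KC _ Ky; have [x yE] := Rpunc_shift Ry.
have gx := Hr _ _ Ky yE; have Gg' := GV Gg.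
move: e; rewrite /= /rot_pair /= => e.
have wT := address_punc H.
have eU : rot (invmx y.2) y.1.1 = shift (invmx y.2 *m x) T.
  by rewrite -e yE rot_shift mulmxN shiftNK.
have oU : Omega_punc (shift (- - (invmx y.2 *m x)) T).
  by rewrite opprK -eU; apply: Omega_punc_rot => //; case: Ry.
have /Omega_punc_shiftP [] := oU; first by case: wT.
move=> u Tu ux.
have [|t' H' _] := address_deep H dt Tu; first by rewrite ux normrN.
apply: nC0; split=> //; exists n => //.
have LT : RAF_level n (shift (- puncture u) T, T).
  by apply/RAF_levelP; exists p, T0, t', t.
have := RAF_level_rot Gg LT; by rewrite ux opprK -eU rotVK // -e rotVK //; case: (y.1).
Qed.

(** * Invariant measures *)

(* [Q n] is a large supertile of [T] and [B] the set of its shallow tiles. *)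
Lemma folner_sequence : exists (T : set tile) (Q : nat -> set tile),
  Omega T /\ forall n, [/\ Q n `<=` T, finite_set (Q n), Q n !=set0 &
    exists B, [/\ B `<=` Q n, (ncard B)%:R <= n.+1%:R^-1 * (ncard (Q n))%:R :> R &
      forall t u, Q n t -> ~ B t -> T u -> `|puncture u - puncture t| <= n%:R -> Q n u]].
Proof.
have [T [oT _]] := Omega_star; exists T.
suff /choice [Q HQ] : forall n : nat, exists Q : set tile,
    [/\ Q `<=` T, finite_set Q, Q !=set0 &
    exists B, [/\ B `<=` Q, (ncard B)%:R <= n.+1%:R^-1 * (ncard Q)%:R :> R &
      forall t u, Q t -> ~ B t -> T u -> `|puncture u - puncture t| <= n%:R -> Q u]].
  by exists Q.
move=> n; have [k Hk] : exists k, shallow_le n%:R k (n.+1%:R^-1) by apply: shallow_ratio.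
have [T1 oT1 T1E] := iter_omega_surj k oT.
have [s T1s _] := Omega_near 0 oT1; have ps := Omega_ptile oT1 T1s.
exists (supertile k s); split.
- by move=> t st; rewrite -T1E; apply/iter_omegaP; exists s.
- exact: supertile_finite.
- exact: supertile_neq0.
exists (shallow n%:R k s); split; first by move=> t [].
  exact: Hk.
move=> t u st nt Tu tu; have {}nt : deep n%:R k s t by apply: contrapT => H; apply: nt.
have pu := Omega_ptile oT Tu.
move: (Tu); rewrite -T1E => /iter_omegaP [s' T1s' s'u].
suff <- : s' = s by [].
apply: (supertile_overlap (Omega_Pstar oT1) T1s' T1s s'u (ptile_nbhs_puncture pu)).
apply/nbhs_norm; exists r0; first exact: std_r0 std.
move=> z zu; apply: nt.
rewrite -(subrK (puncture u) z) -addrA addrC; apply: le_lt_trans (ler_normD _ _) _.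
by apply: ler_ltD.
Qed.

Lemma ncard_setX_ratio (B Q : set tile) (b : R) : finite_set Q -> B `<=` Q ->
  (ncard B)%:R <= b * (ncard Q)%:R ->
  (ncard (B `*` G))%:R <= b * (ncard (Q `*` G))%:R.
Proof.
move=> fQ BQ Bb.
have XE (A : set tile) : A `*` G = \bigcup_(g in G) ((fun t => (t, g)) @` A).
  apply/seteqP; split=> [[t g] [At Gg]|_ [g Gg [t At <-]]] //.
  by exists g => //; exists t.
rewrite !XE; apply: ncard_bigcup_ratio => //.
- by move=> g h _ _ [_ [[t _ <-] [u _ [_ ->]]]].
- by move=> g _; exact: finite_image.
- by move=> g _ _ [t /BQ Qt <-]; exists t.
- move=> g _; rewrite !ncard_image //; try by move=> ? ? _ _ [].
  exact: sub_finite_set BQ fQ.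
Qed.

(* Averages over the tiles of the large supertiles and over [G], passed to the
   limit along an ultrafilter. *)
Lemma invariant_mean : exists m : set (set tile) -> R,
  [/\ forall A, 0 <= m A,
      forall A B, A `&` B = set0 -> m (A `|` B) = m A + m B,
      m Omega_punc = 1, m (~` Omega_punc) = 0 &
      forall A B x h, G h ->
        (forall T, A T -> Omega_punc (shift (- x) T) /\ B (rot h (shift (- x) T))) ->
        m A <= m B].
Proof.
have [T [Q [oT HQ]]] := folner_sequence.
pose W n := Q n `*` G.
pose pt (w : tile * 'M[R]_d) := rot w.2 (shift (- puncture w.1) T).
pose N n (A : set (set tile)) := ncard (W n `&` pt @^-1` A).
pose c A n : R := (N n A)%:R / (ncard (W n))%:R.
have fW n : finite_set (W n).
  by apply: finite_setX => //; case: (HQ n).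
have fN n A : finite_set (W n `&` pt @^-1` A) by apply: sub_finite_set (fW n) => w [].
have W0 n : 0 < (ncard (W n))%:R :> R.
  rewrite ltr0n; apply: ncard_gt0 => //; case: (HQ n) => _ _ [t Qt] _.
  by exists (t, 1%:M); split=> //; exact: G1.
have NW n A : (N n A <= ncard (W n))%N by apply: ncard_sub => // w [].
have c01 A n : 0 <= c A n <= 1.
  rewrite divr_ge0 ?ler0n //= ler_pdivrMr // mul1r ler_nat; exact: NW.
have [U [UU sU]] := @ultraFilterLemma nat \oo _.
have /choice [m Hm] := fun A => ultra_bounded_cvg UU (c01 A).
have m_uniq A (l : R) : c A @ U --> l -> m A = l.
  by move=> cl; exact: (cvg_unique (@norm_hausdorff _ R^o) (Hm A) cl).
have pt_punc n w : W n w -> Omega_punc (pt w).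
  move=> [Qw Gw]; apply: Omega_punc_rot => //; apply: Omega_punc_shift => //.
  by case: (HQ n) => QT _ _ _; exact: QT.
exists m; split.
- move=> A; apply: (@ler_cvg_to _ U _ R (fun=> 0) (c A)); [exact: cvg_cst|exact: Hm|].
  by apply: filterE => n; case/andP: (c01 A n).
- move=> A B AB; apply: m_uniq.
  suff -> : c (A `|` B) = c A + c B by apply: cvgD; exact: Hm.
  apply/funext => n; rewrite /c /N fctE -mulrDl -natrD preimage_setU setIUr ncardU //.
  by rewrite setIACA setIid -preimage_setI AB preimage_set0 setI0.
- apply: m_uniq; suff -> : c Omega_punc = fun=> 1 by exact: cvg_cst.
  apply/funext => n; rewrite /c /N (_ : _ `&` _ = W n) ?divff ?gt_eqF //.
  by apply/setIidPl => w /pt_punc.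
- apply: m_uniq; suff -> : c (~` Omega_punc) = fun=> 0 by exact: cvg_cst.
  apply/funext => n; rewrite /c /N (_ : _ `&` _ = set0) ?ncard0 ?mul0r //.
  by rewrite -subset0 => w [/pt_punc].
- move=> A B x h Gh AB.
  (* Moving the sample [(t, g)] by [x] moves the tile [t] by [invmx g *m x]. As [G] is finite these
     displacements are bounded, and for large [n] only tiles of [E] can leave [Q n]. *)
  have [g0 Gg0 Hg0] : exists2 g0, G g0 & forall g, G g ->
      (Num.bound `|invmx g *m x| <= Num.bound `|invmx g0 *m x|)%N.
    by apply: finite_argmax => //; exists 1%:M; exact: G1.
  have Hharm : (fun n => c B n + harmonic n) @ U --> m B.
    rewrite -[m B]addr0; apply: cvgD; first exact: Hm.
    move=> V V0; apply: sU; exact: (cvg_harmonic (R := R)).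
  apply: (ler_cvg_to (Hm A) Hharm); apply: sU.
  exists (Num.bound `|invmx g0 *m x|) => // n /= Nn.
  have [QT fQ _ [E [EQ bE HE]]] := HQ n.
  have /choice [f Hf] : forall w, exists u, (W n `&` pt @^-1` A) w ->
      T u /\ puncture u = puncture w.1 + invmx w.2 *m x.
    move=> w; have [[[Qw Gw] Aw]|] := pselect ((W n `&` pt @^-1` A) w); last by exists w.1.
    have [oAw _] := AB _ Aw.
    have oTw : Omega (pt w) by apply: Omega_rot => //; exact: Omega_shift.
    have /(Omega_punc_shiftP _ oTw) [v Tv vx] := oAw.
    have Gw' := GV Gw.
    move: Tv => /rotP => /(_ Gw) /shiftP; rewrite opprK => Tv.
    exists (shift_tile (puncture w.1) (rot_tile (invmx w.2) v)) => _; split=> //.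
    have pv : ptile v.
      have := Omega_ptile oT Tv => /(ptile_shift (- puncture w.1)).
      by rewrite shift_tileK => /(ptile_rot Gw); rewrite rot_tileVK.
    by rewrite puncture_shift ?puncture_rot ?vx //; exact: ptile_rot.
  pose A1 := (W n `&` pt @^-1` A) `&` [set w | ~ E w.1].
  have NA : (N n A <= ncard (E `*` G) + ncard A1)%N.
    have fE : finite_set (E `*` G).
      by apply: finite_setX => //; exact: sub_finite_set EQ fQ.
    have fA1 : finite_set A1 by apply: sub_finite_set (fN n A) => w [].
    apply: leq_trans (ncardU_le fE fA1); apply: ncard_sub; first by rewrite finite_setU.
    move=> w Aw; have [Ew|nEw] := pselect (E w.1); last by right.
    by left; split=> //; case: Aw => -[].
  have ND : (ncard A1 <= N n B)%N.
    (* The moved sample is the one at tile [f w] with group element [h *m w.2]; this map is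
       injective and takes samples of [A] away from [E] to samples of [B]. *)
    rewrite -(ncard_image (f := fun w => (f w, h *m w.2))); last 2 first.
    + by apply: sub_finite_set (fN n A) => w [].
    + move=> w w' [Aw _] [Aw' _] [e1 e2].
      have eg : w.2 = w'.2.
        by rewrite -[w.2]mul1mx -(G_mulVmx Gh) -mulmxA e2 mulmxA G_mulVmx // mul1mx.
      have [_ p1] := Hf _ Aw; have [_ p2] := Hf _ Aw'.
      move: p1; rewrite e1 p2 eg => /addIr e.
      have [[Qw _] _] := Aw; have [[Qw' _] _] := Aw'.
      have := Pstar_puncture_inj (Omega_Pstar oT) (QT _ Qw) (QT _ Qw') (esym e).
      by move: eg; case: (w) => ? ?; case: (w') => ? ? /= -> ->.
    apply: ncard_sub => // _ [w [Aw nE] <-]; have [Tu ux] := Hf _ Aw.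
    have [[Qw Gw] ptA] := Aw; have [_ Bw] := AB _ ptA; split.
      split=> /=; last exact: GM.
      apply: HE Qw nE Tu _; rewrite ux addrAC subrr add0r.
      apply: (@le_trans _ _ (Num.bound `|invmx w.2 *m x|)%:R).
        by apply/ltW/archi_boundP.
      by rewrite ler_nat; apply: leq_trans (Hg0 _ Gw) Nn.
    rewrite /pt /= ux rotM // opprD addrC -shiftD rot_shift mulmxN mulmxA.
    by rewrite G_mulmxV // mul1mx.
  rewrite /c ler_pdivrMr // mulrDl divfK ?gt_eqF //.
  apply: (@le_trans _ _ (ncard (E `*` G) + ncard A1)%:R); first by rewrite ler_nat.
  rewrite natrD addrC; apply: lerD; first by rewrite ler_nat.
  exact: ncard_setX_ratio.
Qed.

(** Under this condition range and source map [basicY F x g] onto basic sets of units. *)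
Definition centred F x := (exists2 t, F t & puncture t = 0) /\ (exists2 t, F t & puncture t = x).

(** Second countability with pieces whose ranges and sources are clopen, so that measures of open
    sets reduce to contents. Codes that do not describe a suitable piece contribute the empty
    set. *)
Lemma open_basic_cover (A : set Y) : rel_open C A -> exists B : nat -> set Y,
  A = \bigcup_n B n /\ forall n, B n = set0 \/ exists F x g,
    [/\ finite_set F, G g, centred F x & B n = basicY F x g].
Proof.
move=> [W oW AE]; have [e He] := tile_enum.
have [gam Hgam] := countable_enum 1%:M (finite_set_countable fG).
pose E (k : {fset nat} * nat * nat) := e @` [set` k.1.1].
pose Ex (k : {fset nat} * nat * nat) := puncture (e k.1.2).
pose B k : set Y := basicY (E k) (Ex k) (gam k.2).
pose good k := [/\ G (gam k.2), centred (E k) (Ex k) & B k `<=` A].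
exists (fun n => if @choice.unpickle ({fset nat} * nat * nat)%type n is Some k then [set y | good k /\ B k y] else set0).
split; last first.
  move=> n; case: (choice.unpickle n) => [k|]; last by left.
  have [gk|gk] := pselect (good k); last by left; rewrite -subset0 => y [].
  have [Gg cF _] := gk; right; exists (E k), (Ex k), (gam k.2); split=> //.
    exact: finite_image.
  by apply/seteqP; split=> y; [case|].
apply/seteqP; split=> y; last first.
  by move=> [n _]; case: (choice.unpickle n) => // k [[_ _ BA] By]; exact: BA.
move=> Ay; have [Cy Wy] : C y /\ W y by move: Ay; rewrite AE.
have [Ry Gy] := Cy; have [oT oT' _] := Ry.
have [F [x [fF yF _ F0 Fx]]] := H_nbhd C_subgroupoid (rel_open_self C) Cy.
have /(nbhsY _ Ry) [F' [x' [fF' yF' FW']]] : nbhs y W by exact: open_nbhs_nbhs.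
have [[_ Fy yE] _] := yF.
have xx' : x' = x by case: yF' => _ _ yE'; exact: Rpunc_uniq Ry yE' yE.
pose F1 := F `|` F'.
have fF1 : finite_set F1 by rewrite /F1 finite_setU.
have F1y : F1 `<=` y.1.1 by case: yF' => _ F'y _ t [/Fy|/F'y].
have /choice [c Hc] : forall t, exists n, F1 t -> e n = t.
  move=> t; have [Ft|Ft] := pselect (F1 t); last by exists 0.
  by have [n en] := He _ _ oT (F1y _ Ft); exists n.
have [i ix] : exists i, puncture (e i) = x.
  by have [t Ft <-] := Fx; have [i ei] := He _ _ oT (Fy _ Ft); exists i; rewrite ei.
have [j gj] := Hgam _ Gy.
have FE : e @` [set` fset_set (c @` F1)] = F1.
  apply/seteqP; split=> [_ [n /= nF <-]|t Ft].
    move: nF; rewrite in_fset_set ?inE => [[t Ft <-]|]; last exact: finite_image.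
    by rewrite Hc.
  exists (c t); last exact: Hc.
  by rewrite /= in_fset_set ?inE; [exists t|exact: finite_image].
exists (choice.pickle (fset_set (c @` F1), i, j)) => //.
rewrite choice.pickleK /good /B /E /Ex /= FE ix gj; split; last by split=> //; split.
split=> //.
  by split; [have [t ? ?] := F0|have [t ? ?] := Fx]; exists t => //; left.
move=> z [[Rz F1z zE] /= zg]; rewrite AE; split.
  by split=> //; rewrite zg.
apply: FW'; rewrite xx'; split=> //=; split=> // t Ft; apply: F1z; by right.
Qed.

Lemma rng_basicY F x g : G g -> centred F x ->
  grng O @` basicY F x g = basicY F 0 1%:M.
Proof.
move=> Gg [_ [t Ft tx]]; apply/seteqP; split=> [_ [[[T T'] h] [[Rz Fz _] _] <-]|].
  by apply/basicY0P; split=> //; case: Rz.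
move=> [[T T'] h] [[Rz Fz /= zE] /= ->].
have [oT _ _] := Rz; rewrite oppr0 shift0 in zE.
exists ((T, shift (- x) T), g); last by rewrite /= zE.
split=> //; split=> //; split=> //=; last by exists (- x).
by apply/Omega_punc_shiftP; [case: oT|exists t => //; exact: Fz].
Qed.

Lemma src_basicY F x g : G g -> centred F x ->
  gsrc O @` basicY F x g = basicY (rot (invmx g) (shift (- x) F)) 0 1%:M.
Proof.
move=> Gg [[t Ft t0] _]; have Gg' := GV Gg.
apply/seteqP; split=> [_ [[[T T'] h] [[Rz Fz /= zE] /= hg] <-]|].
  have [_ oT' _] := Rz; rewrite /= /rot_pair /= hg; apply/basicY0P.
  split; first exact: Omega_punc_rot.
  by rewrite zE; apply: rot_sub; exact: shift_sub.
move=> [[T1 T'] h] [[Rz Fz /= zE] /= ->].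
have [oT1 _ _] := Rz; rewrite oppr0 shift0 in zE.
have oU := Omega_punc_rot Gg oT1.
have FU : shift (- x) F `<=` rot g T1.
  by rewrite -[shift _ F](rotVK Gg); exact: rot_sub.
have Tt : rot g T1 (shift_tile (- x) t) by apply: FU; exact: shift_in.
have pt : ptile t.
  by have := ptile_shift x (Omega_ptile oU.1 Tt); rewrite shift_tileNK.
have oV : Omega_punc (shift x (rot g T1)).
  rewrite -[x]opprK; apply/Omega_punc_shiftP; first by case: oU.
  by exists (shift_tile (- x) t) => //; rewrite puncture_shift // t0 addr0.
exists ((shift x (rot g T1), rot g T1), g); last first.
  by rewrite /= /rot_pair /= rotK // zE.
split=> //; split=> //=; last by rewrite shiftK.
  by split=> //; exists (- x); rewrite shiftK.
by rewrite -[F](shiftNK x); apply: shift_sub.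
Qed.

Lemma trace_clopen_basicY F : finite_set F -> trace_clopen (units O C) (basicY F 0 1%:M).
Proof.
move=> fF; have bU : basicY F 0 1%:M `<=` units O C.
  rewrite units_basicY basicY0_units; exact: subIsetl.
split.
  apply: open_comp; first by move=> ? _; exact: initial_continuous.
  exact: open_basicY.
apply: compact_closed; first exact: H_hausdorff units_subgroupoid.
exact: compact_val_basicY.
Qed.

Lemma rel_open_basicY F : finite_set F -> rel_open (units O C) (basicY F 0 1%:M).
Proof.
move=> fF; exists (basicY F 0 1%:M); first exact: open_basicY.
by rewrite units_basicY -basicY0_units.
Qed.

(** Minimality says that each punctured tiling contains some translate of [F]; compactness of the
    unit space reduces to finitely many translates. *)
Lemma cylinders_cover F : legal F -> finite_set F -> exists J : set V,
  finite_set J /\ forall T, Omega_punc T -> exists2 x, J x & shift x F `<=` T.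
Proof.
move=> lF fF.
have cU : compact (units O C) by rewrite units_basicY; exact: compact_basicY.
move: cU; rewrite compact_cover.
move=> /(_ {classic V} setT (fun x => basicY (shift x F) 0 1%:M)) [x _|_ /unitsP [T oT ->]|J _ HJ].
- by apply: open_basicY; exact: finite_image.
- have [x xT] := Omega_legal_shift oT.1 lF.
  by exists x => //; apply/basicY0P.
exists [set` J]; split=> [|T oT]; first exact: (@finite_fset {classic V}).
have [|x Jx /basicY0P [_ xT]] := HJ (diag T); first by apply/unitsP; exists T.
by exists x.
Qed.

Lemma invariant_probability : exists mu : probability (borel_units O C) R,
  [/\ mu (units O C) = 1%E, invariant_measure mu &
      forall U : set Y, rel_open (units O C) U -> U !=set0 -> (0 < mu U)%E].
Proof.
have [m [m_ge0 mU mO mnO m_inv]] := invariant_mean.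
pose mY (A : set Y) : R := m [set T | A (diag T)].
have diagU T : units O C (diag T) <-> Omega_punc T.
  by split=> [/unitsP [T' oT' [->]]//|oT]; apply/unitsP; exists T.
have mYU (A B : set Y) : A `&` B = set0 -> mY (A `|` B) = mY A + mY B.
  move=> AB; rewrite -mU; first by [].
  by rewrite -subset0 => T AB'; have : (A `&` B) (diag T) by []; rewrite AB.
have mYn : mY (~` units O C) = 0.
  rewrite -mnO; congr m; apply/seteqP; split=> T /= H; first by move/diagU.
  by move/diagU.
have mYO : mY (units O C) = 1.
  by rewrite -mO; congr m; apply/seteqP; split=> T /= /diagU.
have cU : compact (units O C) by rewrite units_basicY; exact: compact_basicY.
have openC A : rel_open (units O C) A -> rel_open C A.
  have [W oW WE] := units_open; move=> [W' oW' ->]; exists (W `&` W'); first exact: openI.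
  by rewrite WE setIA.
(* A piece consisting of units is its own range, hence a basic set of units, which is trace
   clopen. *)
have GB : rel_open (units O C) `<=` <<s trace_clopen (units O C) >>.
  move=> A rA; have [B [AE HB]] := open_basic_cover (openC _ rA).
  rewrite AE; apply: sigma_algebra_bigcup => n.
  have [->|[F [x [g [fF Gg cF BE]]]]] := HB n; first exact: sigma_algebra0.
  apply: sub_sigma_algebra.
  suff -> : B n = basicY F 0 1%:M by exact: trace_clopen_basicY.
  rewrite -(rng_basicY Gg cF) -BE.
  have BU : B n `<=` units O C by move=> y By; case: rA => W _ E; have : A y by [rewrite AE; exists n]; rewrite E => -[].
  apply/seteqP; split=> [y By|_ [y By <-]].
    by exists y => //; have /unitsP [T _ ->] := BU _ By.
  by have /unitsP [T _ yE] := BU _ By; move: By; rewrite yE.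
have [mu0 Hmu0] := content_extension cU (fun A => m_ge0 [set T | A (diag T)]) mYU mYn GB.
have mu_clopen A : trace_clopen (units O C) A -> mu0 A = (mY A)%:E by exact: Hmu0.
have mu_T : mu0 setT = 1%E.
  rewrite mu_clopen; last by rewrite -setC0; apply: trace_clopenC; exact: trace_clopen0.
  by rewrite -mYO; congr EFin; apply: (content_trace (K := units O C) (fun A => m_ge0 [set T | A (diag T)]) mYU mYn); rewrite setTI setIid.
have [mu Hmu] : exists mu : probability (borel_units O C) R, forall A, mu A = mu0 A.
  by have [Q HQ] := measure_probability mu_T; exists Q.
have mu_c A : trace_clopen (units O C) A -> mu A = (mY A)%:E by rewrite Hmu; exact: mu_clopen.
have mB F : finite_set F -> @measurable _ (borel_units O C) (basicY F 0 1%:M).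
  by move=> fF; apply: sub_sigma_algebra; exact: rel_open_basicY.
exists mu; split.
- by rewrite mu_c ?mYO //; exact: trace_clopen_self.
- move=> A [AC rI sI] rA; have [B [AE HB]] := open_basic_cover rA.
  have BA n : B n `<=` A by rewrite AE => y By; exists n.
  have cl (f : Y -> Y) : (forall F x g, finite_set F -> G g -> centred F x ->
      exists2 F', finite_set F' & f @` basicY F x g = basicY F' 0 1%:M) ->
      forall n, trace_clopen (units O C) (f @` B n) /\
        @measurable _ (borel_units O C) (f @` B n).
    move=> Hf n; have [->|[F [x [g [fF Gg cF ->]]]]] := HB n.
      by rewrite image_set0; split; [exact: trace_clopen0|exact: measurable0].
    have [F' fF' ->] := Hf _ _ _ fF Gg cF.
    by split; [exact: trace_clopen_basicY|exact: mB].
  have Hr : forall n, trace_clopen (units O C) (grng O @` B n) /\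
        @measurable _ (borel_units O C) (grng O @` B n).
    by apply: cl => F x g fF Gg cF; exists F => //; exact: rng_basicY.
  have Hs : forall n, trace_clopen (units O C) (gsrc O @` B n) /\
        @measurable _ (borel_units O C) (gsrc O @` B n).
    apply: cl => F x g fF Gg cF; exists (rot (invmx g) (shift (- x) F)).
      by do 2!apply: finite_image.
    exact: src_basicY.
  (* The same disjoint pieces of [A] serve range and source. Their images are trace clopen, so the
     comparison is between contents, piece by piece. *)
  have muE (f : Y -> Y) : set_inj A f -> (forall n, trace_clopen (units O C) (f @` B n) /\
        @measurable _ (borel_units O C) (f @` B n)) ->
      mu (f @` A) = (\sum_(0 <= n <oo) (mY (f @` seqDU B n))%:E)%E.
    move=> fI Hf; rewrite {1}AE image_bigcup seqDU_bigcup_eq.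
    have mD n : @measurable _ (borel_units O C) (seqDU (fun k => f @` B k) n).
      by apply: seqDU_measurable => k; case: (Hf k).
    rewrite (measure_semi_bigcup mu mD (trivIset_seqDU _) (bigcupT_measurable _ mD)).
    apply: eq_eseriesr => n _; rewrite (image_seqDU _ fI BA); apply: mu_c.
    rewrite /seqDU setDE -[X in X `&` _]setCK -setCU; apply: trace_clopenC.
    apply: trace_clopenU; first by apply: trace_clopenC; case: (Hf n).
    elim/big_ind: _ => [||k _]; [exact: trace_clopen0|exact: trace_clopenU|by case: (Hf k)].
  rewrite (muE _ rI Hr) (muE _ sI Hs); apply: eq_eseriesr => n _; congr EFin.
  have [F [x [g [Gg DF]]]] : exists F x g, G g /\ seqDU B n `<=` basicY F x g.
    have [Bn0|[F [x [g [_ Gg _ BE]]]]] := HB n.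
      by exists set0, 0, 1%:M; split; [exact: G1|move=> y []; rewrite Bn0].
    by exists F, x, g; split=> // y []; rewrite BE.
  (* On one piece the arrow is a fixed motion from range to source; this motion and its inverse give
     the two inequalities. *)
  have Gg' := GV Gg; apply/le_anti/andP; split.
    apply: (m_inv _ _ x (invmx g)) => // T [[[T1 T'] h] Dy [T1T _]].
    have [[[_ oT' _] _ /= T'E] /= hg] := DF _ Dy; rewrite -T1T -T'E; split=> //.
    by exists ((T1, T'), h) => //; rewrite /= /rot_pair /= hg.
  apply: (m_inv _ _ (- (invmx g *m x)) g) => // T [[[T1 T'] h] Dy [/= TE _]].
  have [[[oT1 _ _] _ /= T'E] /= hg] := DF _ Dy.
  have -> : shift (- - (invmx g *m x)) T = rot (invmx g) T1.
    by rewrite opprK -TE hg T'E rot_shift mulmxN shiftNK.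
  split; first exact: Omega_punc_rot.
  by exists ((T1, T'), h) => //=; rewrite rotVK.
- move=> A rA [y Ay]; have [B [AE HB]] := open_basic_cover (openC _ rA).
  have [n _ Bny] : (\bigcup_n B n) y by rewrite -AE.
  have [Bn0|[F [x [g [fF Gg cF BE]]]]] := HB n; first by move: Bny; rewrite Bn0.
  have AU : A `<=` units O C by case: rA => W _ -> z [].
  have BA : B n `<=` A by rewrite AE => z Bz; exists n.
  have rB : grng O @` B n = B n.
    apply/seteqP; split=> [_ [z Bz <-]|z Bz].
      by have /unitsP [T _ zE] := AU _ (BA _ Bz); move: Bz; rewrite zE.
    by exists z => //; have /unitsP [T _ ->] := AU _ (BA _ Bz).
  have {}BE : B n = basicY F 0 1%:M by rewrite -(rng_basicY Gg cF) -BE.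
  have mA : @measurable _ (borel_units O C) A by exact: sub_sigma_algebra.
  apply: (@lt_le_trans _ _ (mu (basicY F 0 1%:M))); last first.
    by apply: le_measure; rewrite ?inE //; [exact: mB|rewrite -BE].
  rewrite mu_c ?lte_fin; last exact: trace_clopen_basicY.
  rewrite lt0r m_ge0 andbT; apply/eqP => mF0.
  have /unitsP [T oT yE] := AU _ Ay.
  have FT : F `<=` T by move: Bny; rewrite BE yE => /basicY0P [].
  have /Omega_puncP [oT' [p Pp Tp]] := oT.
  have fQ : finite_set (F `|` [set p]) by rewrite finite_setU.
  have lQ : legal (F `|` [set p]).
    by apply: (Omega_legal oT') => // t [/FT|->].
  have [J [fJ HJ]] := cylinders_cover lQ fQ.
  (* Recentring at [w] maps [E w] into the cylinder of [F], so all these sets would be null, though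
     finitely many of them cover [Omega_punc]. The prototile [p] ensures a puncture at [w]. *)
  pose E w := [set T | Omega_punc T /\ shift w (F `|` [set p]) `<=` T].
  have mE w : m (E w) = 0.
    apply/le_anti; rewrite m_ge0 andbT -mF0 /mY.
    apply: (m_inv _ _ w 1%:M); first exact: G1.
    move=> T' [oT2 wT]; rewrite rot1; split.
      apply/Omega_punc_shiftP; first by case: oT2.
      exists (shift_tile w p); first by apply: wT; apply: shift_in; right.
      exact: puncture_proto.
    apply/basicY0P; split.
      apply/Omega_punc_shiftP; first by case: oT2.
      exists (shift_tile w p); first by apply: wT; apply: shift_in; right.
      exact: puncture_proto.
    by move=> t Ft; apply/shiftP; rewrite opprK; apply: wT; apply: shift_in; left.
  have m_le A1 A2 : A1 `<=` A2 -> m A1 <= m A2.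
    by move=> A12; rewrite -(setDUK A12) mU ?lerDl // setDE setIC -setIA setICl setI0.
  have m0 : m (\bigcup_(w in J) E w) = 0.
    elim/finite_set_rec: J / fJ {HJ} => [|w J _ _ IH].
      rewrite bigcup_set0; apply/le_anti; rewrite m_ge0 andbT -mnO.
      by apply: m_le.
    rewrite bigcup_setU1 -[_ `|` _](setDUK (@subsetUl _ (E w) _)) mU; last first.
      by rewrite setDE setIC -setIA setICl setI0.
    rewrite mE add0r; apply/le_anti; rewrite m_ge0 andbT -IH.
    by apply: m_le => z [[]].
  have : m Omega_punc <= m (\bigcup_(w in J) E w).
    by apply: m_le => T' oT2; have [w Jw wT] := HJ _ oT2; exists w.
  by rewrite m0 mO ler10.
Qed.

(** Any orbit meets every cylinder, by minimality, and a closed invariant set contains the closure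
    of its orbits. The measure condition thus concerns only the full unit space. *)
Lemma invariant_units (E : set Y) : invariant_set O C E ->
  rel_closed (units O C) E -> E !=set0 -> E = units O C.
Proof.
move=> [EU invE] [W cW EW] [y Ey].
apply/seteqP; split=> // _ /unitsP [T' oT' ->].
have /unitsP [T oT yE] := EU _ Ey.
have uT' : units O C (diag T') by apply/unitsP; exists T'.
rewrite EW; split=> //; apply: cW => B /nbhsY => /(_ (Rpunc_diag oT')).
move=> [F [x [fF yF FB]]].
have /Omega_puncP [oT1 [p Pp Tp]] := oT'.
have FT' : F `<=` T' by case: yF.
have lQ : legal (F `|` [set p]).
  by apply: (Omega_legal oT1); [move=> t [/FT'|->]|rewrite finite_setU].
have [w wT] := Omega_legal_shift oT.1 lQ.
have oU : Omega_punc (shift (- w) T).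
  apply/Omega_punc_shiftP; first by case: oT.
  exists (shift_tile w p); first by apply: wT; apply: shift_in; right.
  exact: puncture_proto.
have x0 : x = 0.
  case: yF => _ _ e; apply: (Rpunc_uniq (Rpunc_diag oT') e).
  by rewrite /= oppr0 shift0.
have EwT : E (diag (shift (- w) T)).
  have -> : diag (shift (- w) T) = grng O (((shift (- w) T, T), 1%:M) : Y) by [].
  apply: invE; last by rewrite /= /rot_pair /= invmx1 rot1 -/(diag T) -yE.
  by split; [split=> //; exists w; rewrite shiftNK|exact: G1].
exists (diag (shift (- w) T)); split; first by move: EwT; rewrite EW => -[].
apply: FB; rewrite x0; apply/basicY0P; split=> // t Ft.
by apply/shiftP; rewrite opprK; apply: wT; apply: shift_in; left.
Qed.

Lemma almost_AF (d_gt0 : (0 < d)%N) : almost_AF_cantor_groupoid O R C C0.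
Proof.
split; first exact: (cantor_groupoid_sub d_gt0 C_subgroupoid (rel_open_self _)).
  split; [exact: C0_subgroupoid|exact: C0_open|exact: C0_AF|exact: RAF_thin].
move=> E U invE cE UE [u Uu].
have Eu : E u by move: UE Uu => [W _ ->] [].
have EE : E = units O C by apply: invariant_units => //; exists u.
rewrite EE in UE; have [mu [mu1 mu_inv mu_gt0]] := invariant_probability.
by exists mu; split=> //; apply: mu_gt0 => //; exists u.
Qed.

End prototiles.

Theorem theorem5p4 (R : realType) (d : nat) (L : Type)
    (S : substitution_data R d L) (G : set 'M[R]_d) (la : 'M[R]_d -> L -> L) :
  (0 < d)%N ->
  substitution_tiling_system S ->
  primitive S ->
  finite_local_complexity S ->
  injective_substitution S ->
  border_forcing S ->
  finite_set G ->
  symmetry_group S G la ->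
  free_on_prototiles S G la ->
  almost_AF_cantor_groupoid (semidirect_ops (pair_ops S) (rot_pair la)) R
    (Rpunc S `*` G) (RAF S `*` G).
Proof.
move=> d_gt0 sys prim flc inj _ fG sym freeG.
have [r0 [D [r00 D0 ball bound]]] := prototile_constants sys.
have std : standing S r0 D by split.
exact: (almost_AF std sym fG freeG d_gt0).
Qed.
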